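(* Let $\mathbb K$ be a local field of characteristic different from $2$, or a quaternion division algebra over such a local field. Let $\sigma:x\mapsto\overline x$ be a (possibly trivial) involutive anti-automorphism of $\mathbb K$; if $\mathbb K$ is a quaternion division algebra which is not the Hamilton quaternion algebra, assume that $\sigma$ is the standard quaternionic involution. Let $V$ be a finite-dimensional right $\mathbb K$-vector space of dimension at least $5$, and let $q$ be a nondegenerate $\sigma$-Hermitian form of Witt index $2$ on $V$. Let $\mathcal I$ be the flag complex of nonzero totally isotropic subspaces of $V$, let $\mathcal A$ be its standard apartment, and let $f:\mathcal A\to\mathcal I$ be a morphism. (1) If $f$ is not a quadripod, then $f\in\overline{\operatorname{Mor}_{inj}(\mathcal A,\mathcal I)}^g$. (2) If $f$ is a line-type quadripod, then $f\in\overline{\operatorname{Mor}_{inj}(\mathcal A,\mathcal I)}^g$ if and only if $f$ is symmetric. (3) If $f$ is a plane-type quadripod, then $f\in\overline{\operatorname{Mor}_{inj}(\mathcal A,\mathcal I)}^g$ if and only if either $\sigma\neq\operatorname{id}_{\mathbb K}$, or $\sigma=\operatorname{id}_{\mathbb K}$ and $1-c\in\{q_{an}(v)q_{an}(v')^{-1}: v,v'\in V'\setminus\{0\}\}$, where $c$ is the cross-ratio of $f$. Assume moreover $\sigma=\operatorname{id}_{\mathbb K}$. If $\dim V=5$, then all line-type quadripods belong to $\overline{\operatorname{Mor}_{inj}(\mathcal A,\mathcal I)}^g$, and a plane-type quadripod with cross-ratio $c$ belongs to $\overline{\operatorname{Mor}_{inj}(\mathcal A,\mathcal I)}^g$ if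 and only if $1-c$ is a square in $\mathbb K$. So, when $\dim V=5$, if $\mathbb K=\mathbb R$ the condition on $c$ reduces to $c\le 1$, and if $\mathbb K=\mathbb C$ the condition on $c$ is void. In particular, if $\mathbb K=\mathbb C$ (and $\sigma=\operatorname{id}$), then $\operatorname{Mor}(\mathcal A,\mathcal I)=\overline{\operatorname{Mor}_{inj}(\mathcal A,\mathcal I)}^g$.
   Context: A local field is a field with a non-trivial valuation (absolute value), complete and locally compact: $\mathbb R$, $\mathbb C$, a finite extension of $\mathbb Q_p$, or $\mathbb F_q((t))$. A $\sigma$-Hermitian form is given by $\varphi:V\times V\to\mathbb K$, additive in each variable, with $\varphi(vx,wy)=\sigma(x)\varphi(v,w)y$ and $\varphi(w,v)=\sigma(\varphi(v,w))$; $q(v)=\varphi(v,v)$. Witt index $2$ means that all maximal totally isotropic subspaces have dimension $2$. If $\sigma=\operatorname{id}_{\mathbb K}$ then $\mathbb K$ is commutative. The standard quaternionic involution sends $i,j,k=ij$ to $-i,-j,-k$ and fixes the centre. $\mathcal I$ is a spherical building of type $C_2$. Its vertices are the isotropic lines (line-type) and the totally isotropic $2$-planes (plane-type) of $V$; its edges (Weyl chambers) are the incident pairs. The space $\operatorname{Cham}(\mathcal I)$ of edges has the compact topology induced by $\mathbb P(V)\times\mathcal{G}r_2(V)$. Fix a free family $(e_1,e_2,e_3,e_4)$ of isotropic vectors such that $\langle e_1,e_3\rangle$ and $\langle e_2,e_4\rangle$ are orthogonal hyperbolic planes with $\varphi(e_1,e_3)=\varphi(e_2,e_4)=1$. The standard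 apartment $\mathcal A$ is the octagon with line-type vertices $\langle e_i\rangle$ and plane-type vertices $\langle e_1,e_2\rangle,\langle e_2,e_3\rangle,\langle e_3,e_4\rangle,\langle e_4,e_1\rangle$. $V'$ is the orthogonal complement of $\langle e_1,e_2,e_3,e_4\rangle$ and $q_{an}=q|_{V'}$, which is anisotropic. A morphism is a (not necessarily injective) type-preserving simplicial map. $\operatorname{Mor}(\mathcal A,\mathcal I)$ is the set of morphisms with the topology induced by the product topology on $\operatorname{Cham}(\mathcal I)^{\operatorname{Cham}(\mathcal A)}$; $\operatorname{Mor}_{inj}(\mathcal A,\mathcal I)$ is the subset of injective morphisms and $\overline{\operatorname{Mor}_{inj}(\mathcal A,\mathcal I)}^g$ its closure. A (marked) quadripod is a morphism $f:\mathcal A\to\mathcal I$ whose image consists of four pairwise distinct and pairwise intersecting edges; its type (line-type or plane-type) is the type of the common vertex. For a line-type quadripod with common isotropic line $\ell$, put $P_1=f(\langle e_1,e_2\rangle)$, $P_2=f(\langle e_2,e_3\rangle)$, $P_3=f(\langle e_3,e_4\rangle)$, $P_4=f(\langle e_4,e_1\rangle)$. The dimension of $f$ is the dimension of the span of $P_1,\dots,P_4$. $f$ is symmetric if its dimension is at most $4$ and for all $i\in\{1,2,3,4\}$ there exists $v_i\in P_i\setminus\ell$ such that $v_1+v_2+v_3+v_4=0$ and $\varphi(v_2,v_3)=\varphi(v_1,v_4)$ (equivalently $\varphi(v_1,v_2)=\varphi(v_4,v_3)$). For a plane-type quadripod $f$ with $\mathbb K$ commutative, the cross-ratio of $f$ is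 the cross-ratio of the four lines $(f(\langle e_1\rangle),f(\langle e_2\rangle),f(\langle e_3\rangle),f(\langle e_4\rangle))$ in the common plane, where the cross-ratio of $(y_1,y_2,y_3,y_4)$ on a projective line is $h(y_4)$ for the homography $h$ with $h(y_1)=\infty$, $h(y_2)=0$, $h(y_3)=1$.
   Formalization: The involution σ is assumed continuous; this excludes only the discontinuous (''wild'') involutions of K = C, for which Cham(I) is not compact and part (2) fails. *)

(* Defs.v *)
From HB Require Import structures.
From mathcomp Require Import all_boot all_order all_algebra all_field.
From mathcomp Require Import all_classical all_reals.
From mathcomp Require Import topology normedtype.
From mathcomp Require Import complex.

Set Implicit Arguments.
Unset Strict Implicit.
Unset Printing Implicit Defensive.

Import Order.TTheory GRing.Theory Num.Theory.
Import numFieldNormedType.Exports.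

Local Open Scope classical_set_scope.
Local Open Scope ring_scope.

Record absolute_value (R : realType) (F : fieldType) := AbsoluteValue {
  absv :> F -> R;
  absv_ge0 : forall x, 0 <= absv x;
  absv_eq0 : forall x, absv x = 0 <-> x = 0;
  absvM : forall x y, absv (x * y) = absv x * absv y;
  absvD : forall x y, absv (x + y) <= absv x + absv y
}.

(* F as a metric space for the distance v (x - y). *)
Definition valued (R : realType) (F : fieldType) (v : absolute_value R F) :
  Type := F.

Section ValuedField.
Variables (R : realType) (F : fieldType) (v : absolute_value R F).

HB.instance Definition _ := Choice.on (valued v).

Definition valued_dist (x y : valued v) : R := v ((x : F) - (y : F)).

Lemma absvN x : v (- x) = v x.
Proof.
have v1 : v 1 = 1.
  have v1n0 : v 1 != 0 by apply/eqP => /absv_eq0/eqP; rewrite oner_eq0.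
  by apply: (mulIf v1n0); rewrite -absvM !mul1r.
suff vN1 : v (- 1) = 1 by rewrite -mulN1r absvM vN1 mul1r.
apply/eqP; rewrite -(@eqrXn2 _ 2) ?absv_ge0 //.
by rewrite expr2 -absvM mulN1r opprK v1 expr1n.
Qed.

Lemma valued_distxx x : valued_dist x x = 0.
Proof. by rewrite /valued_dist subrr; apply/absv_eq0. Qed.

Lemma valued_dist_positivity x y : valued_dist x y = 0 -> x = y.
Proof. by move/absv_eq0/eqP; rewrite subr_eq0 => /eqP. Qed.

Lemma valued_dist_sym x y : valued_dist x y = valued_dist y x.
Proof. by rewrite /valued_dist -absvN opprB. Qed.

Lemma valued_dist_triangle y x z :
  valued_dist x z <= valued_dist x y + valued_dist y z.
Proof.
by rewrite /valued_dist (le_trans _ (absvD _ _ _)) // addrA subrK.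
Qed.

HB.instance Definition _ := isMetric.Build R (valued v)
  valued_distxx valued_dist_positivity valued_dist_sym valued_dist_triangle.

Definition local_field : Prop :=
  [/\ exists x : F, x != 0 /\ v x != 1,
      forall G : set_system (valued v), ProperFilter G -> cauchy G ->
        exists x : valued v, G --> x
    & locally_compact [set: valued v]].

(* Isomorphism of topological fields onto F; used for A the field of real or
   complex numbers. *)
Definition topological_iso (A : numFieldType) (h : {rmorphism A -> F}) : Prop :=
  exists g : valued v -> A,
    [/\ cancel h g, cancel g h, continuous (h : A -> valued v) & continuous g].

End ValuedField.

Section CanonicalTopology.
Variables (R : realType) (F : fieldType) (v : absolute_value R F).
Variable W : zmodType.
Variable act : F -> W -> W.

Definition Flinear_form : set (W -> F) :=
  [set l | forall a w w', l (act a w + w') = a * l w + l w'].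

Definition eval_forms (w : W) : {ptws Flinear_form -> valued v} :=
  fun l => (\val l : W -> F) w.

(* The canonical topology of a finite-dimensional F-vector space: as F is
   complete for v, it is the coarsest topology making all linear forms continuous. *)
Definition fd_topology : Type := initial_topology eval_forms.
HB.instance Definition _ := Topological.copy fd_topology
  (initial_topology eval_forms).

End CanonicalTopology.

Section ScalarAlgebra.
Variables (R : realType) (F : fieldType) (v : absolute_value R F).
Variable K : falgType F.

Definition quaternion_generators (i j : K) : Prop :=
  exists a b : F,
    [/\ [/\ a != 0 & b != 0],
        i ^+ 2 = a%:A, j ^+ 2 = b%:A, i * j = - (j * i)
      & basis_of {:K} [:: 1; i; j; i * j]].

Definition quaternion_division_algebra : Prop :=
  (forall x : K, x != 0 -> x \is a GRing.unit) /\
  exists i j, quaternion_generators i j.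

Definition Hamilton_quaternions : Prop :=
  (exists h : {rmorphism R -> F}, topological_iso v h) /\
  exists i j, [/\ quaternion_generators i j,
    i ^+ 2 = - 1 :> K & j ^+ 2 = - 1 :> K].

Definition scalar_topology := fd_topology v (fun (a : F) (x : K) => a *: x).

Variable sigma : K -> K.

Definition involutive_antiautomorphism : Prop :=
  [/\ forall x y, sigma (x + y) = sigma x + sigma y,
      forall x y, sigma (x * y) = sigma y * sigma x
    & involutive sigma].

Definition standard_quaternionic_involution : Prop :=
  exists i j, [/\ quaternion_generators i j,
    [/\ sigma i = - i, sigma j = - j & sigma (i * j) = - (i * j)]
    & forall a : F, sigma a%:A = a%:A].

(* Over local fields and quaternion division algebras, this excludes only the
   wild involutions of the field of complex numbers, for which isotropy would
   not be a closed condition. *)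
Definition sigma_continuous : Prop :=
  continuous (sigma : scalar_topology -> scalar_topology).

End ScalarAlgebra.

Section RightVectorSpaces.
Variables (R : realType) (F : fieldType) (v : absolute_value R F).
Variable K : falgType F.
Variable V : vectType K^c.

(* A left module over the opposite ring K^c is a right K-module. *)
Definition rscale (v : V) (x : K) : V := (x : K^c) *: v.

Definition subspace (U : set V) : Prop :=
  [/\ U 0, forall u v, U u -> U v -> U (u + v)
    & forall u x, U u -> U (rscale u x)].

Definition spanned (A : set V) : set V := smallest subspace A.

Definition free_family d (e : 'I_d -> V) : Prop :=
  forall a : 'I_d -> K, \sum_i rscale (e i) (a i) = 0 -> forall i, a i = 0.

Definition has_dim (U : set V) (d : nat) : Prop :=
  exists e : 'I_d -> V, free_family e /\ U = spanned (range e).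

Definition Vtop := fd_topology v (fun (a : F) (v : V) => rscale v a%:A).

Section Grassmannian.
Variable d : nat.

Definition frame : Type := [set e : {ptws 'I_d -> Vtop} | free_family e].
HB.instance Definition _ := Topological.on frame.

Definition grassmannian : Type := [set U : set Vtop | has_dim U d].
HB.instance Definition _ := Choice.on grassmannian.

Lemma frame_span_subproof (e : frame) :
  spanned (range (\val e : 'I_d -> V)) \in [set U : set Vtop | has_dim U d].
Proof. by case: e => e /= /set_mem fe; apply/mem_set; exists e. Qed.

Definition frame_span (e : frame) : grassmannian :=
  exist (fun U => U \in [set U : set Vtop | has_dim U d]) _
    (frame_span_subproof e).

(* Quotient topology of the space of frames. *)
Definition grassmannian_open (A : set grassmannian) : Prop :=
  open (frame_span @^-1` A).

Lemma grassmannian_openT : grassmannian_open setT.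
Proof. exact: openT. Qed.

Lemma grassmannian_openI : setI_closed grassmannian_open.
Proof. by move=> A B; exact: openI. Qed.

Lemma grassmannian_open_bigU (I : Type) (A : I -> set grassmannian) :
  (forall i, grassmannian_open (A i)) -> grassmannian_open (\bigcup_i A i).
Proof. by move=> oA; apply: bigcup_open => i _; exact: oA. Qed.

HB.instance Definition _ := isOpenTopological.Build grassmannian
  grassmannian_openT grassmannian_openI grassmannian_open_bigU.

Definition space (U : grassmannian) : set V := \val U.

End Grassmannian.

Section Building.
Variables (sigma : K -> K) (phi : V -> V -> K).

Definition hermitian_form : Prop :=
  [/\ forall u v w, phi (u + v) w = phi u w + phi v w,
      forall u v w, phi u (v + w) = phi u v + phi u w,
      forall v w x y, phi (rscale v x) (rscale w y) = sigma x * phi v w * y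
    & forall v w, phi w v = sigma (phi v w)].

Definition nondegenerate_form : Prop :=
  forall v, (forall w, phi v w = 0) -> v = 0.

Definition totally_isotropic (U : set V) : Prop :=
  forall u v, U u -> U v -> phi u v = 0.

Definition maximal_totally_isotropic (U : set V) : Prop :=
  [/\ subspace U, totally_isotropic U
    & forall W, subspace W -> totally_isotropic W -> U `<=` W -> W = U].

Definition Witt_index (m : nat) : Prop :=
  forall U, maximal_totally_isotropic U -> has_dim U m.

Definition line_vertex : Type :=
  [set L : grassmannian 1 | totally_isotropic (space L)].
HB.instance Definition _ := Topological.on line_vertex.

Definition plane_vertex : Type :=
  [set P : grassmannian 2 | totally_isotropic (space P)].
HB.instance Definition _ := Topological.on plane_vertex.

Definition line_space (l : line_vertex) : set V := space (\val l).
Definition plane_space (P : plane_vertex) : set V := space (\val P).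

Definition chamber : Type :=
  [set c : line_vertex * plane_vertex | line_space c.1 `<=` plane_space c.2].
HB.instance Definition _ := Topological.on chamber.

(* The indices 0, 1, 2, 3 : 'I_4 stand for 1, 2, 3, 4; addition in 'I_4 is
   modulo 4. *)
Variable e : 'I_4 -> V.

Definition standard_frame : Prop :=
  [/\ free_family e, forall i, phi (e i) (e i) = 0,
      phi (e 0) (e 2) = 1, phi (e 1) (e 3) = 1
    & forall u v, spanned [set e 0; e 2] u -> spanned [set e 1; e 3] v ->
        phi u v = 0].

Definition core_orthogonal : set V := [set v | forall i, phi (e i) v = 0].

(* The vertices <e_i> and <e_j, e_(j+1)> of the standard apartment are labelled
   by i and j; the labelling is injective for a free family e. *)
Definition apt_line (i : 'I_4) : set V := spanned [set e i].
Definition apt_plane (j : 'I_4) : set V := spanned [set e j; e (j + 1)].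

Definition apt_chamber : Type :=
  [set c : 'I_4 * 'I_4 | apt_line c.1 `<=` apt_plane c.2].

Record morphism := Morphism {
  mline : 'I_4 -> line_vertex;
  mplane : 'I_4 -> plane_vertex;
  morphism_incident : forall i j, apt_line i `<=` apt_plane j ->
    line_space (mline i) `<=` plane_space (mplane j)
}.
HB.instance Definition _ := gen_eqMixin morphism.
HB.instance Definition _ := gen_choiceMixin morphism.

Lemma mchamber_subproof (f : morphism) (c : apt_chamber) :
  (mline f (\val c).1, mplane f (\val c).2) \in
  [set c : line_vertex * plane_vertex | line_space c.1 `<=` plane_space c.2].
Proof.
by apply/mem_set => /=; apply: morphism_incident; exact: (set_mem (valP c)).
Qed.

Definition mchamber (f : morphism) : {ptws apt_chamber -> chamber} :=
  fun c => exist (fun c => c \in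
      [set c : line_vertex * plane_vertex | line_space c.1 `<=` plane_space c.2])
    _ (mchamber_subproof f c).

Definition Mor : Type := initial_topology mchamber.
HB.instance Definition _ := Topological.copy Mor (initial_topology mchamber).

Definition Mor_inj : set Mor :=
  [set f : morphism | injective (mline f) /\ injective (mplane f)].

Definition image_chambers (f : morphism) : set chamber := range (mchamber f).

Definition quadripod (f : morphism) : Prop :=
  (image_chambers f #= `I_4)%card /\
  forall c d, image_chambers f c -> image_chambers f d ->
    (\val c).1 = (\val d).1 \/ (\val c).2 = (\val d).2.

Definition line_quadripod (f : morphism) : Prop :=
  quadripod f /\
  exists l, forall c, image_chambers f c -> (\val c).1 = l.

Definition plane_quadripod (f : morphism) : Prop :=
  quadripod f /\
  exists P, forall c, image_chambers f c -> (\val c).2 = P.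

(* Meant for line-type quadripods, whose common line is the image of each
   line-type vertex. *)
Definition symmetric_quadripod (f : morphism) : Prop :=
  (exists2 d, (d <= 4)%N &
     has_dim (spanned (\bigcup_i plane_space (mplane f i))) d) /\
  exists v : 'I_4 -> V,
    [/\ forall i, (plane_space (mplane f i) `\` line_space (mline f 0)) (v i),
        v 0 + v 1 + v 2 + v 3 = 0
      & phi (v 1) (v 2) = phi (v 0) (v 3)].

Definition linear_form (a : V -> K) : Prop :=
  (forall u v, a (u + v) = a u + a v) /\
  (forall u x, a (rscale u x) = a u * x).

(* Homographies from the projective line of the plane P to K + {oo}, where oo
   is None. *)
Definition homography (P : set V) (h : set V -> option K) : Prop :=
  exists a b : V -> K,
    [/\ linear_form a, linear_form b,
        forall u, P u -> a u = 0 -> b u = 0 -> u = 0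
      & forall u, P u -> u != 0 ->
          h (spanned [set u]) = if b u == 0 then None else Some (a u / b u)].

(* Meant for plane-type quadripods, whose common plane is the image of each
   plane-type vertex, and for K commutative. *)
Definition cross_ratio (f : morphism) (c : K) : Prop :=
  exists h, homography (plane_space (mplane f 0)) h /\
    [/\ h (line_space (mline f 0)) = None,
        h (line_space (mline f 1)) = Some 0,
        h (line_space (mline f 2)) = Some 1
      & h (line_space (mline f 3)) = Some c].

End Building.
End RightVectorSpaces.

Arguments Mor_inj {R F} v {K V} phi e.

(* Main.v *)
(* A morphism amounts to isotropic lines L i and totally isotropic planes P i
   with L i and L (i + 1) contained in P i, and it is in the closure of the
   injective ones iff it is a limit of a sequence of them. A configuration in
   which L 0 and L 2, or P 0 and P 2, are opposite can be perturbed into an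
   injective one, because V' is nonzero; every other configuration is first
   perturbed into one of these, except when all L i coincide and the P i are
   distinct or all P i coincide and the L i are distinct.

   For a common line, normalise vectors u_i spanning the lines of a nearby
   injective configuration by phi(y, u_i) = 1. The differences
   d_i = u_(i+1) - u_i have sum zero and satisfy the relation defining symmetry,
   and so do their limits after a common rescaling.

   For a common plane, an approximation to first order in the direction of V'
   and second order in the dual plane exists as soon as one can solve
   A + sigma A = sigma x q(w) x with A (1 - c) skew when sigma is not the identity;
   when sigma = id, one minus the cross-ratio is exactly a quotient of two values
   of q_an along the sequence, and scalars close to 1 are squares. *)

Require Import Defs.
From HB Require Import structures.
From mathcomp Require Import all_boot all_order all_algebra all_field.
From mathcomp Require Import all_classical all_reals.
From mathcomp Require Import topology normedtype sequences.
From mathcomp Require Import complex ring lra interval_inference.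

Set Implicit Arguments.
Unset Strict Implicit.
Unset Printing Implicit Defensive.

Import Order.TTheory GRing.Theory Num.Theory.
Import numFieldNormedType.Exports.

Local Open Scope classical_set_scope.
Local Open Scope ring_scope.
Import VectorInternalTheory.

(** * Absolute values and limits *)

(** Every perturbation is polynomial in one sequence [t n] of nonzero scalars of [F], fixed by
    [sigma] and tending to 0. Such scalars are central, so isotropy and orthogonality of the
    perturbed vectors reduce to identities between coefficients even when [K] is not commutative.
    The topology of morphisms is used in two ways: convergent spanning vectors give convergent
    morphisms, and, the span map on frames being open, a morphism in the closure lifts to convergent
    sequences of spanning vectors. Degenerate morphisms are moved in several stages, since a closure
    is closed.

    The vectors spanning an approximating apartment may come together at unrelated speeds. Division
    by the largest coordinate and an ultrafilter limit keep one difference nonzero; the others then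
    survive because, the Witt index being 2, vectors outside a common line in two distinct totally
    isotropic planes are never orthogonal. Witt's theorem is replaced by the remark that adding to
    [w] an element of a totally isotropic plane orthogonal to [w] does not change [q]; this carries
    values of [q] from one orthogonal complement to another. *)

Section AbsoluteValue.
Variables (R : realType) (F : fieldType) (v : absolute_value R F).

Lemma absv0 : v 0 = 0. Proof. exact/absv_eq0. Qed.

Lemma absv_gt0 x : x != 0 -> 0 < v x.
Proof.
move=> x0; rewrite lt_neqAle absv_ge0 andbT eq_sym.
by apply: contraNN x0 => /eqP/absv_eq0 ->.
Qed.

Lemma absv1 : v 1 = 1.
Proof.
have v1n0 : v 1 != 0 by rewrite gt_eqF// absv_gt0// oner_eq0.
by apply: (mulIf v1n0); rewrite -absvM !mul1r.
Qed.

Lemma absvV x : v x^-1 = (v x)^-1.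
Proof.
have [->|x0] := eqVneq x 0; first by rewrite invr0 absv0 invr0.
have vx0 := absv_gt0 x0; apply: (mulfI (lt0r_neq0 vx0)).
by rewrite -absvM !mulfV// ?absv1// gt_eqF.
Qed.

Lemma absvX x n : v (x ^+ n) = v x ^+ n.
Proof. by elim: n => [|n IH]; rewrite ?absv1// !exprS absvM IH. Qed.

Lemma absvB x y : v (x - y) <= v x + v y.
Proof. by rewrite (le_trans (absvD _ _ _))// absvN. Qed.

Lemma absv_distC x y : v (x - y) = v (y - x).
Proof. by rewrite -absvN opprB. Qed.

(** Stated for an arbitrary set system, so that the same rules serve sequences, neighbourhood
    filters and ultrafilters. *)
Definition cvF (T : Type) (U : set_system T) (x : T -> F) (l : F) :=
  forall eps : R, 0 < eps -> U [set n | v (x n - l) < eps].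

Lemma ballvE (x : valued v) e y : ball x e y <-> v ((x : F) - (y : F)) < e.
Proof. by rewrite ballEmdist. Qed.

Lemma cvFP (T : Type) (U : set_system T) (x : T -> F) (l : F) : Filter U ->
  cvF U x l <-> ((x : T -> valued v) @ U --> (l : valued v)).
Proof.
move=> FU; split=> [cx A /nbhs_ballP [e /= e0 eA]|cx e e0].
  change (U (x @^-1` A)); apply: filterS (cx _ e0) => n /= ne; apply: eA; apply/ballvE.
  by rewrite absv_distC.
have /cx : nbhs (l : valued v) (ball (l : valued v) e) by exact: nbhsx_ballx.
rewrite /nbhs /= => cxb; apply: filterS cxb => n /= /ballvE.
by rewrite absv_distC.
Qed.

Section FilterLimits.
Context (T : Type) (U : set_system T) {FU : Filter U}.

Lemma cvF_cst a : cvF U (fun=> a) a.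
Proof. by move=> e e0; apply: filterS filterT => n _ /=; rewrite subrr absv0. Qed.

Lemma cvF_ext x y l : (forall n, x n = y n) -> cvF U x l -> cvF U y l.
Proof. by move=> xy cx e e0; apply: filterS (cx e e0) => n /=; rewrite xy. Qed.

Lemma cvFD x y a b : cvF U x a -> cvF U y b -> cvF U (fun n => x n + y n) (a + b).
Proof.
move=> cx cy e e0; have e20 : 0 < e / 2 by rewrite divr_gt0.
apply: filterS2 (cx _ e20) (cy _ e20) => n /= xe ye.
have -> : x n + y n - (a + b) = (x n - a) + (y n - b) by ring.
by rewrite (le_lt_trans (absvD _ _ _))// (splitr e) ltrD.
Qed.

Lemma cvFN x a : cvF U x a -> cvF U (fun n => - x n) (- a).
Proof.
move=> cx e e0; apply: filterS (cx _ e0) => n /=.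
by rewrite -opprD absvN.
Qed.

Lemma cvFB x y a b : cvF U x a -> cvF U y b -> cvF U (fun n => x n - y n) (a - b).
Proof. by move=> cx cy; apply: cvFD => //; exact: cvFN. Qed.

Lemma cvFM x y a b : cvF U x a -> cvF U y b -> cvF U (fun n => x n * y n) (a * b).
Proof.
move=> cx cy e e0.
pose d := Num.min 1 (e / (v a + v b + 1)).
have s0 : 0 < v a + v b + 1 by rewrite ltr_wpDl// addr_ge0// absv_ge0.
have d0 : 0 < d by rewrite lt_min ltr01 divr_gt0.
apply: filterS2 (cx _ d0) (cy _ d0) => n /= xd yd.
have -> : x n * y n - a * b =
  (x n - a) * (y n - b) + a * (y n - b) + (x n - a) * b by ring.
have d1 : d <= 1 by rewrite ge_min lexx.
have de : d * (v a + v b + 1) <= e.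
  by rewrite -ler_pdivlMr// ge_min lexx orbT.
rewrite (le_lt_trans (absvD _ _ _))//.
rewrite (le_lt_trans (lerD (absvD _ _ _) (lexx _)))// !absvM.
have va := absv_ge0 v a; have vb := absv_ge0 v b.
have vx := absv_ge0 v (x n - a); have vy := absv_ge0 v (y n - b).
have : v (x n - a) * v (y n - b) < d by nra.
nra.
Qed.

Lemma cvF_sum (I : Type) (r : seq I) (P : pred I) (x : I -> T -> F) (a : I -> F) :
  (forall i, P i -> cvF U (x i) (a i)) ->
  cvF U (fun n => \sum_(i <- r | P i) x i n) (\sum_(i <- r | P i) a i).
Proof.
move=> cx; elim: r => [|i r IH].
  by rewrite big_nil; apply: (cvF_ext (x := fun=> 0)) => [n|]; rewrite ?big_nil//; exact: cvF_cst.
rewrite big_cons; case: ifP => Pi.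
  apply: (cvF_ext (x := fun n => x i n + \sum_(j <- r | P j) x j n)).
    by move=> n; rewrite big_cons Pi.
  by apply: cvFD => //; exact: cx.
by apply: cvF_ext IH => n; rewrite big_cons Pi.
Qed.

Lemma cvF_neq0 x a : cvF U x a -> a != 0 -> U [set n | x n != 0].
Proof.
move=> cx a0; apply: filterS (cx _ (absv_gt0 a0)) => n /=.
by apply: contraTneq => ->; rewrite sub0r absvN ltxx.
Qed.

Lemma cvFV x a : a != 0 -> cvF U x a -> cvF U (fun n => (x n)^-1) a^-1.
Proof.
move=> a0 cx e e0; have va := absv_gt0 a0.
pose d := Num.min (v a / 2) (e * v a ^+ 2 / 2).
have d0 : 0 < d.
  by rewrite lt_min !divr_gt0// mulr_gt0// exprn_gt0.
apply: filterS2 (cvF_neq0 cx a0) (cx _ d0) => n /= xn0 xd.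
have -> : (x n)^-1 - a^-1 = (a - x n) / (x n * a) by field; rewrite ?a0 ?xn0.
rewrite absvM absvV absv_distC absvM.
have vx : v a / 2 < v (x n).
  have : v a <= v (x n) + v (x n - a).
    by rewrite (absv_distC (x n)) (le_trans _ (absvD _ _ _))// addrC subrK.
  have : d <= v a / 2 by rewrite ge_min lexx.
  by lra.
have vx0 : 0 < v (x n) by apply: lt_trans vx; rewrite divr_gt0.
rewrite ltr_pdivrMr ?mulr_gt0//.
have de : d <= e * v a ^+ 2 / 2 by rewrite ge_min lexx orbT.
apply: (lt_le_trans xd); apply: (le_trans de).
rewrite -mulrA ler_pM2l// expr2 mulrAC; rewrite ler_pM2r//; exact: ltW.
Qed.

End FilterLimits.

Lemma cvF_unique (T : Type) (U : set_system T) : ProperFilter U ->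
  forall x a b, cvF U x a -> cvF U x b -> a = b.
Proof.
move=> PU x a b cx cy; apply/eqP; rewrite -subr_eq0; apply/negPn/negP => ab0.
have [n] := filter_ex (cvF_neq0 (cvFB cx cy) ab0).
by rewrite /= subrr eqxx.
Qed.

Lemma cvF_nmono (T : Type) (U W : set_system T) : W `<=` U -> forall x a, cvF W x a -> cvF U x a.
Proof. by move=> WU x a cx e e0; exact/WU/cx. Qed.

Lemma cvF_geom (t : F) : v t < 1 -> cvF \oo (fun n => t ^+ n) 0.
Proof.
move=> t1 e e0.
have := @cvg_expr R (v t); rewrite ger0_norm ?absv_ge0// => /(_ t1).
move/cvgrPdist_lt => /(_ e e0); apply: filterS => n /=.
by rewrite sub0r normrN subr0 ger0_norm ?exprn_ge0 ?absv_ge0// absvX.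
Qed.

(** * Compactness of balls and square roots near 1 *)

Hypothesis F_local : local_field v.

Lemma absv_gt1_ex : exists s : F, 1 < v s.
Proof.
have [[x [x0 x1]] _ _] := F_local.
have [x1'|x1'] := ltP 1 (v x); first by exists x.
exists x^-1; rewrite absvV invf_gt1 ?absv_gt0//.
by rewrite lt_neqAle x1 x1'.
Qed.

Lemma absv_unbounded (C : R) : exists2 s : F, s != 0 & C < v s.
Proof.
have [s s1] := absv_gt1_ex.
have s0 : s != 0 by apply: contraTneq s1 => ->; rewrite absv0 ltr10.
have C0 : 0 < `|C| + 1 by rewrite ltr_wpDl.
have s2 : v s^-1 < 1 by rewrite absvV invf_lt1// (lt_trans ltr01).
have C0' : 0 < (`|C| + 1)^-1 by rewrite invr_gt0.
have [n _ /(_ n (leqnn n))] := cvF_geom s2 C0'; rewrite /= subr0 => h.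
exists (s ^+ n); first by rewrite expf_neq0.
move: h; rewrite exprVn absvV ltf_pV2 ?posrE// ?absv_gt0 ?expf_neq0//.
by apply: le_lt_trans; rewrite (le_trans (ler_norm _))// lerDl.
Qed.

(** Local compactness at 0 suffices: division by a scalar [s] of large absolute value brings a
    bounded map into a compact neighbourhood [B] of 0, where ultrafilters converge, and the limit is
    multiplied back by [s]. *)
Lemma bounded_ultralimit (T : Type) (U : set_system T) : UltraFilter U ->
  forall (x : T -> F) (C : R), U [set n | v (x n) <= C] -> exists a, cvF U x a.
Proof.
move=> UU x C UC; have [_ _ lc] := F_local.
have [B wB [+ _]] := lc (0 : valued v) I; rewrite compact_ultra => cB.
have : nbhs (0 : valued v) B.
  by move: wB; rewrite /within /=; apply: (@filterS _ (nbhs (0 : valued v))) => y; exact.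
move=> /nbhs_ballP[r /= r0 rB].
have [s s0 sC] := absv_unbounded (C / r).
pose y : T -> valued v := fun n => x n / s.
have UB : U [set n | B (y n)].
  apply: filterS UC => n /= nC; apply: rB; apply/ballvE.
  rewrite sub0r absvN absvM absvV ltr_pdivrMr ?absv_gt0//.
  by rewrite (le_lt_trans nC)// mulrC -ltr_pdivrMr.
have Uy : UltraFilter (y @ U).
  split; first exact: fmap_proper_filter.
  move=> G PG UG; rewrite predeqE => A; split; last exact: UG.
  move=> GA; have [//|UnA] := in_ultra_setVsetC (y @^-1` A) UU.
  have : G (~` A) by exact: UG.
  by move/(filterI GA)/filter_ex => -[? []].
have [b [_ /= cyb]] := cB _ Uy UB.
exists (b * s); apply: (cvF_ext (x := fun n => (y n : F) * s)).
  by move=> n; rewrite /y mulfVK.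
by apply: cvFM; [apply/cvFP|exact: cvF_cst].
Qed.

Lemma ultra_oo : exists U : set_system nat, UltraFilter U /\ \oo `<=` U.
Proof. exact: ultraFilterLemma. Qed.

Hypothesis F_char : 2%N \notin [pchar F].

Lemma two_neq0 : (2 : F) != 0.
Proof. by apply: contraNN F_char => F2; rewrite inE /=. Qed.

(** Only the triangle inequality is used, so that archimedean and ultrametric fields are treated
    together. All bounds are relative to [w], the absolute value of 2, which may be small but is
    nonzero. *)
Lemma squares_near1 : exists2 eps : R, 0 < eps &
  forall x : F, v (x - 1) < eps -> exists y, x = y ^+ 2.
Proof.
have w0 := absv_gt0 two_neq0; set w := v 2 in w0.
have w2 : w <= 2.
  have -> : (2 : R) = v 1 + v 1 by rewrite absv1.
  by rewrite /w -[2]/(1 + 1 : F) absvD.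
pose r : R := Num.min 2^-1 (w / 2).
have r0 : 0 < r by rewrite lt_min invr_gt0 ltr0n divr_gt0.
have r1 : r <= 2^-1 by rewrite ge_min lexx.
have r2 : r <= w / 2 by rewrite ge_min lexx orbT.
(* The 5 is 4 + 1: since [r <= w / 2], the iterates satisfy [v z * w <= 4 * eps], and one more step
   adds at most [eps], which keeps [v z] below [r]. *)
pose eps := r * w / 5; have eps0 : 0 < eps by rewrite divr_gt0 ?mulr_gt0.
exists eps => // x1 x1e; pose x := x1 - 1.
pose f z := z ^+ 2 + 2 * z - x.
(* Newton's iteration for (1 + z) ^+ 2 = x1, with the derivative frozen at z = 0 *)
pose z := fix z n := if n is n'.+1 then z n' - f (z n') / 2 else 0.
have fS t : f (t - f t / 2) = (f t / 2) * (f t / 2 - 2 * t).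
  by rewrite {1}/f; rewrite {4}[f t]lock; rewrite -[in RHS]lock; have := two_neq0; rewrite /f => ?; field.
have H n : v (z n) <= r /\ v (f (z n)) <= eps * (3 / 5) ^+ n.
  elim: n => [|n [zr fe]].
    rewrite /= absv0 expr0 mulr1 (ltW r0); split=> //.
    by rewrite /f expr0n mulr0 add0r sub0r absvN ltW.
  have fe' : v (f (z n)) <= eps.
    apply: (le_trans fe); rewrite ler_piMr ?(ltW eps0)//.
    by rewrite exprn_ile1//; lra.
  have f0 := absv_ge0 v (f (z n)); have z0 := absv_ge0 v (z n).
  have zz : w * v (z n) <= 2 * eps + v (z n) ^+ 2.
    rewrite /w -absvM -absvX.
    have -> : 2 * z n = (f (z n) + x) - z n ^+ 2 by rewrite /f; ring.
    rewrite (le_trans (absvB _ _))// lerD2r (le_trans (absvD _ _ _))//.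
    by rewrite mulr2n mulrDl mul1r lerD// ltW.
  have z4 : v (z n) * w <= 4 * eps by nra.
  have d5 : v (f (z n) / 2) * w <= eps by rewrite absvM absvV -/w mulfVK ?gt_eqF.
  have d0 := absv_ge0 v (f (z n) / 2).
  have epsE : 5 * eps = r * w by rewrite /eps; field.
  split=> /=.
    rewrite (le_trans (absvB _ _))// -(ler_pM2r w0); lra.
  rewrite fS absvM exprS mulrCA.
  (* The factor is 1/10 + 1/2: the first term is at most [w / 10] because [eps <= w ^+ 2 / 10], the
     second at most [w / 2] because [r <= 1/2]. *)
  have B1 : v (f (z n) / 2 - 2 * z n) <= w * (3 / 5).
    rewrite (le_trans (absvB _ _))// [v (2 * _)]absvM -/w.
    have : v (f (z n) / 2) <= w / 10 by rewrite -(ler_pM2r w0); nra.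
    have : w * v (z n) <= w / 2 by rewrite ler_pM2l//; lra.
    by lra.
  apply: (@le_trans _ _ (v (f (z n)) * (3 / 5))); last by rewrite mulrC ler_pM2l//; lra.
  have -> : v (f (z n)) = v (f (z n) / 2) * w.
    by rewrite absvM absvV -/w mulfVK ?gt_eqF.
  by rewrite -mulrA ler_wpM2l.
have [U [UU ooU]] := ultra_oo.
have [y zy] : exists y, cvF U z y.
  by apply: (@bounded_ultralimit _ _ UU z r); apply: filterS filterT => n _; case: (H n).
have fz : cvF U (fun n => f (z n)) (f y).
  apply: cvFB; last exact: cvF_cst.
  apply: cvFD; first by rewrite expr2; apply: (cvF_ext (x := fun n => z n * z n)) => //; exact: cvFM.
  by apply: cvFM => //; exact: cvF_cst.
have fz0 : cvF U (fun n => f (z n)) 0.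
  apply: (cvF_nmono ooU) => e e0.
  have q1 : `|3 / 5 : R| < 1 by rewrite ger0_norm; lra.
  have /cvgrPdist_lt/(_ e e0) := cvg_geometric eps q1.
  apply: filterS.
  move=> n /=; rewrite sub0r normrN subr0 => he; apply: le_lt_trans he.
  by rewrite (le_trans _ (ler_norm _))//; case: (H n).
have fy : f y = 0 by exact: (@cvF_unique _ U _ _ _ _ fz fz0).
exists (1 + y); have -> : x1 = x + 1 by rewrite /x subrK.
by apply/eqP; rewrite -subr_eq0 -oppr_eq0 -fy /f; apply/eqP; ring.
Qed.

End AbsoluteValue.

Lemma initial_cvg (S : choiceType) (T : topologicalType) (f : S -> T)
    (G : set_system S) (s : S) : Filter G ->
  f @ G --> f s -> G --> (s : initial_topology f).
Proof.
move=> FG fG A [_ [[B oB <-] Bs] BA].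
by apply: filterS BA _; apply: fG; exact: open_nbhs_nbhs.
Qed.

Lemma ptws_cvg (I : Type) (T : topologicalType) (G : set_system (I -> T)) (g : I -> T) :
  Filter G -> (forall i, (fun h : I -> T => h i) @ G --> g i) ->
  G --> (g : {ptws I -> T}).
Proof.
by move=> FG gG; apply/cvg_sup => i; apply: initial_cvg; exact: gG.
Qed.

Lemma ptws_eval_continuous (I : Type) (T : topologicalType) (i : I) :
  continuous ((fun h => h i) : {ptws I -> T} -> T).
Proof.
move=> g; have /cvg_sup/(_ i) gi : nbhs (g : {ptws I -> T}) --> (g : {ptws I -> T}) by [].
apply: cvg_trans; last exact: (@initial_continuous _ _ (fun h : I -> T => h i)).
exact: cvg_app.
Qed.

(** * Canonical topologies and Grassmannians *)

Section CanonicalTopologyLimits.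
Variables (R : realType) (F : fieldType) (v : absolute_value R F).
Variable (W : zmodType) (act : F -> W -> W).

Definition cvW (T : Type) (U : set_system T) (x : T -> W) (w : W) :=
  forall l, Flinear_form act l -> cvF v U (l \o x) (l w).

Lemma cvW_cvg (T : Type) (U : set_system T) x w : Filter U -> cvW U x w ->
  (x : T -> fd_topology v act) @ U --> (w : fd_topology v act).
Proof.
move=> FU cx; apply: initial_cvg; apply: ptws_cvg => l.
by apply/cvFP; apply: cx; exact: (set_mem (valP l)).
Qed.

Lemma open_form (l : W -> F) (w : W) (e : R) : Flinear_form act l ->
  open [set x : fd_topology v act | v (l x - l w) < e].
Proof.
move=> ll; pose L : Flinear_form act := exist _ l (mem_set ll).
have -> : [set x : fd_topology v act | v (l x - l w) < e] =
   eval_forms v (act := act) @^-1` [set h | ball (l w : valued v) e (h L)].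
  by apply/seteqP; split=> x /=; rewrite ballEmdist /= /Defs.valued_dist absv_distC.
exists [set h | ball (l w : valued v) e (h L)] => //.
apply: (open_comp (f := fun h : {ptws Flinear_form act -> valued v} => h L)).
  by move=> h _; exact: ptws_eval_continuous.
rewrite openE => x /= /ballvE lx.
apply/nbhs_ballP; exists (e - v (l w - x)) => /=; first by rewrite subr_gt0.
move=> y /ballvE xy; apply/ballvE.
have -> : l w - y = (l w - x) + (x - y) by rewrite addrA subrK.
by rewrite (le_lt_trans (absvD _ _ _))// -ltrBrDl.
Qed.

End CanonicalTopologyLimits.

Section GrassmannianLimits.
Variables (R : realType) (F : fieldType) (v : absolute_value R F).
Variables (K : falgType F) (V : vectType K^c).
Implicit Types (u w : V).

Lemma rsDl u w x : rscale (u + w) x = rscale u x + rscale w x.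
Proof. exact: scalerDr. Qed.

Lemma rsDr u x y : rscale u (x + y) = rscale u x + rscale u y.
Proof. exact: scalerDl. Qed.

Lemma rsA u x y : rscale (rscale u x) y = rscale u (x * y).
Proof. exact: scalerA. Qed.

Lemma rs1 u : rscale u 1 = u. Proof. exact: scale1r. Qed.
Lemma rs0 u : rscale u 0 = 0. Proof. exact: scale0r. Qed.
Lemma rs0l x : rscale (0 : V) x = 0. Proof. exact: scaler0. Qed.
Lemma rsNl u x : rscale (- u) x = - rscale u x. Proof. exact: scalerN. Qed.
Lemma rsN u x : rscale u (- x) = - rscale u x. Proof. exact: scaleNr. Qed.
Lemma rs_sum I (r : seq I) (P : pred I) (f : I -> V) x :
  rscale (\sum_(i <- r | P i) f i) x = \sum_(i <- r | P i) rscale (f i) x.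
Proof. exact: scaler_sumr. Qed.
Lemma rs_sumr I (r : seq I) (P : pred I) (f : I -> K) u :
  rscale u (\sum_(i <- r | P i) f i) = \sum_(i <- r | P i) rscale u (f i).
Proof. exact: scaler_suml. Qed.

Lemma subspace_sum I (r : seq I) (P : pred I) (f : I -> V) (S : set V) :
  Defs.subspace S -> (forall i, P i -> S (f i)) -> S (\sum_(i <- r | P i) f i).
Proof.
move=> [S0 SD _] Sf; elim/big_ind : _ => //; exact: SD.
Qed.

Lemma spanned_rangeE d (e : 'I_d -> V) :
  spanned (range e) = [set w | exists a : 'I_d -> K, w = \sum_i rscale (e i) (a i)].
Proof.
apply/seteqP; split=> w.
  apply; split; last first.
    move=> _ [i _ <-]; exists (fun j => (j == i)%:R).
    rewrite (bigD1 i)//= eqxx rs1 big1 ?addr0// => j /negPf ->.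
    by rewrite rs0.
  split.
  - exists (fun=> 0); rewrite big1// => i _; exact: rs0.
  - move=> _ _ [a ->] [b ->]; exists (fun i => a i + b i).
    by rewrite -big_split; apply: eq_bigr => i _; rewrite rsDr.
  - move=> _ x [a ->]; exists (fun i => a i * x).
    by rewrite rs_sum; apply: eq_bigr => i _; rewrite rsA.
move=> [a ->] S [sS eS]; apply: subspace_sum => // i _.
by case: sS => _ _; apply; apply: eS; exists i.
Qed.

Lemma spanned_subspace (A : set V) : Defs.subspace (spanned A).
Proof.
split=> [S [[S0 _ _] _]//|u w Au Aw S SA|u x Au S SA].
  by case: (SA) => -[_ SD _] _; apply: SD; [exact: Au|exact: Aw].
by case: (SA) => -[_ _ SZ] _; apply: SZ; exact: Au.
Qed.

Lemma spanned_sub (A B : set V) : Defs.subspace B -> A `<=` B -> spanned A `<=` B.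
Proof. by move=> sB AB u; apply; split. Qed.

Lemma sub_spanned (A : set V) : A `<=` spanned A.
Proof. by move=> u Au S [_]; exact. Qed.

Definition cvV := @cvW R F v V (fun a u => rscale u a%:A).

Definition Fform := Flinear_form (fun (a : F) (u : V) => rscale u a%:A).

Lemma FformD l u w : Fform l -> l (u + w) = l u + l w.
Proof. by move=> ll; have := ll 1 u w; rewrite scale1r rs1 mul1r. Qed.

Lemma Fform0 l : Fform l -> l 0 = 0.
Proof. by move=> ll; apply: (addrI (l 0)); rewrite -FformD// !addr0. Qed.

Lemma FformZ l a u : Fform l -> l (rscale u a%:A) = a * l u.
Proof. by move=> ll; have := ll a u 0; rewrite (Fform0 ll) !addr0. Qed.

Lemma Fform_sum l I (r : seq I) (P : pred I) (f : I -> V) : Fform l ->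
  l (\sum_(i <- r | P i) f i) = \sum_(i <- r | P i) l (f i).
Proof.
move=> ll; elim/big_rec2 : _ => [|i a b _ <-]; [exact: Fform0|exact: FformD].
Qed.

Lemma Fform_rscale l x : Fform l -> Fform (fun u => l (rscale u x)).
Proof.
move=> ll a u w; rewrite rsDl -ll; congr (l (_ + _)).
by rewrite !rsA mulr_algl mulr_algr.
Qed.

Lemma frame_span_cvg (T : Type) d (x : T -> frame v V d) (x0 : frame v V d) (U : set_system T) :
  Filter U -> (forall k, cvV U (fun n => \val (x n) k) (\val x0 k)) ->
  (fun n => frame_span (x n)) @ U --> frame_span x0.
Proof.
move=> FU cx A.
rewrite nbhsE => -[B [oB Bx] BA].
have : (x @ U) --> x0.
  apply: initial_cvg; apply: ptws_cvg => k.
  exact: (cvW_cvg FU (cx k)).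
move=> /(_ (@frame_span R F v K V d @^-1` B)) h.
have {}h : (x @ U) (@frame_span R F v K V d @^-1` B).
  by apply: h; apply: open_nbhs_nbhs; split.
by move: h; rewrite /= /fmap /=; apply: filterS => n; exact: BA.
Qed.

Lemma cvV_frame d (x0 : frame v V d) k :
  cvV (nbhs x0) (fun x => \val x k) (\val x0 k).
Proof.
move=> l ll e e0 /=.
pose A : set (Vtop v V) := [set w | v (l w - l (\val x0 k)) < e].
have oA : open A by exact: open_form.
have c1 : (fun x : frame v V d => \val x) @ nbhs x0 --> \val x0.
  exact: initial_continuous.
have c2 : (fun x : frame v V d => \val x k) @ nbhs x0 --> (\val x0 k : Vtop v V).
  apply: cvg_trans; last exact: (@ptws_eval_continuous 'I_d (Vtop v V) k (\val x0)).
  exact: (cvg_app (fun h : {ptws 'I_d -> Vtop v V} => h k) c1).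
have := c2 A; apply; apply: open_nbhs_nbhs; split => //.
by rewrite /A /= subrr absv0.
Qed.

(** Two frames of one subspace differ by a matrix [G] with a two-sided inverse [H]. The same [G]
    then acts on every frame [z] without changing its span, which is the group action that makes the
    span map open. *)
Lemma frame_changes d (x y : frame v V d) : frame_span x = frame_span y ->
  exists G : 'I_d -> 'I_d -> K,
   (forall k, \val x k = \sum_j rscale (\val y j) (G j k)) /\
   forall z : 'I_d -> V, free_family z ->
     let z' := fun k => \sum_j rscale (z j) (G j k) in
     free_family z' /\ spanned (range z') = spanned (range z).
Proof.
move=> /(congr1 val) /= xy.
have comb (x1 y1 : frame v V d) :
  spanned (range (\val x1 : 'I_d -> V)) = spanned (range (\val y1 : 'I_d -> V)) ->
  exists G : 'I_d -> 'I_d -> K, forall k, \val x1 k = \sum_j rscale (\val y1 j) (G j k).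
  move=> x1y1.
  have : forall k, exists a : 'I_d -> K, \val x1 k = \sum_j rscale (\val y1 j) (a j).
    move=> k; have : spanned (range (\val x1 : 'I_d -> V)) (\val x1 k).
      by apply: sub_spanned; exists k.
    by rewrite x1y1 spanned_rangeE.
  by move=> /choice[G GP]; exists (fun j k => G k j).
have [G GP] := comb _ _ xy; have [H HP] := comb _ _ (esym xy).
exists G; split => // z fz; pose z' k := \sum_j rscale (z j) (G j k).
have GH i j : \sum_k G i k * H k j = (i == j)%:R.
  have fy := set_mem (valP y).
  apply/eqP; rewrite -subr_eq0; apply/eqP.
  apply: (fy (fun i => \sum_k G i k * H k j - (i == j)%:R)).
  under eq_bigr do rewrite rsDr rsN.
  rewrite sumrB [X in _ - X](bigD1 j)//= eqxx rs1 [X in _ - (_ + X)]big1; last first.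
    by move=> k /negPf ->; rewrite rs0.
  rewrite addr0; apply/eqP; rewrite subr_eq0; apply/eqP.
  rewrite [RHS]HP; under [RHS]eq_bigr do rewrite GP rs_sum.
  rewrite exchange_big /=; apply: eq_bigr => k _; rewrite rs_sumr.
  by apply: eq_bigr => m _; rewrite rsA.
have HG i j : \sum_k H i k * G k j = (i == j)%:R.
  have fy := set_mem (valP x).
  apply/eqP; rewrite -subr_eq0; apply/eqP.
  apply: (fy (fun i => \sum_k H i k * G k j - (i == j)%:R)).
  under eq_bigr do rewrite rsDr rsN.
  rewrite sumrB [X in _ - X](bigD1 j)//= eqxx rs1 [X in _ - (_ + X)]big1; last first.
    by move=> k /negPf ->; rewrite rs0.
  rewrite addr0; apply/eqP; rewrite subr_eq0; apply/eqP.
  rewrite [RHS]GP; under [RHS]eq_bigr do rewrite HP rs_sum.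
  rewrite exchange_big /=; apply: eq_bigr => k _; rewrite rs_sumr.
  by apply: eq_bigr => m _; rewrite rsA.
have zE j : z j = \sum_k rscale (z' k) (H k j).
  rewrite /z'; under eq_bigr do rewrite rs_sum.
  rewrite exchange_big /= (bigD1 j)//= [X in _ + X]big1.
    rewrite addr0; under eq_bigr do rewrite rsA.
    by rewrite -rs_sumr GH eqxx rs1.
  move=> i /negPf ij; under eq_bigr do rewrite rsA.
  by rewrite -rs_sumr GH ij rs0.
split.
  move=> a az i.
  have Ga j : \sum_k G j k * a k = 0.
    apply: (fz (fun j => \sum_k G j k * a k)).
    under eq_bigr do rewrite rs_sumr.
    rewrite exchange_big /= -[RHS]az; apply: eq_bigr => k _.
    by rewrite rs_sum; apply: eq_bigr => m _; rewrite rsA.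
  have -> : a i = \sum_k H i k * \sum_j G k j * a j.
    under eq_bigr do rewrite mulr_sumr.
    rewrite exchange_big /= (bigD1 i)//= [X in _ + X]big1.
      rewrite addr0; under eq_bigr do rewrite mulrA.
      by rewrite -mulr_suml HG eqxx mul1r.
    move=> j /negPf ij; under eq_bigr do rewrite mulrA.
    by rewrite -mulr_suml HG eq_sym ij mul0r.
  by rewrite big1// => k _; rewrite Ga mulr0.
apply/seteqP; split; apply: spanned_sub; try exact: spanned_subspace;
    move=> _ [k _ <-]; rewrite spanned_rangeE /=.
  by exists (G^~ k).
by exists (H^~ k).
Qed.

(** Openness of the span map. If [z] has the same span as a frame [y] close to [x0], the matrix [G]
    taking [z] to [y] takes every frame near [z] to a frame of the same span near [y]. *)
Lemma grassmannian_nbhs d (x0 : frame v V d) (N : 'I_d -> set (Vtop v V)) :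
  (forall k, open (N k)) -> (forall k, N k (\val x0 k)) ->
  nbhs (frame_span x0) [set S : grassmannian v V d |
    exists y : frame v V d, frame_span y = S /\ forall k, N k (\val y k)].
Proof.
move=> oN Nx; apply: open_nbhs_nbhs; split; last by exists x0.
rewrite /open /= /grassmannian_open openE => z /= [y [yz Ny]].
have [G [yG Gz]] := frame_changes yz.
pose T k (z' : frame v V d) : Vtop v V := \sum_j rscale (\val z' j) (G j k).
have cT k : T k @ nbhs z --> T k z.
  apply: cvW_cvg => l ll /=.
  apply: (cvF_ext (x := fun z' : frame v V d => \sum_j l (rscale (\val z' j) (G j k)))).
    by move=> z'; rewrite /T /= (Fform_sum _ _ _ ll).
  rewrite /T (Fform_sum _ _ _ ll); apply: cvF_sum => j _.
  by have := @cvV_frame d z j _ (Fform_rscale (G j k) ll).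
have {}cT k : nbhs z [set z' | N k (T k z')].
  apply: (cT k (N k)); apply: open_nbhs_nbhs; split => //.
  by rewrite /T -yG.
have {}cT : nbhs z [set z' | forall k, N k (T k z')].
  exact: (@filter_forall _ 'I_d (fun k z' => N k (T k z')) (nbhs z)).
apply: filterS cT => z' Nz'.
have [fz' sz'] := Gz _ (set_mem (valP z')).
pose y' : frame v V d := exist _ (_ : {ptws 'I_d -> Vtop v V}) (mem_set fz').
exists y'; split => //.
by apply: val_inj => /=.
Qed.

End GrassmannianLimits.

Section Coordinates.
Variables (R : realType) (F : fieldType) (v : absolute_value R F).
Variables (K : falgType F) (V : vectType K^c).
Implicit Types (u w : V).

(** A basis of [V] over [F]: the multiples of a [K]-basis of [V] by an [F]-basis of [K]. Finitely
    many coordinates then control all linear forms. *)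
Definition Vbase (i : 'I_(dim V) * 'I_(\dim {:K})) : V :=
  rscale (r2v (delta_mx 0 i.1)) (vbasis {:K})`_i.2.

Definition Vcoord (i : 'I_(dim V) * 'I_(\dim {:K})) (u : V) : F :=
  coord (vbasis {:K}) i.2 (v2r u 0 i.1 : K).

Lemma Vcoord_form i : Fform (Vcoord i).
Proof.
move=> a u w; rewrite /Vcoord linearD linearZ !mxE.
have -> : (a%:A : K^c) * v2r u 0 i.1 = a *: (v2r u 0 i.1 : K).
  by rewrite -[LHS]/((v2r u 0 i.1 : K) * a%:A) mulr_algr.
by rewrite linearD linearZ.
Qed.

Lemma Vcoord_sum u : u = \sum_i rscale (Vbase i) (Vcoord i u)%:A.
Proof.
rewrite -(pair_bigA _ (fun i j => rscale (Vbase (i, j)) (Vcoord (i, j) u)%:A)) /=.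
apply: (can_inj v2rK); rewrite linear_sum [LHS]row_sum_delta.
apply: eq_bigr => i _; rewrite /Vbase /Vcoord /=.
under eq_bigr do rewrite rsA mulr_algr.
rewrite -rs_sumr -(coord_vbasis (memvf (v2r u 0 i : K))).
by rewrite /rscale [RHS]linearZ /= r2vK.
Qed.

Lemma cvV_coord (T : Type) (U : set_system T) x w : Filter U ->
  (forall i, cvF v U (Vcoord i \o x) (Vcoord i w)) -> cvV v U x w.
Proof.
move=> FU cx l ll.
have lE u : l u = \sum_i Vcoord i u * l (Vbase i).
  rewrite [in LHS](Vcoord_sum u) (Fform_sum _ _ _ ll); apply: eq_bigr => i _.
  exact: FformZ.
rewrite lE; apply: (cvF_ext (x := fun n => \sum_i Vcoord i (x n) * l (Vbase i))).
  by move=> n /=; rewrite lE.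
by apply: cvF_sum => i _; apply: cvFM; [exact: cx|exact: cvF_cst].
Qed.

End Coordinates.

(** * Isotropic subspaces and sequences of morphisms *)

Section Building.
Variables (R : realType) (F : fieldType) (v : absolute_value R F).
Variables (K : falgType F) (V : vectType K^c).
Implicit Types (u w : V).

Definition ln u : set V := spanned [set u].
Definition pl u w : set V := spanned [set u; w].

Lemma lnE u : ln u = [set rscale u x | x in [set: K]].
Proof.
apply/seteqP; split=> w.
  apply; split; last by move=> _ ->; exists 1 => //; rewrite rs1.
  split.
  - by exists 0 => //; rewrite rs0.
  - by move=> _ _ [x _ <-] [y _ <-]; exists (x + y) => //; rewrite rsDr.
  - by move=> _ y [x _ <-]; exists (x * y) => //; rewrite rsA.
move=> [x _ <-]; have [_ _] := spanned_subspace [set u]; apply.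
exact: sub_spanned.
Qed.

Lemma plE u w : pl u w = [set z | exists x y : K, z = rscale u x + rscale w y].
Proof.
apply/seteqP; split=> z.
  apply; split; last first.
    move=> _ [->|->]; first by exists 1, 0; rewrite rs1 rs0 addr0.
    by exists 0, 1; rewrite rs1 rs0 add0r.
  split.
  - by exists 0, 0; rewrite !rs0 addr0.
  - move=> _ _ [x [y ->]] [x' [y' ->]]; exists (x + x'), (y + y').
    by rewrite !rsDr addrACA.
  - by move=> _ a [x [y ->]]; exists (x * a), (y * a); rewrite rsDl !rsA.
move=> [x [y ->]]; have [_ SD SZ] := spanned_subspace [set u; w].
by apply: SD; apply: SZ; apply: sub_spanned; [left|right].
Qed.

Lemma lnP u w : ln u w <-> exists x : K, w = rscale u x.
Proof. by rewrite lnE; split=> [[x _ <-]|[x ->]]; exists x. Qed.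

Lemma plP u w z : pl u w z <-> exists x y : K, z = rscale u x + rscale w y.
Proof. by rewrite plE. Qed.

Definition fr1 u : 'I_1 -> V := fun=> u.
Definition fr2 u w : 'I_2 -> V := fun i => if i == 0 then u else w.

Lemma range_fr1 u : range (fr1 u) = [set u].
Proof. by apply/seteqP; split=> [_ [i _ <-]//|_ ->]; exists 0. Qed.

Lemma range_fr2 u w : range (fr2 u w) = [set u; w].
Proof.
apply/seteqP; split=> [_ [i _ <-]|_ [->|->]].
- by rewrite /fr2; case: ifP => _; [left|right].
- by exists 0.
- by exists 1.
Qed.

Definition free2 u w := forall x y : K, rscale u x + rscale w y = 0 -> x = 0 /\ y = 0.

Hypothesis K_unit : forall x : K, x != 0 -> x \is a GRing.unit.

Lemma rs_eq0 u x : rscale u x = 0 -> u != 0 -> x = 0.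
Proof.
move=> ux u0; apply/eqP; apply: contraNT u0 => /K_unit xu.
by rewrite -(rs1 u) -(mulrV xu) -rsA ux rs0l.
Qed.

Lemma fr1_free u : u != 0 -> free_family (fr1 u).
Proof. by move=> u0 a; rewrite big_ord1 => /rs_eq0/(_ u0) a0 i; rewrite ord1. Qed.

Lemma fr2_free u w : free2 u w -> free_family (fr2 u w).
Proof.
move=> uw a; rewrite big_ord_recl big_ord1 => /uw[a0 a1] i.
by case: (unliftP 0 i) => [j ->|->//]; rewrite ord1 -a1; congr (a _); apply: val_inj.
Qed.

Lemma free2P u w : free2 u w <-> u != 0 /\ ~ ln u w.
Proof.
split=> [uw|[u0 uw] x y xy].
  split; first by apply/eqP => u0; case: (uw 1 0); rewrite ?u0 ?rs0l ?rs0 ?addr0// => /eqP; rewrite oner_eq0.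
  move=> /lnP[x wx]; case: (uw x (- 1)); first by rewrite wx rsN rs1 subrr.
  by move=> _ /eqP; rewrite oppr_eq0 oner_eq0.
have [y0|y0] := eqVneq y 0.
  by split=> //; apply: rs_eq0 u0; move: xy; rewrite y0 rs0 addr0.
case: uw; apply/lnP; exists (- (x * y^-1)).
have yu := K_unit y0; rewrite rsN -rsA; apply/eqP; rewrite -addr_eq0 addrC.
by rewrite -[w]rs1 -[in X in _ + X](mulrV yu) -rsA -rsDl xy rs0l.
Qed.

Lemma has_dim1 (S : set V) : has_dim S 1 -> exists2 u, u != 0 & S = ln u.
Proof.
move=> [e [fe ->]]; exists (e 0).
  apply/eqP => e0; have := fe (fun=> 1); rewrite big_ord1 e0 rs0l => /(_ erefl 0)/eqP.
  by rewrite oner_eq0.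
have eE : e = fr1 (e 0) by apply/funext => i; rewrite ord1.
by rewrite [in LHS]eE range_fr1.
Qed.

Lemma has_dim2 (S : set V) : has_dim S 2 -> exists u w, free2 u w /\ S = pl u w.
Proof.
move=> [e [fe ->]]; exists (e 0), (e 1); split.
  move=> x y xy; have := fe (fun i => if i == 0 then x else y).
  rewrite big_ord_recl big_ord1 /= => h.
  have {}h : forall i : 'I_2, (if i == 0 then x else y) = 0.
    by apply: h; rewrite -[RHS]xy; congr (_ + rscale (e _) _); apply: val_inj.
  by split; [exact: (h 0)|exact: (h 1)].
have eE : e = fr2 (e 0) (e 1).
  apply/funext => i; rewrite /fr2; case: ifP => [/eqP->//|].
  case: (unliftP 0 i) => [j ->|->]; last by rewrite eqxx.
  by rewrite ord1 => _; congr e; apply: val_inj.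
by rewrite [in LHS]eE range_fr2.
Qed.

Lemma ln_dim u : u != 0 -> has_dim (ln u) 1.
Proof. by move=> u0; exists (fr1 u); rewrite range_fr1; split=> //; exact: fr1_free. Qed.

Lemma pl_dim u w : free2 u w -> has_dim (pl u w) 2.
Proof. by move=> uw; exists (fr2 u w); rewrite range_fr2; split=> //; exact: fr2_free. Qed.

End Building.

Section Morphisms.
Variables (R : realType) (F : fieldType) (v : absolute_value R F).
Variables (K : falgType F) (V : vectType K^c).
Variables (sigma : K -> K) (phi : V -> V -> K) (e : 'I_4 -> V).
Hypothesis K_unit : forall x : K, x != 0 -> x \is a GRing.unit.
Hypothesis sigma_invol : involutive_antiautomorphism sigma.
Hypothesis phi_herm : hermitian_form sigma phi.
Hypothesis e_free : free_family e.
Implicit Types (u w : V).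

Lemma antiD x y : sigma (x + y) = sigma x + sigma y. Proof. by case: sigma_invol. Qed.
Lemma antiM x y : sigma (x * y) = sigma y * sigma x. Proof. by case: sigma_invol. Qed.
Lemma antiK : involutive sigma. Proof. by case: sigma_invol. Qed.
Lemma anti0 : sigma 0 = 0. Proof. by apply: (addrI (sigma 0)); rewrite -antiD !addr0. Qed.
Lemma antiN x : sigma (- x) = - sigma x.
Proof. by apply: (addrI (sigma x)); rewrite -antiD !subrr anti0. Qed.
Lemma anti1 : sigma 1 = 1.
Proof. by have := antiM (sigma 1) 1; rewrite mulr1 antiK mulr1. Qed.
Lemma anti_eq0 x : (sigma x == 0) = (x == 0).
Proof. by apply/eqP/eqP => [h|->]; [rewrite -(antiK x) h anti0|exact: anti0]. Qed.
Lemma antiV x : sigma x^-1 = (sigma x)^-1.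
Proof.
have [->|x0] := eqVneq x 0; first by rewrite !(invr0, anti0).
have xu := K_unit x0; have sxu : sigma x \is a GRing.unit by rewrite K_unit// anti_eq0.
by apply: (mulrI sxu); rewrite -antiM mulVr// mulrV// anti1.
Qed.

Lemma phiDl u w z : phi (u + w) z = phi u z + phi w z. Proof. by case: phi_herm. Qed.
Lemma phiDr u w z : phi z (u + w) = phi z u + phi z w. Proof. by case: phi_herm. Qed.
Lemma phiZ u w x y : phi (rscale u x) (rscale w y) = sigma x * phi u w * y.
Proof. by case: phi_herm. Qed.
Lemma phiC u w : phi w u = sigma (phi u w). Proof. by case: phi_herm. Qed.
Lemma phiZl u w x : phi (rscale u x) w = sigma x * phi u w.
Proof. by rewrite -[w in LHS]rs1 phiZ mulr1. Qed.
Lemma phiZr u w x : phi u (rscale w x) = phi u w * x.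
Proof. by rewrite -[u in LHS]rs1 phiZ anti1 mul1r. Qed.
Lemma phi0l w : phi 0 w = 0. Proof. by rewrite -(rs0 0) phiZl anti0 mul0r. Qed.
Lemma phi0r w : phi w 0 = 0. Proof. by rewrite -(rs0 0) phiZr mulr0. Qed.
Lemma phiNl u w : phi (- u) w = - phi u w.
Proof. by apply: (addrI (phi u w)); rewrite -phiDl !subrr phi0l. Qed.
Lemma phiNr u w : phi u (- w) = - phi u w.
Proof. by apply: (addrI (phi u w)); rewrite -phiDr !subrr phi0r. Qed.
Lemma phi_eq0C u w : phi u w = 0 -> phi w u = 0.
Proof. by move=> h; rewrite phiC h anti0. Qed.

Definition phiE := (phiDl, phiDr, phiNl, phiNr, phiZl, phiZr, phi0l, phi0r).

Lemma tiso_ln u : phi u u = 0 -> totally_isotropic phi (ln u).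
Proof. by move=> uu _ _ /lnP[x ->] /lnP[y ->]; rewrite phiZ uu mulr0 mul0r. Qed.

Lemma tiso_pl u w : phi u u = 0 -> phi w w = 0 -> phi u w = 0 ->
  totally_isotropic phi (pl u w).
Proof.
move=> uu ww uw _ _ /plP[x [y ->]] /plP[x' [y' ->]].
by rewrite !phiE uu ww uw (phi_eq0C uw) !(mulr0, mul0r, addr0).
Qed.

Lemma pl_l u w : pl u w u. Proof. by apply: sub_spanned; left. Qed.
Lemma pl_r u w : pl u w w. Proof. by apply: sub_spanned; right. Qed.
Lemma ln_id u : ln u u. Proof. exact: sub_spanned. Qed.

Lemma ln_sub u (S : set V) : Defs.subspace S -> S u -> ln u `<=` S.
Proof. by move=> sS Su; apply: spanned_sub => // _ ->. Qed.

Lemma pl_sub u w (S : set V) : Defs.subspace S -> S u -> S w -> pl u w `<=` S.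
Proof. by move=> sS Su Sw; apply: spanned_sub => // _ [->|->]. Qed.

Lemma pl_subspace u w : Defs.subspace (pl u w). Proof. exact: spanned_subspace. Qed.
Lemma ln_subspace u : Defs.subspace (ln u). Proof. exact: spanned_subspace. Qed.

Lemma apt_incident i j : apt_line e i `<=` apt_plane e j <-> i = j \/ i = j + 1.
Proof.
split=> [ij|[->|->]]; last 2 first.
- by apply: ln_sub; [exact: pl_subspace|exact: pl_l].
- by apply: ln_sub; [exact: pl_subspace|exact: pl_r].
have /plP[x [y exy]] : pl (e j) (e (j + 1)) (e i) by apply: ij; exact: ln_id.
apply: contrapT => /not_orP[nij nij1].
pose a k : K := (k == i)%:R - (k == j)%:R * x - (k == j + 1)%:R * y.
have ind (k : 'I_4) z : \sum_m rscale (e m) ((m == k)%:R * z) = rscale (e k) z.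
  rewrite (bigD1 k)//= eqxx mul1r big1 ?addr0// => m /negPf->.
  by rewrite mul0r rs0.
have := e_free (a := a); rewrite /a.
under eq_bigr do rewrite 2!rsDr 2!rsN.
rewrite 2!big_split /= !sumrN !ind.
under eq_bigr do rewrite -[(_ == i)%:R]mulr1.
rewrite ind rs1 exy -addrA -opprD subrr => /(_ erefl i).
rewrite eqxx.
have /negPf -> : i != j by apply/eqP.
have /negPf -> : i != j + 1 by apply/eqP.
by rewrite !mul0r !subr0 => /eqP; rewrite oner_eq0.
Qed.

(** Morphisms in terms of vectors: [u i] spans the line of index [i], and [u i], [p i] span the
    plane of index [i]. The last condition is the incidence of the line [i + 1] with the plane [i];
    that of the line [i] is built in. *)
Definition vconf (u p : 'I_4 -> V) := forall i,
  [/\ free2 (u i) (p i), phi (u i) (u i) = 0, phi (p i) (p i) = 0,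
      phi (u i) (p i) = 0 & pl (u i) (p i) (u (i + 1))].

Definition spaces (f : morphism v phi e) (u p : 'I_4 -> V) :=
  forall i, line_space (mline f i) = ln (u i) /\ plane_space (mplane f i) = pl (u i) (p i).

Definition line_of u (u0 : u != 0) (uu : phi u u = 0) : line_vertex v phi :=
  exist _ (exist _ (ln u : set (Vtop v V)) (mem_set (ln_dim K_unit u0)) : grassmannian v V 1)
   (mem_set (tiso_ln uu)).

Definition plane_of u w (uw : free2 u w) (t : totally_isotropic phi (pl u w)) :
  plane_vertex v phi :=
  exist _ (exist _ (pl u w : set (Vtop v V)) (mem_set (pl_dim uw)) : grassmannian v V 2)
   (mem_set t).

Lemma mor_of (u p : 'I_4 -> V) : vconf u p -> exists f : Mor v phi e, spaces f u p.
Proof.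
move=> c.
have u0 i : u i != 0 by case: (c i) => /(free2P K_unit)[].
have uu i : phi (u i) (u i) = 0 by case: (c i).
have fr i : free2 (u i) (p i) by case: (c i).
have ti i : totally_isotropic phi (pl (u i) (p i)).
  by case: (c i) => _ ? ? ? _; exact: tiso_pl.
have inc i j : apt_line e i `<=` apt_plane e j ->
    line_space (line_of (u0 i) (uu i)) `<=` plane_space (plane_of (fr j) (@ti j)).
  move=> /apt_incident[->|->]; apply: ln_sub; try exact: pl_subspace.
    exact: pl_l.
  by case: (c j).
by exists (Morphism inc).
Qed.

Lemma line_sub_plane (f : morphism v phi e) i j : i = j \/ i = j + 1 ->
  line_space (mline f i) `<=` plane_space (mplane f j).
Proof. by move=> /apt_incident; exact: morphism_incident. Qed.

Lemma mor_conf (f : morphism v phi e) : exists u p : 'I_4 -> V, vconf u p /\ spaces f u p.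
Proof.
have hl i : exists u, [/\ u != 0, phi u u = 0 & line_space (mline f i) = ln u].
  have [u u0 E] := has_dim1 (set_mem (valP (\val (mline f i)))).
  exists u; split => //; have t := set_mem (valP (mline f i)).
  have {}E : line_space (mline f i) = ln u := E.
  by apply: t; rewrite -/(line_space (mline f i)) E; exact: ln_id.
have /choice[u uP] := hl.
have hp i : exists p, [/\ free2 (u i) p, phi p p = 0, phi (u i) p = 0
    & plane_space (mplane f i) = pl (u i) p].
  have [a [b [ab E]]] := has_dim2 (set_mem (valP (\val (mplane f i)))).
  have t := set_mem (valP (mplane f i)).
  have {}E : plane_space (mplane f i) = pl a b := E.
  have {}t : totally_isotropic phi (pl a b) by rewrite -E.
  have [u0 uu uE] := uP i.
  have : pl a b (u i).
    rewrite -E; apply: (@line_sub_plane f i i); first by left.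
    by rewrite uE; exact: ln_id.
  move=> uab; have [x [y uxy]] := (plP _ _ _).1 uab.
  (* The basis of the plane is changed so as to start with [u i]: it is completed by [b] if [u i] is
     a multiple of [a], and by [a] otherwise. *)
  have key p : pl a b p -> ~ ln (u i) p -> (pl (u i) p a /\ pl (u i) p b) ->
    exists p, [/\ free2 (u i) p, phi p p = 0, phi (u i) p = 0
    & plane_space (mplane f i) = pl (u i) p].
    move=> pab nup [pa pb]; exists p; split.
    - by apply/(free2P K_unit).
    - exact: t.
    - exact: t.
    - rewrite E; apply/seteqP; split.
        by apply: pl_sub => //; exact: pl_subspace.
      by apply: pl_sub => //; exact: pl_subspace.
  have [y0|y0] := eqVneq y 0.
    have x0 : x != 0 by apply: contraNneq u0 => x0; rewrite uxy y0 x0 !rs0 addr0.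
    have ua : a = rscale (u i) x^-1.
      by rewrite uxy y0 rs0 addr0 rsA mulrV ?rs1// K_unit.
    apply: (key b); first exact: pl_r.
      move=> /lnP[z bz]; case: (ab (x * z) (- 1)); last by move=> _ /eqP; rewrite oppr_eq0 oner_eq0.
      by rewrite rsN rs1 [X in _ - X]bz uxy y0 rs0 addr0 rsA subrr.
    by split; [apply/plP; exists x^-1, 0; rewrite rs0 addr0|exact: pl_r].
  apply: (key a); first exact: pl_l.
    move=> /lnP[z az]; case: (ab (x * z - 1) (y * z)).
      by rewrite rsDr rsN rs1 addrAC -!rsA -rsDl -uxy [X in _ - X]az subrr.
    move=> xz /eqP yz; have := K_unit y0 => yu.
    have z0 : z = 0 by apply: (mulrI yu); rewrite mulr0; exact/eqP.
    by move: xz => /eqP; rewrite z0 mulr0 sub0r oppr_eq0 oner_eq0.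
  split; first exact: pl_r.
  apply/plP; exists y^-1, (- (x * y^-1)).
  rewrite uxy rsDl !rsA mulrV ?K_unit// rs1 rsN addrAC subrr add0r//.
have /choice[p pP] := hp.
exists u, p; split; last by move=> i; case: (uP i) => _ _ ->; case: (pP i).
move=> i; have [u0 uu uE] := uP i; have [up pp uip pE] := pP i; split => //.
rewrite -pE; apply: (@line_sub_plane f (i + 1) i); first by right.
by case: (uP (i + 1)) => _ _ ->; exact: ln_id.
Qed.

(** Convergence of frames gives convergence of their spans in the quotient topology; the topologies
    on vertices, chambers and morphisms being initial or products, the morphisms converge. The
    frames of the planes need not contain the vectors spanning the lines. *)
Lemma closure_seq (S : set (Mor v phi e)) (f : Mor v phi e) (g : nat -> Mor v phi e)
   (un an bn : nat -> 'I_4 -> V) (u a b : 'I_4 -> V) :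
  (forall n, S (g n)) ->
  (forall n i, un n i != 0 /\ line_space (mline (g n) i) = ln (un n i)) ->
  (forall n i, free2 (an n i) (bn n i) /\ plane_space (mplane (g n) i) = pl (an n i) (bn n i)) ->
  (forall i, u i != 0 /\ line_space (mline f i) = ln (u i)) ->
  (forall i, free2 (a i) (b i) /\ plane_space (mplane f i) = pl (a i) (b i)) ->
  (forall i, cvV v \oo (un^~ i) (u i)) ->
  (forall i, cvV v \oo (an^~ i) (a i)) ->
  (forall i, cvV v \oo (bn^~ i) (b i)) ->
  closure S f.
Proof.
move=> Sg gl gp fl fp cu ca cb.
suff gf : g @ \oo --> f.
  move=> B /gf [n _ /(_ n (leqnn n)) Bn]; exists (g n); split => //.
pose F1 w (w0 : w != 0) : frame v V 1 :=
  exist _ (fr1 w : {ptws 'I_1 -> Vtop v V}) (mem_set (fr1_free K_unit w0)).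
pose F2 w z (wz : free2 w z) : frame v V 2 :=
  exist _ (fr2 w z : {ptws 'I_2 -> Vtop v V}) (mem_set (fr2_free wz)).
have cl i : (fun n => \val (mline (g n) i)) @ \oo --> \val (mline f i).
  have -> : (fun n => \val (mline (g n) i)) = fun n => frame_span (F1 _ (gl n i).1).
    apply/funext => n; apply: val_inj; rewrite /= range_fr1; exact: (gl n i).2.
  have -> : \val (mline f i) = frame_span (F1 _ (fl i).1).
    apply: val_inj; rewrite /= range_fr1; exact: (fl i).2.
  by apply: frame_span_cvg => k; exact: cu.
have cp i : (fun n => \val (mplane (g n) i)) @ \oo --> \val (mplane f i).
  have -> : (fun n => \val (mplane (g n) i)) = fun n => frame_span (F2 _ _ (gp n i).1).
    apply/funext => n; apply: val_inj; rewrite /= range_fr2; exact: (gp n i).2.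
  have -> : \val (mplane f i) = frame_span (F2 _ _ (fp i).1).
    apply: val_inj; rewrite /= range_fr2; exact: (fp i).2.
  apply: frame_span_cvg => k /=; rewrite /fr2; case: ifP => _; [exact: ca|exact: cb].
apply: initial_cvg; apply: ptws_cvg => c; apply: initial_cvg.
have cl' i : (fun n => mline (g n) i) @ \oo --> mline f i by apply: initial_cvg; exact: cl.
have cp' i : (fun n => mplane (g n) i) @ \oo --> mplane f i by apply: initial_cvg; exact: cp.
exact: (cvg_pair (cl' (\val c).1) (cp' (\val c).2)).
Qed.

(** The vertices of index [i] of both types form a chamber of the apartment, so both images are read
    off from the image of one chamber. *)
Lemma mvertices_cvg (f : Mor v phi e) i :
  (fun g : Mor v phi e => (mline g i, mplane g i)) @ nbhs f --> (mline f i, mplane f i).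
Proof.
have ii : apt_line e i `<=` apt_plane e i by apply/apt_incident; left.
pose c : apt_chamber e := exist _ (i, i) (mem_set ii).
have c1 : @mchamber _ _ v _ _ phi e @ nbhs f --> mchamber f by exact: initial_continuous.
have c2 := cvg_comp _ _ c1 (@ptws_eval_continuous _ (chamber v phi) c (mchamber f)).
have c3 := @initial_continuous _ _ (set_val : chamber v phi -> line_vertex v phi * plane_vertex v phi) (mchamber f c).
exact: (cvg_comp _ _ c2 c3).
Qed.

Lemma mline_continuous i : continuous ((fun f => \val (mline f i)) : Mor v phi e -> grassmannian v V 1).
Proof.
move=> f.
have c1 : (fun g : Mor v phi e => mline g i) @ nbhs f --> mline f i by exact: (cvg_comp _ _ (@mvertices_cvg f i) cvg_fst).
have c2 := (@initial_continuous _ _ (set_val : line_vertex v phi -> grassmannian v V 1) (mline f i)).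
exact: (cvg_comp _ _ c1 c2).
Qed.

Lemma mplane_continuous i : continuous ((fun f => \val (mplane f i)) : Mor v phi e -> grassmannian v V 2).
Proof.
move=> f.
have c1 : (fun g : Mor v phi e => mplane g i) @ nbhs f --> mplane f i by exact: (cvg_comp _ _ (@mvertices_cvg f i) cvg_snd).
have c2 := (@initial_continuous _ _ (set_val : plane_vertex v phi -> grassmannian v V 2) (mplane f i)).
exact: (cvg_comp _ _ c1 c2).
Qed.

(** Converse of [closure_seq]. Openness of the span map lifts each nearby line or plane to a nearby
    frame. Closeness is measured by finitely many coordinates, so the tolerances [n.+1%:R^-1]
    produce a sequence and no net is required. *)
Lemma closure_ex (S : set (Mor v phi e)) (f : Mor v phi e) (u a b : 'I_4 -> V) :
  (forall i, u i != 0 /\ line_space (mline f i) = ln (u i)) ->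
  (forall i, free2 (a i) (b i) /\ plane_space (mplane f i) = pl (a i) (b i)) ->
  closure S f ->
  exists (g : nat -> Mor v phi e) (un an bn : nat -> 'I_4 -> V),
  [/\ forall n, S (g n),
  forall n i, un n i != 0 /\ line_space (mline (g n) i) = ln (un n i),
  forall n i, free2 (an n i) (bn n i) /\ plane_space (mplane (g n) i) = pl (an n i) (bn n i),
  forall i, cvV v \oo (un^~ i) (u i) &
  (forall i, cvV v \oo (an^~ i) (a i)) /\
  (forall i, cvV v \oo (bn^~ i) (b i))].
Proof.
move=> fl fp cSf.
pose near (eps : R) w : set (Vtop v V) := [set z | forall i, v (Vcoord i z - Vcoord i w) < eps].
have near_open eps w : open (near eps w).
  rewrite openE => z hz.
  apply: (@filter_forall (Vtop v V) _ (fun i z => v (Vcoord i z - Vcoord i w) < eps) (nbhs z)) => i.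
  by apply: open_nbhs_nbhs; split; [apply: open_form; exact: Vcoord_form|exact: hz].
have near_id eps w : 0 < eps -> near eps w w by move=> e0 i; rewrite subrr absv0.
have key eps : 0 < eps -> exists (g : Mor v phi e) (un an bn : 'I_4 -> V),
  [/\ S g, forall i, un i != 0 /\ line_space (mline g i) = ln (un i),
   forall i, free2 (an i) (bn i) /\ plane_space (mplane g i) = pl (an i) (bn i) &
   forall i, [/\ near eps (u i) (un i), near eps (a i) (an i) & near eps (b i) (bn i)]].
  move=> e0.
  have hl i : nbhs f [set g : Mor v phi e | exists un,
      [/\ un != 0, line_space (mline g i) = ln un & near eps (u i) un]].
    have [u0 uE] := fl i.
    pose x0 : frame v V 1 := exist _ (fr1 (u i) : {ptws 'I_1 -> Vtop v V}) (mem_set (fr1_free K_unit u0)).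
    have x0E : \val (mline f i) = frame_span x0.
      by apply: val_inj; rewrite /= range_fr1; exact: uE.
    have h : (fun g : Mor v phi e => \val (mline g i)) @ nbhs f --> frame_span x0.
      by rewrite -x0E; exact: mline_continuous.
    have h2 : nbhs f [set g : Mor v phi e | exists y : frame v V 1,
       frame_span y = \val (mline g i) /\ forall k, near eps (u i) (\val y k)].
      exact: (h _ (grassmannian_nbhs (x0 := x0) (N := fun=> near eps (u i)) (fun=> near_open _ _) (fun=> near_id _ _ e0))).
    apply: filterS h2 => g /= [y [yE yN]].
    exists (\val y 0 : V); split; last exact: yN.
      apply/eqP => y0; have := set_mem (valP y) (fun=> 1).
      by rewrite big_ord1 y0 rs0l => /(_ erefl 0)/eqP; rewrite oner_eq0.
    rewrite (_ : line_space _ = spanned (range (\val y : 'I_1 -> V))); last first.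
      exact: (congr1 val (esym yE)).
    have yE' : (\val y : 'I_1 -> V) = fr1 (\val y 0) by apply/funext => j; rewrite ord1.
    by rewrite [in LHS]yE' range_fr1.
  have hp i : nbhs f [set g : Mor v phi e | exists an bn,
      [/\ free2 an bn, plane_space (mplane g i) = pl an bn, near eps (a i) an & near eps (b i) bn]].
    have [ab abE] := fp i.
    pose x0 : frame v V 2 := exist _ (fr2 (a i) (b i) : {ptws 'I_2 -> Vtop v V}) (mem_set (fr2_free ab)).
    have x0E : \val (mplane f i) = frame_span x0.
      by apply: val_inj; rewrite /= range_fr2; exact: abE.
    have h : (fun g : Mor v phi e => \val (mplane g i)) @ nbhs f --> frame_span x0.
      by rewrite -x0E; exact: mplane_continuous.
    have h2 : nbhs f [set g : Mor v phi e | exists y : frame v V 2,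
       frame_span y = \val (mplane g i) /\ forall k, near eps (fr2 (a i) (b i) k) (\val y k)].
      exact: (h _ (grassmannian_nbhs (x0 := x0) (N := fun k => near eps (fr2 (a i) (b i) k)) (fun=> near_open _ _) (fun=> near_id _ _ e0))).
    apply: filterS h2 => g /= [y [yE yN]].
    have yE' : (\val y : 'I_2 -> V) = fr2 (\val y 0) (\val y 1).
      apply/funext => j; rewrite /fr2; case: ifP => [/eqP->//|].
      case: (unliftP 0 j) => [k ->|->]; last by rewrite eqxx.
      by rewrite ord1 => _; congr (\val y _); apply: val_inj.
    have fy : free_family (\val y : 'I_2 -> V) by exact: (set_mem (valP y)).
    exists (\val y 0), (\val y 1); split.
    - move=> c d cd; have := fy (fun i => if i == 0 then c else d).
      rewrite big_ord_recl big_ord1 /= => {}h.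
      have {}h : forall i : 'I_2, (if i == 0 then c else d) = 0.
        by apply: h; rewrite -[RHS]cd; congr (_ + rscale (\val y _) _); apply: val_inj.
      by split; [exact: (h 0)|exact: (h 1)].
    - rewrite (_ : plane_space _ = spanned (range (\val y : 'I_2 -> V))); last first.
        exact: (congr1 val (esym yE)).
      by rewrite [in LHS]yE' range_fr2.
    - exact: (yN 0).
    - exact: (yN 1).
  have h : nbhs f [set g : Mor v phi e | forall i, (exists un,
      [/\ un != 0, line_space (mline g i) = ln un & near eps (u i) un]) /\ exists an bn,
      [/\ free2 an bn, plane_space (mplane g i) = pl an bn, near eps (a i) an & near eps (b i) bn]].
    apply: (@filter_forall (Mor v phi e) 'I_4 (fun i g => _ /\ _) (nbhs f)) => i.
    exact: filterI (hl i) (hp i).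
  have [g [Sg gP]] := cSf _ h.
  have /choice[un unP] := fun i => (gP i).1.
  have /choice[an /choice[bn abP]] := fun i => (gP i).2.
  exists g, un, an, bn; split => // i.
  - by case: (unP i).
  - by case: (abP i).
  - by case: (unP i) => _ _ ?; case: (abP i).
have /choice[g /choice[un /choice[an /choice[bn h]]]] := fun n : nat => key (n.+1%:R^-1) ltac:(by rewrite invr_gt0).
exists g, un, an, bn.
have lim (x : nat -> V) w : (forall n, near n.+1%:R^-1 w (x n)) -> cvV v \oo x w.
  move=> xw; apply: cvV_coord => i eps e0 /=.
  have [N _ NP] := near_infty_natSinv_lt (PosNum e0).
  by exists N => // n /NP /= nN; apply: lt_trans nN; exact: xw.
split=> [n|n i|n i|i|].
- by case: (h n).
- by case: (h n).
- by case: (h n).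
- by apply: lim => n; case: (h n) => _ _ _ /(_ i)[].
- by split=> i; apply: lim => n; case: (h n) => _ _ _ /(_ i)[].
Qed.

End Morphisms.

(** * Linear algebra over K *)

Section CvgForms.
Variables (R : realType) (F : fieldType) (v : absolute_value R F).
Variable (W : zmodType) (act : F -> W -> W).

Lemma cvg_cvW (T : Type) (U : set_system T) (x : T -> W) w : Filter U ->
  (x : T -> fd_topology v act) @ U --> (w : fd_topology v act) -> cvW v act U x w.
Proof.
move=> FU xw l ll e e0.
have h : nbhs (w : fd_topology v act) [set z : fd_topology v act | v (l z - l w) < e].
  by apply: open_nbhs_nbhs; split; [exact: open_form|rewrite /= subrr absv0].
exact: (xw _ h).
Qed.

End CvgForms.

Section Dependence.
Variables (F : fieldType) (K : falgType F).
Hypothesis K_unit : forall x : K, x != 0 -> x \is a GRing.unit.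

(** Gaussian elimination over a division ring: coefficients stay to the left of the unknowns, so
    that commutativity never intervenes. *)
Lemma linear_system_kernel n m (A : 'I_m -> 'I_n -> K) : (n < m)%N ->
  exists x : 'I_m -> K, (exists i, x i != 0) /\ forall j, \sum_i A i j * x i = 0.
Proof.
elim: n m A => [|n IH] [|m] A //= nm.
  by exists (fun=> 1); split; [exists ord0; exact: oner_neq0|case].
have [A0|/existsNP[i0 /eqP Ai0]] := pselect (forall i, A i ord0 = 0).
  have [x [x0 Ax]] := IH _ (fun i j => A i (lift ord0 j)) (ltnW nm).
  exists x; split=> // j; case: (unliftP ord0 j) => [k ->|->]; first exact: Ax.
  by rewrite big1// => i _; rewrite A0 mul0r.
pose B i j := A (lift i0 i) (lift ord0 j) -
   A i0 (lift ord0 j) * (A i0 ord0)^-1 * A (lift i0 i) ord0.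
have [x [[i1 x0] Bx]] := IH _ B nm.
(* The value of the eliminated unknown [i0] forced by the equation [ord0]. *)
pose x' := - ((A i0 ord0)^-1 * \sum_i A (lift i0 i) ord0 * x i).
pose y i := if unlift i0 i is Some j then x j else x'.
exists y; split; first by exists (lift i0 i1); rewrite /y liftK.
have yE j : \sum_i A i j * y i = A i0 j * x' + \sum_i A (lift i0 i) j * x i.
  rewrite (bigD1_ord i0)//= /y unlift_none; congr (_ + _).
  by apply: eq_bigr => i _; rewrite liftK.
move=> j; rewrite yE; case: (unliftP ord0 j) => [k ->|->].
  rewrite -[RHS](Bx k) /B; under [RHS]eq_bigr do rewrite mulrBl.
  rewrite sumrB [RHS]addrC /x' mulrN mulrA mulr_sumr; congr (- _ + _).
  by apply: eq_bigr => i _; rewrite !mulrA.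
by rewrite /x' mulrN mulVKr ?K_unit// addNr.
Qed.

Variable V : vectType K^c.

Lemma linear_dependence n m (y : 'I_n -> V) (z : 'I_m -> V) : (n < m)%N ->
  (forall i, spanned (range y) (z i)) ->
  exists x : 'I_m -> K, (exists i, x i != 0) /\ \sum_i rscale (z i) (x i) = 0.
Proof.
move=> nm yz.
have /choice[A AP] : forall i, exists a : 'I_n -> K, z i = \sum_j rscale (y j) (a j).
  by move=> i; have := yz i; rewrite spanned_rangeE.
have [x [x0 Ax]] := linear_system_kernel A nm; exists x; split => //.
under eq_bigr do rewrite AP rs_sum.
rewrite exchange_big big1//= => j _.
by under eq_bigr do rewrite rsA; rewrite -rs_sumr Ax rs0.
Qed.

Lemma not_spanned n (y : 'I_n -> V) : (n < dim V)%N -> exists w, ~ spanned (range y) w.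
Proof.
move=> nV; apply: contrapT => /forallNP yV.
pose z (i : 'I_(dim V)) : V := r2v (delta_mx 0 i).
have [|x [[i xi] zx]] := @linear_dependence n _ y z nV; first by move=> i; apply: contrapT; exact: yV.
move: xi; apply/negP; rewrite negbK; apply/eqP.
have : v2r (\sum_i rscale (z i) (x i)) = 0 by rewrite zx linear0.
have zE j : v2r (rscale (z j) (x j)) = (x j : K^c) *: delta_mx 0 j.
  by rewrite /rscale linearZ /= /z r2vK.
rewrite linear_sum (eq_bigr _ (fun j _ => zE j)).
move=> /rowP/(_ i); rewrite summxE !mxE (bigD1 i)//= big1 => [|j ij].
  by rewrite !mxE !eqxx addr0 mulr1.
by rewrite !mxE eqxx/= eq_sym (negPf ij) mulr0.
Qed.

Lemma spanned_dim : exists y : 'I_(dim V) -> V, spanned (range y) = [set: V].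
Proof.
exists (fun i => r2v (delta_mx 0 i)).
apply/seteqP; split=> // w _; rewrite spanned_rangeE.
exists (fun i => v2r w 0 i).
apply: (can_inj v2rK); rewrite linear_sum [LHS]row_sum_delta.
by apply: eq_bigr => i _; rewrite /rscale [RHS]linearZ /= r2vK.
Qed.

Lemma fin_dim n (x : 'I_n -> V) : exists2 d, (d <= n)%N & has_dim (spanned (range x)) d.
Proof.
elim: n x => [|n IH] x.
  by exists 0%N => //; exists x; split => // a _ [].
have [fx|] := pselect (free_family x); first by exists n.+1 => //; exists x.
move=> /existsNP[a /not_implyP[ax /existsNP[i /eqP ai]]].
have [d dn hd] := IH (fun j => x (lift i j)).
exists d; first exact: leqW.
rewrite (_ : spanned (range x) = spanned (range (fun j => x (lift i j))))//.
apply/seteqP; split; apply: spanned_sub; try exact: spanned_subspace; last first.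
  by move=> _ [j _ <-]; apply: sub_spanned; exists (lift i j).
move=> _ [j _ <-]; case: (unliftP i j) => [k ->|->]; first by apply: sub_spanned; exists k.
rewrite spanned_rangeE; exists (fun k => - (a (lift i k) * (a i)^-1)).
move: ax; rewrite (bigD1_ord i)//= => /eqP; rewrite addr_eq0 => /eqP ax.
rewrite -[LHS]rs1 -(mulrV (K_unit ai)) -rsA ax rsNl rs_sum -sumrN.
by apply: eq_bigr => k _; rewrite rsA rsN.
Qed.

End Dependence.

Section Scalars.
Variables (R : realType) (F : fieldType) (v : absolute_value R F).
Variables (K : falgType F) (sigma : K -> K).
Hypothesis F_local : local_field v.
Hypothesis K_unit : forall x : K, x != 0 -> x \is a GRing.unit.
Hypothesis sigma_invol : involutive_antiautomorphism sigma.
Hypothesis sigma_cont : sigma_continuous v sigma.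
Hypothesis sigma_scal : forall a : F, exists b : F, sigma a%:A = b%:A.

Notation act := (fun (a : F) (x : K) => a *: x).

Lemma scal_inj : injective (fun a : F => a%:A : K).
Proof. by move=> a b /eqP; rewrite -subr_eq0 -scalerBl scaler_eq0 oner_eq0 orbF subr_eq0 => /eqP. Qed.

(** For the converse direction, a coordinate of [K] that does not vanish at 1 recovers the
    scalar. *)
Lemma cvK_scal (T : Type) (U : set_system T) (x : T -> F) a : Filter U ->
  cvF v U x a <-> cvW v act U (fun n => (x n)%:A) a%:A.
Proof.
move=> FU; split=> [cx l ll|cx].
  have lE b : l b%:A = b * l 1.
    have ll' : Flinear_form act l := ll.
    have l1 : l 0 = 0 by have := ll' 1 0 0; rewrite scaler0 addr0 mul1r => /eqP; rewrite -subr_eq0 opprD addrA subrr sub0r oppr_eq0 => /eqP.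
    by have := ll' b 1 0; rewrite l1 !addr0.
  rewrite lE; apply: (cvF_ext (x := fun n => x n * l 1)); first by move=> n /=; rewrite lE.
  by apply: cvFM => //; exact: cvF_cst.
have [i ci] : exists i, coord (vbasis {:K}) i 1 != 0.
  apply: contrapT => /forallNP h.
  have := coord_vbasis (memvf (1 : K)); rewrite big1 => [/eqP|i _]; first by rewrite oner_eq0.
  by have /negP := h i; rewrite negbK => /eqP ->; rewrite scale0r.
have ll : Flinear_form act (coord (vbasis {:K}) i) by move=> b w w'; rewrite linearD linearZ.
have h := @cvFM _ _ v _ U FU _ _ _ _ (cx _ ll) (@cvF_cst _ _ v _ U FU (coord (vbasis {:K}) i 1)^-1).
have E b : coord (vbasis {:K}) i b%:A / coord (vbasis {:K}) i 1 = b.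
  by rewrite linearZ /= mulfK.
by rewrite -(E a); apply: (@cvF_ext _ _ v _ U FU _ _ _ _ h) => n /=; rewrite E.
Qed.

(** Since [sigma] need not be [F]-linear (complex conjugation), [phi] is only semilinear over [F] in
    its first variable. The twist [sF] and its continuity are what continuity of [phi] requires. *)
Lemma sigma_F : exists sF : F -> F, [/\ forall a, sigma a%:A = (sF a)%:A,
  forall a b, sF (a * b) = sF a * sF b,
  involutive sF &
  forall (T : Type) (U : set_system T) (x : T -> F) a, Filter U ->
    cvF v U x a -> cvF v U (sF \o x) (sF a)].
Proof.
have /choice[sF sFE] := sigma_scal; exists sF; split => //.
- move=> a b; apply: scal_inj; rewrite -sFE.
  have -> : (a * b)%:A = a%:A * b%:A :> K by rewrite mulr_algl scalerA.
  by rewrite (antiM sigma_invol) !sFE mulr_algl scalerA mulrC.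
- by move=> a; apply: scal_inj; rewrite -!sFE (antiK sigma_invol).
- move=> T U x a FU /cvK_scal cx; apply/cvK_scal.
  rewrite -sFE; have -> : (fun n => ((sF \o x) n)%:A) = fun n => sigma (x n)%:A.
    by apply/funext => n; rewrite /= sFE.
  apply: cvg_cvW; have := cvW_cvg FU cx => {}cx.
  exact: (cvg_comp _ _ cx (@sigma_cont a%:A)).
Qed.

(** Powers of the norm [s * sF s] of a small scalar [s]. Continuity of [sF] forces the powers of
    [sF s] to tend to 0 as well, so that its absolute value is also below 1. *)
Lemma small_scalars : exists t : nat -> F,
  [/\ forall n, t n != 0, forall n, sigma (t n)%:A = (t n)%:A & cvF v \oo t 0].
Proof.
have [sF [sFE sFM sFK sFc]] := sigma_F.
have [s' s'1] := absv_gt1_ex F_local; pose s := s'^-1.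
have s'0 : s' != 0 by apply: contraTneq s'1 => ->; rewrite absv0 ltr10.
have s0 : s != 0 by rewrite invr_eq0.
have s1 : v s < 1 by rewrite /s absvV invf_lt1// (lt_trans ltr01).
have sF0 : sF 0 = 0 by apply: scal_inj; rewrite -sFE scale0r (anti0 sigma_invol).
have sF1 : sF 1 = 1 by apply: scal_inj; rewrite -sFE scale1r (anti1 sigma_invol).
have sFX a n : sF (a ^+ n) = sF a ^+ n by elim: n => [|n IH]; rewrite ?expr0// !exprS sFM IH.
have sFs1 : v (sF s) < 1.
  rewrite ltNge; apply/negP => le1.
  have := sFc _ _ _ _ _ (cvF_geom s1); rewrite sF0 => /(_ _)/(_ 1 ltr01)[N _ /(_ N (leqnn N))].
  by rewrite /= sFX subr0 absvX ltNge exprn_ege1.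
have sFs0 : sF s != 0 by apply: contraNneq s0 => h; rewrite -(sFK s) h sF0.
pose t n := (s * sF s) ^+ n; exists t; split=> [n|n|].
- by rewrite expf_neq0// mulf_neq0.
- by rewrite sFE /t sFX sFM sFK mulrC.
- apply: cvF_geom; rewrite absvM.
  by rewrite (le_lt_trans _ s1)// ler_piMr ?absv_ge0// ltW.
Qed.

Variable V : vectType K^c.
Variable phi : V -> V -> K.
Hypothesis phi_herm : hermitian_form sigma phi.

(** In coordinates [phi] is a finite sum of products, with the left coordinates twisted by [sF].
    Composition with a linear form [m] on [K] keeps everything inside [F]. *)
Lemma phi_cvg (T : Type) (U : set_system T) (x x' : T -> V) a a' m : Filter U ->
  cvV v U x a -> cvV v U x' a' -> Flinear_form act m ->
  cvF v U (fun n => m (phi (x n) (x' n))) (m (phi a a')).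
Proof.
move=> FU cx cx' mm; have [sF [sFE _ _ sFc]] := sigma_F.
have mD k k' : m (k + k') = m k + m k' by have := mm 1 k k'; rewrite scale1r mul1r.
have m0 : m 0 = 0 by apply: (addrI (m 0)); rewrite -mD !addr0.
have mZ c k : m (c *: k) = c * m k by have := mm c k 0; rewrite m0 !addr0.
have m_sum I (r : seq I) (h : I -> K) : m (\sum_(i <- r) h i) = \sum_(i <- r) m (h i).
  by elim/big_rec2 : _ => // i c d _ <-.
have phi_suml I (r : seq I) (h : I -> V) w : phi (\sum_(i <- r) h i) w = \sum_(i <- r) phi (h i) w.
  by elim/big_rec2 : _ => [|i c d _ <-]; [exact: (phi0l sigma_invol phi_herm)|exact: (phiDl phi_herm)].
have phi_sumr I (r : seq I) (h : I -> V) w : phi w (\sum_(i <- r) h i) = \sum_(i <- r) phi w (h i).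
  by elim/big_rec2 : _ => [|i c d _ <-]; [exact: (phi0r sigma_invol phi_herm)|exact: (phiDr phi_herm)].
have phiF u w c d : phi (rscale u c%:A) (rscale w d%:A) = (sF c * d) *: phi u w.
  by rewrite (phiZ phi_herm) sFE mulr_algl mulr_algr scalerA mulrC.
have E u w : m (phi u w) = \sum_i \sum_j sF (Vcoord i u) * Vcoord j w * m (phi (Vbase i) (Vbase j)).
  rewrite {1}(Vcoord_sum u) {1}(Vcoord_sum w) phi_suml m_sum; apply: eq_bigr => i _.
  rewrite phi_sumr m_sum; apply: eq_bigr => j _.
  by rewrite phiF mZ.
rewrite E; apply: (cvF_ext (x := fun n => \sum_i \sum_j sF (Vcoord i (x n)) * Vcoord j (x' n) * m (phi (Vbase i) (Vbase j)))).
  by move=> n; rewrite E.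
apply: cvF_sum => i _; apply: cvF_sum => j _; apply: cvFM; last exact: cvF_cst.
apply: cvFM; last by apply: cx'; exact: Vcoord_form.
by apply: sFc; apply: cx; exact: Vcoord_form.
Qed.

Lemma K_forms_separate (k : K) : (forall m, Flinear_form act m -> m k = 0) -> k = 0.
Proof.
move=> h; rewrite (coord_vbasis (memvf k)) big1// => i _.
have -> : coord (vbasis {:K}) i k = 0 by apply: h => b w w'; rewrite linearD linearZ.
by rewrite scale0r.
Qed.

Lemma phi_cvg_eq (T : Type) (U : set_system T) (x x' y y' : T -> V) a a' b b' : ProperFilter U ->
  cvV v U x a -> cvV v U x' a' -> cvV v U y b -> cvV v U y' b' ->
  U [set n | phi (x n) (x' n) = phi (y n) (y' n)] -> phi a a' = phi b b'.
Proof.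
move=> PU cx cx' cy cy' UE; apply/eqP; rewrite -subr_eq0; apply/eqP.
apply: K_forms_separate => m mm.
have mD k k' : m (k + k') = m k + m k' by have := mm 1 k k'; rewrite scale1r mul1r.
have m0 : m 0 = 0 by apply: (addrI (m 0)); rewrite -mD !addr0.
have mN k : m (- k) = - m k by apply: (addrI (m k)); rewrite -mD !subrr m0.
apply: (@cvF_unique _ _ v _ U PU (fun n => m (phi (x n) (x' n)) - m (phi (y n) (y' n)))).
  rewrite mD mN; apply: cvFB; exact: phi_cvg.
move=> e e0; apply: filterS UE => n /= ->.
by rewrite !subrr absv0.
Qed.

Lemma phi_cvg_neq0 (T : Type) (U : set_system T) (x x' : T -> V) a a' : Filter U ->
  cvV v U x a -> cvV v U x' a' -> phi a a' != 0 -> U [set n | phi (x n) (x' n) != 0].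
Proof.
move=> FU cx cx' aa'.
have [m mm ma] : exists2 m, Flinear_form act m & m (phi a a') != 0.
  apply: contrapT => h; case/eqP: aa'; apply: K_forms_separate => m mm.
  by apply: contrapT => /eqP ma; apply: h; exists m.
apply: filterS (cvF_neq0 (phi_cvg FU cx cx' mm) ma) => n /=.
apply: contraNneq => ->; apply/eqP.
by have := mm 1 0 0; rewrite scaler0 addr0 mul1r => /eqP; rewrite -subr_eq0 opprD addrA subrr sub0r oppr_eq0 => /eqP.
Qed.

End Scalars.

(** * The scalars and their involution *)

Section RealEndomorphism.
Variables (R : realType) (s : R -> R).
Hypotheses (sB : {morph s : x y / x - y}) (sM : {morph s : x y / x * y}) (s1 : s 1 = 1).

(** Nonnegative reals are squares, so [s] is monotone; it fixes the rationals, which are dense. *)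
Lemma real_endo_id x : s x = x.
Proof.
have mono a b : a <= b -> s a <= s b.
  by move=> ab; rewrite -subr_ge0 -sB -(sqr_sqrtr (a := b - a)) ?subr_ge0// expr2 sM -expr2 sqr_ge0.
pose f : {rmorphism R -> R} := HB.pack s (GRing.isZmodMorphism.Build R R s sB)
  (GRing.isMonoidMorphism.Build R R s (conj s1 sM)).
have sq (q : rat) : s (ratr q) = ratr q by exact: (fmorph_rat f).
case: (ltgtP (s x) x) => // /rat_in_itvoo[q]; rewrite in_itv /= => /andP[h1 h2].
  by have := mono _ _ (ltW h2); rewrite sq leNgt h1.
by have := mono _ _ (ltW h1); rewrite sq leNgt h2.
Qed.

End RealEndomorphism.

Section Quaternions.
Variables (F : fieldType) (K : falgType F).
Hypothesis F_char : 2%N \notin [pchar F].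

Lemma dim1_scalar : \dim {:K} = 1%N -> forall x : K, exists r : F, x = r%:A.
Proof.
move=> d1 x; apply/vlineP.
suff -> : <[1 : K]>%VS = fullv by exact: memvf.
by apply/eqP; rewrite eqEdim subvf d1 dim_vline oner_eq0.
Qed.

Lemma scalar_comm (r : F) (x : K) : r%:A * x = x * r%:A.
Proof. by rewrite mulr_algl mulr_algr. Qed.

Lemma double_eq0 (x : K) : x + x = 0 -> x = 0.
Proof.
move=> /eqP; rewrite -mulr2n -scaler_nat scaler_eq0 => /orP[|/eqP//].
by rewrite (negPf (two_neq0 F_char)).
Qed.

Variables i j : K.
Hypothesis gens : quaternion_generators i j.

Lemma quaternion_coords (x : K) : exists x0 x1 x2 x3 : F,
  x = x0%:A + (x1 *: i + x2 *: j + x3 *: (i * j)).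
Proof.
case: gens => a [b [_ _ _ _ B]]; pose X := [tuple 1; i; j; i * j].
have := coord_basis (X := X) B (memvf x); rewrite !big_ord_recl big_ord0 addr0 /= => ->.
by do 4![eexists]; rewrite -!addrA.
Qed.

Let ij_anti : j * i = - (i * j).
Proof. by case: gens => a [b [_ _ _ -> _]]; rewrite opprK. Qed.

Lemma quaternion_neq0 : [/\ i != 0, j != 0, i * j != 0 & forall x0 x1 x2 x3 : F,
  x0%:A + (x1 *: i + x2 *: j + x3 *: (i * j)) = 0 -> [/\ x0 = 0, x1 = 0, x2 = 0 & x3 = 0]].
Proof.
case: gens => a [b [_ _ _ _ /basis_free B]]; have fr x0 x1 x2 x3 :
  x0%:A + (x1 *: i + x2 *: j + x3 *: (i * j)) = 0 -> [/\ x0 = 0, x1 = 0, x2 = 0 & x3 = 0].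
  move=> E; have /freeP B' : free [tuple 1; i; j; i * j] := B.
  have := B' (fun k => nth 0 [:: x0; x1; x2; x3] k).
  rewrite !big_ord_recl big_ord0 addr0 /= -!addrA addrA addrA in E * => h.
  have {}h := h E.
  by split; [have := h 0|have := h 1|have := h 2|have := h 3].
split=> //; apply/eqP => z.
- by have [] := fr 0 1 0 0; rewrite ?z ?scale0r ?scaler0 ?addr0// => _ /eqP; rewrite oner_eq0.
- by have [] := fr 0 0 1 0; rewrite ?z ?scale0r ?scaler0 ?addr0// => _ _ /eqP; rewrite oner_eq0.
- by have [] := fr 0 0 0 1; rewrite ?z ?scale0r ?scaler0 ?addr0// => _ _ _ /eqP; rewrite oner_eq0.
Qed.

Lemma quaternion_noncomm : ~ (forall x y : K, x * y = y * x).
Proof.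
move=> c; have [_ _ + _] := quaternion_neq0; move/eqP; apply; apply: double_eq0.
by rewrite {1}c ij_anti addNr.
Qed.

(** The part [u] of [x] along [j] and [i * j] anticommutes with [i]; commuting with [i] kills it,
    because [i * i] is a nonzero scalar and 2 is nonzero. Commuting with [j] then kills the
    coordinate along [i]. *)
Lemma quaternion_center (x : K) : (forall y, x * y = y * x) -> exists r : F, x = r%:A.
Proof.
case: gens => a [b [[a0 b0] ii jj _ _]] c.
have [x0 [x1 [x2 [x3 E]]]] := quaternion_coords x; exists x0.
have [_ _ k0 fr] := quaternion_neq0.
pose u := x2 *: j + x3 *: (i * j).
have ui : u * i = - (i * u).
  by rewrite /u mulrDl mulrDr -!scalerAl -!scalerAr ij_anti -[i * j * i]mulrA ij_anti mulrN !scalerN opprD.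
rewrite -(addrA (x1 *: i)) -/u in E; clearbody u => {fr x2 x3}.
have u0 : u = 0.
  have iu : i * u = 0.
    have h := c i; rewrite E !mulrDl !mulrDr scalar_comm -!scalerAl -!scalerAr in h.
    move/addrI/addrI: h; rewrite ui => h; apply: double_eq0; by rewrite -{1}h addNr.
  have : (i * i) * u = 0 by rewrite -mulrA iu mulr0.
  by rewrite -expr2 ii mulr_algl => /eqP; rewrite scaler_eq0 (negPf a0) => /eqP.
have x10 : x1 = 0.
  have h := c j; rewrite E u0 addr0 mulrDl mulrDr scalar_comm in h.
  move/addrI: h; rewrite -scalerAl -scalerAr ij_anti => h.
  have /double_eq0/eqP : x1 *: (i * j) + x1 *: (i * j) = 0 by rewrite {1}h scalerN addNr.
  by rewrite scaler_eq0 (negPf k0) orbF => /eqP.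
by rewrite E u0 x10 scale0r !addr0.
Qed.

End Quaternions.

Section Scalars.
Variables (R : realType) (F : fieldType) (v : absolute_value R F).
Variables (K : falgType F) (sigma : K -> K).
Hypothesis F_char : 2%N \notin [pchar F].
Hypothesis K_cases : \dim {:K} = 1%N \/ quaternion_division_algebra K.
Hypothesis sigma_invol : involutive_antiautomorphism sigma.

Lemma division_unit (x : K) : x != 0 -> x \is a GRing.unit.
Proof.
case: K_cases => [d1|[+ _]]; last by apply.
have [r ->] := dim1_scalar d1 x => rn.
have r0 : r != 0 by apply: contraNneq rn => ->; rewrite scale0r.
by apply/unitrP; exists (r^-1)%:A; rewrite !mulr_algl !scalerA mulVf// divff// scale1r.
Qed.

(** An anti-automorphism preserves the centre, which consists of the scalars in the quaternion
    case. *)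
Lemma sigma_scalar (a : F) : exists b : F, sigma a%:A = b%:A.
Proof.
case: K_cases => [d1|[_ [i [j gens]]]]; first exact: dim1_scalar.
apply: (quaternion_center F_char gens) => y.
by rewrite -[y](antiK sigma_invol) -!(antiM sigma_invol) scalar_comm.
Qed.

(** The identity is an anti-automorphism only of a commutative ring, which excludes quaternions. *)
Lemma id_scalar : sigma =1 id -> forall x : K, exists r : F, x = r%:A.
Proof.
move=> sid; case: K_cases => [d1|[_ [i [j gens]]]]; first exact: dim1_scalar.
case: (quaternion_noncomm F_char gens) => x y.
by rewrite -(sid (x * y)) (antiM sigma_invol) !sid.
Qed.

Lemma standard_symmetric : standard_quaternionic_involution sigma ->
  forall x, sigma x = x -> exists r : F, x = r%:A.
Proof.
move=> [i [j [gens [si sj sk] sF]]] x sx.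
have [x0 [x1 [x2 [x3 E]]]] := quaternion_coords gens x; exists x0.
have sZ (a : F) y : sigma (a *: y) = a *: sigma y.
  by rewrite -mulr_algl (antiM sigma_invol) sF mulr_algr.
rewrite E; suff -> : x1 *: i + x2 *: j + x3 *: (i * j) = 0 by rewrite addr0.
apply: (double_eq0 F_char); move: sx; rewrite E !(antiD sigma_invol) sF !sZ si sj sk !scalerN -!opprD.
by move=> /addrI h; rewrite -{1}h addNr.
Qed.

Lemma real_scalar_fixed (h : {rmorphism R -> F}) (g : F -> R) : cancel h g -> cancel g h ->
  forall r : F, sigma r%:A = r%:A.
Proof.
move=> hK gK; have /choice[sF sFE] := sigma_scalar.
have sFB x y : sF (x - y) = sF x - sF y.
  by apply: (@scal_inj _ K); rewrite -sFE !scalerBl (antiD sigma_invol) (antiN sigma_invol) !sFE.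
have AM (a b : F) : (a * b)%:A = a%:A * b%:A :> K by rewrite mulr_algl scalerA.
have sFM x y : sF (x * y) = sF x * sF y.
  by apply: (@scal_inj _ K); rewrite -sFE !AM (antiM sigma_invol) !sFE -!AM mulrC.
have sF1 : sF 1 = 1.
  by apply: (@scal_inj _ K); rewrite -sFE scale1r (anti1 sigma_invol).
move=> r; rewrite sFE; congr (_%:A); rewrite -(gK r) -[LHS]gK; congr (h _).
apply: (@real_endo_id _ (fun x => g (sF (h x)))) => [x y|x y|].
- by apply: (can_inj hK); rewrite !(gK, rmorphB) sFB.
- by apply: (can_inj hK); rewrite !(gK, rmorphM) sFM.
- by apply: (can_inj hK); rewrite gK !rmorph1 sF1.
Qed.

(* k^-1 * z is fixed by the involution x |-> k^-1 * sigma x * k, so its square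
   roots in the field it generates are fixed too. *)
Lemma Hamilton_norm (z k : K) : Hamilton_quaternions v K ->
  ~ (forall x, sigma x = x -> exists r : F, x = r%:A) ->
  sigma z = z -> sigma k = k -> k != 0 -> exists x, sigma x * k * x = z.
Proof.
move=> [[h [g [hK gK _ _]]] [i [j [gens ii jj]]]] nsym sz sk k0.
have K_unit := division_unit.
have sF := real_scalar_fixed hK gK.
pose H (r : R) : K := (h r)%:A.
have HD r s : H (r + s) = H r + H s by rewrite /H rmorphD scalerDl.
have HN r : H (- r) = - H r by rewrite /H rmorphN scaleNr.
have HM r s : H (r * s) = H r * H s by rewrite /H rmorphM mulr_algl scalerA.
have HC r x : H r * x = x * H r by exact: scalar_comm.
have sH r : sigma (H r) = H r by exact: sF.
have HE (r : F) : r%:A = H (g r) by rewrite /H gK.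
have ij : j * i = - (i * j) by case: gens => a [b [_ _ _ -> _]]; rewrite opprK.
have sqD x y : y * x = - (x * y) -> (x + y) * (x + y) = x * x + y * y :> K.
  by move=> E; rewrite mulrDl !mulrDr E addrA addrK.
(* Real part [H a] plus a pure quaternion [p], whose square is a nonpositive real vanishing only
   with [p]. *)
have pure x : exists a m p, [/\ x = H a + p, p * p = - H m, 0 <= m & m = 0 -> p = 0].
  have [x0 [x1 [x2 [x3 ->]]]] := quaternion_coords gens x.
  exists (g x0), (g x1 ^+ 2 + g x2 ^+ 2 + g x3 ^+ 2), (x1 *: i + x2 *: j + x3 *: (i * j)).
  rewrite -HE; split=> //; last 2 first.
  - by rewrite !addr_ge0// sqr_ge0.
  - move=> /eqP; rewrite !paddr_eq0 ?addr_ge0 ?sqr_ge0// !sqrf_eq0 => /andP[/andP[]].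
    have g0 y : g y == 0 -> y = 0 by move=> /eqP E; rewrite -(gK y) E rmorph0.
    by move=> /g0 -> /g0 -> /g0 ->; rewrite !scale0r !addr0.
  have ki : i * j * i = - (i * (i * j)) by rewrite -mulrA ij mulrN.
  have kj : i * j * j = - (j * (i * j)) by rewrite [j * _]mulrA ij mulNr opprK.
  have kk : i * j * (i * j) = - 1.
    by rewrite mulrA ki mulNr !mulrA -expr2 ii mulN1r mulNr -expr2 jj opprK.
  rewrite sqD; last first.
    by rewrite mulrDl mulrDr -!scalerAl -!scalerAr ki kj !scalerN !scalerA ![x3 * _]mulrC opprD.
  rewrite sqD; last by rewrite -!scalerAl -!scalerAr ij !scalerN !scalerA mulrC.
  rewrite -!scalerAl -!scalerAr kk -!expr2 ii jj !scalerA !scalerN -!opprD -!scalerDl.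
  by congr (- _%:A); rewrite !rmorphD !rmorphXn /= !gK.
have [a [m [p [yE pp m0 mp]]]] := pure (k^-1 * z).
have kyz : k * (k^-1 * z) = z by rewrite mulrA mulrV ?mul1r ?K_unit.
have syk : sigma (k^-1 * z) * k = z.
  by rewrite (antiM sigma_invol) sz (antiV K_unit sigma_invol) sk -mulrA mulVr ?mulr1 ?K_unit.
have spk : sigma p * k = k * p.
  have E : p = k^-1 * z - H a by rewrite yE addrC addKr.
  rewrite E (antiD sigma_invol) (antiN sigma_invol) sH mulrDl mulrBr kyz syk mulNr HC //.
have [p0|p0] := eqVneq p 0; last first.
  have m1 : 0 < m by rewrite lt_def m0 andbT; apply: contraNneq p0 => /mp/eqP.
  (* [H a + p] generates a copy of the complex numbers, with modulus [r]. The root [c + d * p] is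
     given by the usual formula for a complex square root: [c] is its real part, and
     [2 * c * d = 1]. *)
  pose r := Num.sqrt (a ^+ 2 + m); pose c := Num.sqrt ((a + r) / 2).
  have rr : r ^+ 2 = a ^+ 2 + m by rewrite sqr_sqrtr// addr_ge0 ?sqr_ge0.
  have ar : 0 < a + r.
    have am : 0 < a ^+ 2 + m by have := sqr_ge0 a; lra.
    have : `|a| < r by rewrite -(sqrtr_sqr a) (ltr_sqrt _ am) ltrDl.
    by have := ler_norm (- a); rewrite normrN => h1 h2; lra.
  have cc : c ^+ 2 = (a + r) / 2 by rewrite sqr_sqrtr// divr_ge0// ltW.
  have c0 : c != 0 by rewrite gt_eqF// sqrtr_gt0 divr_gt0.
  pose d := (2 * c)^-1.
  have e1 : c * c - d * d * m = a.
    have -> : m = (r - a) * (r + a) by rewrite -[m](addKr (a ^+ 2)) -rr; ring.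
    have -> : r = 2 * c ^+ 2 - a by rewrite cc; field.
    by rewrite /d; field.
  have e2 : c * d + d * c = 1 by rewrite /d; field.
  exists (H c + H d * p).
  have sx : sigma (H c + H d * p) * k = k * (H c + H d * p).
    rewrite (antiD sigma_invol) (antiM sigma_invol) !sH mulrDl mulrDr HC; congr (_ + _).
    by rewrite -HC -mulrA spk mulrA HC -!mulrA HC.
  rewrite sx -mulrA -[RHS]kyz; congr (_ * _); rewrite yE.
  rewrite mulrDl !mulrDr.
  have -> : H d * p * (H d * p) = - H (d * d * m).
    by rewrite -mulrA [p * _]mulrA -(HC d p) -mulrA pp !mulrN -!HM mulrA.
  have -> : H d * p * H c = H (d * c) * p by rewrite -mulrA -(HC c p) mulrA -HM.
  rewrite mulrA -!HM -addrA addrA addrA -HN.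
  rewrite addrAC (addrAC (H (c * c))) -HD e1 -addrA -mulrDl -HD e2.
  by rewrite /H rmorph1 scale1r mul1r.
have zE : z = k * H a by rewrite -kyz yE p0 addr0.
have [a0|a0] := leP 0 a.
  exists (H (Num.sqrt a)); rewrite sH HC -mulrA -HM -expr2 sqr_sqrtr// -zE.
(* For [z = k * H a] with [a < 0], a real square root does not exist. A pure [q] fixed by the
   twisted involution replaces it, as [q * q] is a negative real. It is the pure part of [k] or, if
   [k] is a scalar, of a symmetric element that is not a scalar. *)
have [q [m' [q0 sq qq m'0]]] : exists q m', [/\ q != 0, sigma q * k = k * q, q * q = - H m' & 0 < m'].
  have from s : (forall r : F, s <> r%:A) -> sigma s * k = k * s ->
      exists q m', [/\ q != 0, sigma q * k = k * q, q * q = - H m' & 0 < m'].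
    move=> ns ss; have [b [m' [q [sE qq m'0 mq]]]] := pure s; exists q, m'.
    have q0 : q != 0 by apply/eqP => q0; apply: (ns (h b)); rewrite sE q0 addr0.
    split=> //; last by rewrite lt_def m'0 andbT; apply: contraNneq q0 => /mq/eqP.
    have -> : q = s - H b by rewrite sE addrC addKr.
    by rewrite (antiD sigma_invol) (antiN sigma_invol) sH mulrDl mulrBr ss mulNr HC.
  have [[r kr]|/forallNP kn] := pselect (exists r : F, k = r%:A); last by apply: (from k) => //; rewrite sk.
  move: nsym => /existsNP[s /not_implyP[ss /forallNP sn]]; apply: (from s) => //.
  by rewrite ss kr scalar_comm.
have e0 : 0 <= - a / m' by rewrite divr_ge0 ?oppr_ge0// ltW.
pose r := Num.sqrt (- a / m').
have rr : r * r = - a / m' by rewrite -expr2 sqr_sqrtr.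
exists (q * H r).
rewrite (antiM sigma_invol) sH -(mulrA (H r)) sq.
have -> : H r * (k * q) * (q * H r) = k * (H r * (q * q) * H r) by rewrite !mulrA (HC r k).
rewrite qq mulrN mulNr -!HM -HN zE; congr (_ * H _).
by rewrite mulrAC rr divfK ?opprK// gt_eqF.
Qed.

(** For a skew [B], the element [A = B / g] makes [A * g] skew, and [A + sigma A] is symmetric. If
    it vanishes, [x = 0] works. If all symmetric elements are scalars, a rescaling of [A] by a
    scalar fixed by [sigma] gives the value [k], with [x = 1]. Otherwise [K] is the Hamilton
    algebra, by the assumption on [sigma], and [Hamilton_norm] solves for [x]. *)
Lemma norm_equation : (quaternion_division_algebra K -> ~ Hamilton_quaternions v K ->
    standard_quaternionic_involution sigma) -> ~ (sigma =1 id) ->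
  forall g k : K, g != 0 -> k != 0 -> sigma k = k -> exists A x : K, [/\ A != 0,
     sigma (A * g) = - (A * g) & A + sigma A = sigma x * k * x].
Proof.
move=> std nid g k g0 k0 sk; have K_unit := division_unit.
have [x0 x0n] : exists x, sigma x <> x by apply/existsNP.
pose B := x0 - sigma x0.
have B0 : B != 0 by rewrite subr_eq0; apply/eqP => E; apply: x0n.
have sB : sigma B = - B by rewrite /B (antiD sigma_invol) (antiN sigma_invol) (antiK sigma_invol) opprB.
pose A := B * g^-1.
have A0 : A != 0 by apply/eqP => E; move: B0; rewrite -[B]mulr1 -(mulVr (K_unit _ g0)) mulrA -/A E mul0r eqxx.
have Ag : A * g = B by rewrite /A -mulrA mulVr ?K_unit// mulr1.
have sh : sigma (A + sigma A) = A + sigma A by rewrite (antiD sigma_invol) (antiK sigma_invol) addrC.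
clearbody A B.
have [h0|h0] := eqVneq (A + sigma A) 0.
  by exists A, 0; rewrite Ag h0 mulr0.
have [sym|nsym] := pselect (forall x, sigma x = x -> exists r : F, x = r%:A).
  have [r hr] := sym _ sh; have [s ks] := sym _ sk.
  have r0 : r != 0 by apply: contraNneq h0 => r0; rewrite hr r0 scale0r.
  have s0 : s != 0 by apply: contraNneq k0 => s0; rewrite ks s0 scale0r.
  have AM (a b : F) : (a * b)%:A = a%:A * b%:A :> K by rewrite mulr_algl scalerA.
  have sr : sigma (s / r)%:A = (s / r)%:A.
    have rK : (s / r)%:A * r%:A = s%:A :> K by rewrite -AM divfK.
    have ru : (r%:A : K) \is a GRing.unit by apply: K_unit; rewrite scaler_eq0 oner_eq0 orbF.
    have sR : sigma r%:A = r%:A by rewrite -hr sh.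
    apply: (mulIr ru); rewrite -[X in _ * X = _]sR -(antiM sigma_invol) -scalar_comm rK.
    by rewrite -ks sk.
  exists ((s / r)%:A * A), 1; split.
  - by rewrite mulr_algl scaler_eq0 negb_or A0 mulf_neq0 ?invr_eq0.
  - by rewrite -mulrA Ag (antiM sigma_invol) sr sB scalar_comm mulNr.
  - rewrite (anti1 sigma_invol) mulr1 mul1r (antiM sigma_invol) sr -scalar_comm -mulrDr hr -AM divfK//.
case: K_cases => [d1|qK]; first by case: nsym => x _; exact: dim1_scalar.
have [Ham|nHam] := pselect (Hamilton_quaternions v K); last first.
  by case: nsym; exact: standard_symmetric (std qK nHam).
have [x xE] := Hamilton_norm Ham nsym sh sk k0.
by exists A, x; rewrite Ag xE.
Qed.

Lemma complex_square (h : {rmorphism R[i] -> F}) : topological_iso v h ->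
  forall x : F, exists y, x = y * y.
Proof.
move=> [g [hK gK _ _]] x; exists (h (sqrtC (g x))).
by rewrite -rmorphM -expr2 sqrtCK gK.
Qed.

Lemma real_square (h : {rmorphism R -> F}) (r : R) : topological_iso v h ->
  (exists x : F, h r = x * x) <-> 0 <= r.
Proof.
move=> [g [hK gK _ _]]; split=> [[x xE]|r0].
  have -> : r = g x ^+ 2 by apply: (can_inj hK); rewrite rmorphXn /= gK xE expr2.
  exact: sqr_ge0.
by exists (h (Num.sqrt r)); rewrite -rmorphM -expr2 sqr_sqrtr.
Qed.

End Scalars.

(** * Hyperbolic frames *)

Section Geometry.
Variables (R : realType) (F : fieldType) (v : absolute_value R F).
Variables (K : falgType F) (V : vectType K^c).
Variables (sigma : K -> K) (phi : V -> V -> K) (e : 'I_4 -> V).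
Hypothesis K_unit : forall x : K, x != 0 -> x \is a GRing.unit.
Hypothesis sigma_invol : involutive_antiautomorphism sigma.
Hypothesis phi_herm : hermitian_form sigma phi.
Hypothesis F_char : 2%N \notin [pchar F].
Hypothesis phi_nondeg : nondegenerate_form phi.
Hypothesis phi_index : Witt_index phi 2.
Hypothesis e_std : standard_frame phi e.
Hypothesis V_dim : (5 <= dim V)%N.
Implicit Types (u w a b y z : V).
Let e_free : free_family e. Proof. by case: e_std. Qed.
Let sD := antiD sigma_invol.
Let sM := antiM sigma_invol.
Let sK := antiK sigma_invol.
Let s0 := anti0 sigma_invol.
Let s1 := anti1 sigma_invol.
Let sN := antiN sigma_invol.
Let s_eq0 := anti_eq0 sigma_invol.
Let phiE := phiE sigma_invol phi_herm.
Let phiC := phiC phi_herm.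
Let phi_eq0C := phi_eq0C sigma_invol phi_herm.
Let phiDl := phiDl phi_herm.
Let phiDr := phiDr phi_herm.
Let phiZl := phiZl phi_herm.
Let phiZr := phiZr sigma_invol phi_herm.
Let tiso_pl := tiso_pl sigma_invol phi_herm.
Let tiso_ln := tiso_ln phi_herm.
Let free2P := @free2P F K V K_unit.
Let phiNl := phiNl sigma_invol phi_herm.
Let phiNr := phiNr sigma_invol phi_herm.

Lemma KV x : x != 0 -> x^-1 * x = 1 :> K.
Proof. by move=> x0; rewrite mulVr// K_unit. Qed.

Lemma KVr x : x != 0 -> x * x^-1 = 1 :> K.
Proof. by move=> x0; rewrite mulrV// K_unit. Qed.

Lemma KM0 (x y : K) : x * y = 0 -> x != 0 -> y = 0.
Proof. by move=> xy x0; apply: (mulrI (K_unit x0)); rewrite mulr0. Qed.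

Definition halve (x : K) : K := (2^-1 : F) *: x.

Lemma halveD x : halve x + halve x = x.
Proof.
have t0 := two_neq0 F_char.
rewrite /halve -scalerDl -[RHS]scale1r; congr (_ *: _).
by field.
Qed.

Lemma halve_inj (x y : K) : x + x = y + y -> x = y.
Proof.
have hh (c : K) : halve (c + c) = c by rewrite -[RHS](halveD c) /halve scalerDr.
by move=> /(congr1 halve); rewrite !hh.
Qed.

Lemma halve_sym x : sigma x = x -> sigma (halve x) = halve x.
Proof. by move=> sx; apply: halve_inj; rewrite -sD !halveD. Qed.

Lemma q_sym u : sigma (phi u u) = phi u u. Proof. by rewrite -phiC. Qed.

(** Otherwise [a], [b], [x] would span a totally isotropic space of dimension 3; a maximal totally
    isotropic subspace containing it, found by Zorn's lemma, would have dimension 2 by the Witt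
    index. This is the form in which the Witt index is used throughout. *)
Lemma isotropic_perp_plane a b x : free2 a b -> phi a a = 0 -> phi b b = 0 -> phi a b = 0 ->
  phi x x = 0 -> phi a x = 0 -> phi b x = 0 -> pl a b x.
Proof.
move=> fab aa bb ab xx ax bx.
pose S : set V := [set w | exists p r, pl a b p /\ w = p + rscale x r].
have plab0 : pl a b 0 by case: (pl_subspace a b).
have plD p p' : pl a b p -> pl a b p' -> pl a b (p + p') by case: (pl_subspace a b) => _ + _; apply.
have plZ p r : pl a b p -> pl a b (rscale p r) by case: (pl_subspace a b) => _ _; apply.
have sS : Defs.subspace S.
  split.
  - by exists 0, 0; rewrite rs0 addr0.
  - move=> _ _ [p [r [pp ->]]] [p' [r' [pp' ->]]].
    by exists (p + p'), (r + r'); split; [exact: plD|rewrite rsDr addrACA].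
  - move=> _ r' [p [r [pp ->]]]; exists (rscale p r'), (r * r').
    by split; [exact: plZ|rewrite rsDl rsA].
have tp : totally_isotropic phi (pl a b) by exact: tiso_pl.
have px p : pl a b p -> phi p x = 0.
  by move=> /plP[r [r' ->]]; rewrite !phiE ax bx !mulr0 addr0.
have tS : totally_isotropic phi S.
  move=> _ _ [p [r [pp ->]]] [p' [r' [pp' ->]]].
  rewrite !phiE (tp _ _ pp pp') xx (px _ pp) (phi_eq0C (px _ pp')).
  by rewrite !(mulr0, mul0r, addr0).
pose P (M : set V) := Defs.subspace M /\ totally_isotropic phi M /\ S `<=` M.
(* The property is imposed on the union with [S], so that the empty chain, whose union is the empty
   set, also satisfies it. *)
have [|M [[sM' [tM SM]] maxM]] := @Zorn_bigcup V (fun M => P (M `|` S)).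
  move=> A AP Atot.
  have [A0|/set0P A0] := eqVneq A set0.
    by rewrite A0 bigcup_set0 set0U; split=> //; split.
  have two M N : A M -> A N -> exists2 L, A L & M `<=` L /\ N `<=` L.
    by move=> AM AN; have [h|h] := Atot _ _ AM AN; [exists N => //; split|exists M => //; split].
  have [M0 AM0] := A0.
  have mem w : (\bigcup_(X in A) X `|` S) w -> exists2 L, A L & (L `|` S) w.
    by move=> [[L AL Lw]|Sw]; [exists L => //; left|exists M0 => //; right].
  have mem2 w w' : (\bigcup_(X in A) X `|` S) w -> (\bigcup_(X in A) X `|` S) w' ->
     exists2 L, A L & (L `|` S) w /\ (L `|` S) w'.
    move=> /mem[L AL Lw] /mem[L' AL' Lw']; have [N AN [LN LN']] := two _ _ AL AL'.
    exists N => //; split; [case: Lw => [/LN|]|case: Lw' => [/LN'|]]; by [left|right].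
  have up L w : A L -> (L `|` S) w -> (\bigcup_(X in A) X `|` S) w.
    by move=> AL [Lw|Sw]; [left; exists L|right].
  split; [split|split].
  - by right; case: sS.
  - move=> w w' /mem2/[apply] -[L AL [Lw Lw']]; apply: (up L) => //.
    by have [[_ + _] _] := AP _ AL; apply.
  - move=> w r /mem[L AL Lw]; apply: (up L) => //.
    by have [[_ _ +] _] := AP _ AL; apply.
  - move=> w w' /mem2/[apply] -[L AL [Lw Lw']].
    by have [_ [+ _]] := AP _ AL; apply.
  - by move=> w Sw; right.
have mM : maximal_totally_isotropic phi (M `|` S).
  split=> // W sW tW MW.
  have [//|WM] := pselect (W = M `|` S).
  case: (maxM W).
    split; first by move=> w Mw; apply: MW; left.
    move=> WsubM; apply: WM; apply/seteqP; split=> // w Ww; left; exact: WsubM.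
  rewrite /P; have -> : W `|` S = W.
    by apply/seteqP; split=> [w [//|Sw]|w Ww]; [apply: MW; right|left].
  by split=> //; split=> // w Sw; apply: MW; right.
have [c [d [fcd E]]] := has_dim2 (phi_index mM).
have inM p : S p -> spanned (range (fr2 c d)) p.
  by rewrite range_fr2 -/(pl c d) -E; right.
pose z3 (i : 'I_3) : V := if i == 0 then a else if i == 1 then b else x.
have Sz i : spanned (range (fr2 c d)) (z3 i).
  apply: inM; rewrite /z3; case: ifP => _; last case: ifP => _.
  - by exists a, 0; rewrite rs0 addr0; split=> //; exact: pl_l.
  - by exists b, 0; rewrite rs0 addr0; split=> //; exact: pl_r.
  - by exists 0, 1; rewrite rs1 add0r.
have [r [[i ri] r0]] := linear_dependence K_unit (n := 2) (m := 3) (y := fr2 c d) (z := z3) isT Sz.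
move: r0; rewrite !big_ord_recl big_ord0 /z3 /= addr0.
set r0 := r _; set r1 := r _; set r2 := r _ => rE.
have [r20|r20] := eqVneq r2 0.
  have [r00 r10] : r0 = 0 /\ r1 = 0 by apply: fab; rewrite -rE r20 rs0 addr0.
  case/negP: ri; apply/eqP; have r0E := r00; have r1E := r10.
  case: i => -[|[|[|//]]] lt; [rewrite -r00|rewrite -r10|rewrite -r20]; congr (r _); exact: val_inj.
apply/plP; exists (- (r0 * r2^-1)), (- (r1 * r2^-1)).
rewrite !rsN -opprD -!rsA -rsDl -[LHS]rs1 -(KVr r20) -rsA.
move: rE; rewrite addrA => /eqP; rewrite addrC addr_eq0 => /eqP ->.
by rewrite rsNl.
Qed.

(* Two orthogonal hyperbolic pairs (a, y) and (b, z). *)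
Record hyp4 a b y z : Prop := Hyp4 {
  haa : phi a a = 0; hbb : phi b b = 0; hyy : phi y y = 0; hzz : phi z z = 0;
  hab : phi a b = 0; hba : phi b a = 0; hyz : phi y z = 0; hzy : phi z y = 0;
  hay : phi a y = 1; hya : phi y a = 1; hbz : phi b z = 1; hzb : phi z b = 1;
  haz : phi a z = 0; hza : phi z a = 0; hby : phi b y = 0; hyb : phi y b = 0 }.

Lemma hyp4I a b y z : phi a a = 0 -> phi b b = 0 -> phi y y = 0 -> phi z z = 0 ->
  phi a b = 0 -> phi y z = 0 -> phi a y = 1 -> phi b z = 1 -> phi a z = 0 ->
  phi b y = 0 -> hyp4 a b y z.
Proof.
move=> ? ? ? ? ? ? ay bz ? ?; split => //; try exact: phi_eq0C.
  by rewrite phiC ay s1.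
by rewrite phiC bz s1.
Qed.

Definition gramE a b y z (H : hyp4 a b y z) := (haa H, hbb H, hyy H, hzz H,
  hab H, hba H, hyz H, hzy H, (hay H, hya H, hbz H, hzb H, haz H, hza H, hby H, hyb H)).

Definition zero_oneE := (mulr0, mul0r, addr0, add0r, subr0, sub0r, oppr0, mulr1, mul1r).

Lemma hyp4V a b y z : hyp4 a b y z -> hyp4 y b a z.
Proof. by case=> *; split. Qed.

(** Subtracting half of [phi z z] along [b] removes the value of [q] at [z]; the pairing with [b] is
    unchanged because [b] is isotropic. *)
Lemma isotropic_fix b z : phi b b = 0 -> phi b z = 1 ->
  exists r, phi (z - rscale b r) (z - rscale b r) = 0.
Proof.
move=> bb bz; exists (halve (phi z z)).
have zb : phi z b = 1 by rewrite phiC bz s1.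
rewrite !phiE bb bz zb !(zero_oneE, halve_sym (q_sym z)).
by rewrite -{1}(halveD (phi z z)) addrK subrr.
Qed.

Lemma complete2 a y b : phi a a = 0 -> phi y y = 0 -> phi a y = 1 ->
  phi b b = 0 -> phi a b = 0 -> phi y b = 0 -> b != 0 -> exists z, hyp4 a b y z.
Proof.
move=> aa yy ay bb ab yb b0.
have [z0 bz0] : exists z, phi b z != 0.
  apply: contrapT => /forallNP h; case/eqP: b0; apply: phi_nondeg => w.
  by apply/eqP; have /negP := h w; rewrite negbK.
have [z1 bz1] : exists z1, phi b z1 = 1.
  by exists (rscale z0 (phi b z0)^-1); rewrite phiE KVr.
have ya : phi y a = 1 by rewrite phiC ay s1.
have [z2 [bz2 az2 yz2]] : exists z2, [/\ phi b z2 = 1, phi a z2 = 0 & phi y z2 = 0].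
  exists (z1 - rscale a (phi y z1) - rscale y (phi a z1)).
  rewrite !phiE bz1 (phi_eq0C ab) (phi_eq0C yb) aa ay ya yy !zero_oneE.
  by rewrite !subrr.
have [r zz] := isotropic_fix bb bz2.
exists (z2 - rscale b r); apply: hyp4I => //.
- by rewrite !phiE yz2 yb !zero_oneE.
- by rewrite !phiE bz2 bb !zero_oneE.
- by rewrite !phiE az2 ab !zero_oneE.
- exact: phi_eq0C.
Qed.

(** If every vector orthogonal to [b] were orthogonal to [a], the form [phi a] would be a multiple
    of [phi b], and nondegeneracy would make [a] a multiple of [b]. *)
Lemma hyperbolic_partner a b : free2 a b -> phi a a = 0 -> phi b b = 0 -> phi a b = 0 ->
  exists y, [/\ phi y y = 0, phi a y = 1 & phi b y = 0].
Proof.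
move=> fab aa bb ab.
have [y0 [by0 ay0]] : exists y, phi b y = 0 /\ phi a y != 0.
  apply: contrapT => /forallNP h.
  have {}h w : phi b w = 0 -> phi a w = 0.
    by move=> bw; apply: contrapT => /eqP aw; apply: (h w).
  have [a0 nab] := (free2P a b).1 fab.
  have [[z0 bz0]|/forallNP bz] := pselect (exists z, phi b z != 0); last first.
    have : phi a a = 0 -> a = 0.
      move=> _; apply: phi_nondeg => w; apply: h.
      by apply/eqP; have /negP := bz w; rewrite negbK.
    by move=> /(_ aa)/eqP; rewrite (negPf a0).
  have [z1 bz1] : exists z1, phi b z1 = 1.
    by exists (rscale z0 (phi b z0)^-1); rewrite phiE KVr.
  have ba w : phi a w = phi a z1 * phi b w.
    have /h : phi b (w - rscale z1 (phi b w)) = 0 by rewrite !phiE bz1 mul1r subrr.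
    by rewrite !phiE => /eqP; rewrite subr_eq0 => /eqP.
  have : a - rscale b (sigma (phi a z1)) = 0.
    by apply: phi_nondeg => w; rewrite !phiE sK ba subrr.
  move=> /eqP; rewrite subr_eq0 => /eqP aE.
  have [|c0 _] := fab 1 (- sigma (phi a z1)).
    by rewrite rs1 rsN {1}aE subrr.
  by move/eqP: c0; rewrite oner_eq0.
have [y1 [ay1 by1]] : exists y1, phi a y1 = 1 /\ phi b y1 = 0.
  by exists (rscale y0 (phi a y0)^-1); rewrite !phiE KVr// by0 mul0r.
have [r yy] := isotropic_fix aa ay1.
exists (y1 - rscale a r); split=> //.
- by rewrite !phiE ay1 aa !zero_oneE.
- by rewrite !phiE by1 (phi_eq0C ab) !zero_oneE.
Qed.

Lemma complete4 a b : free2 a b -> phi a a = 0 -> phi b b = 0 -> phi a b = 0 ->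
  exists y z, hyp4 a b y z.
Proof.
move=> fab aa bb ab; have [y [yy ay b'y]] := hyperbolic_partner fab aa bb ab.
have [z H] : exists z, hyp4 a b y z.
  apply: complete2 => //; first exact: phi_eq0C.
  apply/eqP => b0; case: (fab 0 1); first by rewrite b0 rs0l rs0 addr0.
  by move=> _ /eqP; rewrite oner_eq0.
by exists y, z.
Qed.

Lemma hyp4_free a b y z : hyp4 a b y z -> free2 a b.
Proof.
move=> H r r' E.
have := congr1 (phi y) E; have := congr1 (phi z) E.
by rewrite !phiE !(gramE H) !zero_oneE.
Qed.

(** The analogue of [V'] for an arbitrary hyperbolic frame. Orthogonality is recorded on both sides
    for rewriting. *)
Record core a b y z w : Prop := Core {
  caw : phi a w = 0; cwa : phi w a = 0; cbw : phi b w = 0; cwb : phi w b = 0;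
  cyw : phi y w = 0; cwy : phi w y = 0; czw : phi z w = 0; cwz : phi w z = 0 }.

Lemma coreI a b y z w : phi a w = 0 -> phi b w = 0 -> phi y w = 0 -> phi z w = 0 ->
  core a b y z w.
Proof. by move=> *; split => //; exact: phi_eq0C. Qed.

Definition coreE a b y z w (C : core a b y z w) :=
  (caw C, cwa C, cbw C, cwb C, cyw C, cwy C, czw C, cwz C).

(** An isotropic [w] orthogonal to [a] and [b] lies in their plane, on which [y] and [z] are dual
    coordinates. *)
Lemma core_aniso a b y z w : hyp4 a b y z -> core a b y z w -> phi w w = 0 -> w = 0.
Proof.
move=> H C ww.
have /plP[r [r' wE]] := isotropic_perp_plane (hyp4_free H) (haa H) (hbb H) (hab H) ww (caw C) (cbw C).
have := cyw C; have := czw C.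
by rewrite wE !phiE !(gramE H) !zero_oneE => -> ->; rewrite !rs0 addr0.
Qed.

Lemma core_proj a b y z w : hyp4 a b y z -> phi a w = 0 -> phi b w = 0 ->
  exists2 w', core a b y z w' & phi w' w' = phi w w.
Proof.
move=> H aw bw; exists (w - rscale a (phi y w) - rscale b (phi z w)).
  by apply: coreI; rewrite !phiE !(gramE H) ?aw ?bw !zero_oneE ?subrr.
by rewrite !phiE !(gramE H) aw bw (phi_eq0C aw) (phi_eq0C bw) !zero_oneE.
Qed.

(** An elementary substitute for Witt cancellation. Adding to [w] a vector of the plane of [a], [b]
    does not change [q], and two equations in the coefficients of [a], [b], [w] have a nonzero
    solution. If [w] occurs in it, division by its coefficient gives the vector; if not, the
    solution is a vector [p0] common to the two planes. *)
Lemma plane_perp a b a' b' w : free2 a b -> phi a a = 0 -> phi b b = 0 -> phi a b = 0 ->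
  free2 a' b' -> phi a' a' = 0 -> phi b' b' = 0 -> phi a' b' = 0 ->
  phi a w = 0 -> phi b w = 0 ->
  exists2 w', phi a' w' = 0 /\ phi b' w' = 0 & phi w' w' = phi w w.
Proof.
move=> fab aa bb ab fab' aa' bb' ab' aw bw.
have adj p : pl a b p -> phi (w + p) (w + p) = phi w w.
  move=> pp; have pp0 : phi p p = 0 by apply: (tiso_pl aa bb ab).
  have pw : phi p w = 0.
    by move: pp => /plP[r [r' ->]]; rewrite !phiE aw bw !zero_oneE.
  by rewrite !phiE pp0 pw (phi_eq0C pw) !zero_oneE.
suff [p pp [? ?]] : exists2 p, pl a b p & phi a' (w + p) = 0 /\ phi b' (w + p) = 0.
  by exists (w + p); [split|exact: adj].
pose A (i : 'I_3) (j : 'I_2) : K := phi (fr2 a' b' j) (if i == 0 then a else if i == 1 then b else w).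
have [x [x0 Ax]] := linear_system_kernel K_unit A isT.
have := Ax 0; have := Ax 1; rewrite !big_ord_recl !big_ord0 /A /fr2 /= !addr0.
set x1 := x _; set x2 := x _; set x3 := x _ => E2 E1.
have [x30|x30] := eqVneq x3 0; last first.
  exists (rscale a (x1 * x3^-1) + rscale b (x2 * x3^-1)).
    by apply/plP; exists (x1 * x3^-1), (x2 * x3^-1).
  have tw c : phi c a * x1 + (phi c b * x2 + phi c w * x3) = 0 ->
     phi c (w + (rscale a (x1 * x3^-1) + rscale b (x2 * x3^-1))) = 0.
    move=> h; rewrite !phiE !mulrA -mulrDl -[phi c w]mulr1 -(KVr x30) mulrA -mulrDl.
    by rewrite addrC -addrA h mul0r.
  by split; apply: tw.
have x12 : x1 != 0 \/ x2 != 0.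
  have [[[|[|[|//]]] lt] xi] := x0; [left|right|].
  - by apply: contraNneq xi => <-; apply/eqP; congr (x _); exact: val_inj.
  - by apply: contraNneq xi => <-; apply/eqP; congr (x _); exact: val_inj.
  - by case/eqP: xi; rewrite -x30; congr (x _); exact: val_inj.
move: E1 E2; rewrite x30 !mulr0 !addr0 => E1 E2.
pose p0 := rscale a x1 + rscale b x2.
have p00 : p0 <> 0 by move=> /fab[x10 x20]; move: x12; rewrite x10 x20 eqxx => -[].
have p0w : phi p0 w = 0 by rewrite !phiE aw bw !zero_oneE.
have /plP[s [r p0E]] : pl a' b' p0.
  apply: isotropic_perp_plane => //; try by rewrite !phiE.
  by rewrite !phiE aa bb ab (phi_eq0C ab) !(mulr0, mul0r, addr0).
have tP := tiso_pl aa bb ab.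
have p0P : pl a b p0 by apply/plP; exists x1, x2.
(* When the planes meet in [p0], only the equation for a vector [c] outside the first plane has to
   be solved: the one for [d] follows, since [p0] is a combination of [c] and [d] and is orthogonal
   to [w + p]. *)
have adjust c d s' r' : phi c c = 0 -> ~ pl a b c -> p0 = rscale c s' + rscale d r' ->
    exists2 p, pl a b p & phi c (w + p) = 0 /\ phi d (w + p) = 0.
  move=> cc ncP pE.
  have [p1 p1P cp1] : exists2 p1, pl a b p1 & phi c p1 != 0.
    apply: contrapT => h; apply: ncP; apply: isotropic_perp_plane => //; apply: phi_eq0C;
      apply: contrapT => /eqP hc; apply: h.
      by exists a => //; exact: pl_l.
    by exists b => //; exact: pl_r.
  pose p := rscale p1 (- ((phi c p1)^-1 * phi c w)).
  have pP : pl a b p by have [_ _] := pl_subspace a b; apply.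
  have cwp : phi c (w + p) = 0.
    by rewrite !phiE mulrN mulrA KVr// mul1r subrr.
  exists p => //; split => //.
  have r0 : r' != 0.
    apply/eqP => r0; apply: ncP.
    have s'0 : s' != 0 by apply/eqP => s'0; apply: p00; rewrite pE r0 s'0 !rs0 addr0.
    have -> : c = rscale p0 s'^-1 by rewrite pE r0 rs0 addr0 rsA KVr// rs1.
    by have [_ _] := pl_subspace a b; apply.
  have : phi p0 (w + p) = 0 by rewrite phiDr p0w (tP _ _ p0P pP) addr0.
  rewrite pE phiDl !phiZl// cwp mulr0 add0r => h.
  by apply: (KM0 h); rewrite s_eq0.
have [a'P|a'P] := pselect (pl a b a'); last exact: (adjust a' b' s r).
have [b'P|b'P] := pselect (pl a b b'); last first.
  have [|p pP [h1 h2]] := adjust b' a' r s bb' b'P; first by rewrite p0E addrC.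
  by exists p.
exists 0; first by have [] := pl_subspace a b.
rewrite addr0; move: a'P b'P => /plP[? [? ->]] /plP[? [? ->]].
by rewrite !phiE aw bw !zero_oneE.
Qed.

(** All hyperbolic frames have cores with the same values of [q]. Only the value is carried over: no
    isometry between the cores is constructed. *)
Lemma core_transport a b y z a' b' y' z' w : hyp4 a b y z -> hyp4 a' b' y' z' ->
  core a b y z w -> exists2 w', core a' b' y' z' w' & phi w' w' = phi w w.
Proof.
move=> H H' C.
have [w1 [aw1 bw1] qw1] := plane_perp (hyp4_free H) (haa H) (hbb H) (hab H)
  (hyp4_free H') (haa H') (hbb H') (hab H') (caw C) (cbw C).
by rewrite -qw1; exact: core_proj.
Qed.

Lemma std_hyp4 : hyp4 (e 0) (e 1) (e 2) (e 3).
Proof.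
case: e_std => _ ii e02 e13 orth.
have o i j : i \in [:: 0; 2%R] -> j \in [:: 1%R; 3%R] -> phi (e i) (e j) = 0.
  by rewrite !inE => /orP[]/eqP-> /orP[]/eqP->; apply: orth; apply: sub_spanned; first [by left|by right].
by apply: hyp4I => //; try exact: o; apply: phi_eq0C; exact: o.
Qed.

Lemma core_orthogonalP w : core_orthogonal phi e w <-> core (e 0) (e 1) (e 2) (e 3) w.
Proof.
split=> [h|C i]; first by apply: coreI; exact: h.
have : [\/ i = 0, i = 1, i = 2 | i = 3].
  case: i => -[|[|[|[|//]]]] lt; [apply: Or41|apply: Or42|apply: Or43|apply: Or44]; exact: val_inj.
by move=> []->; case: C.
Qed.

Lemma hyp4_resid a b y z w : hyp4 a b y z ->
  core a b y z (w - rscale a (phi y w) - rscale b (phi z w) - rscale y (phi a w) - rscale z (phi b w)).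
Proof.
by move=> H; apply: coreI; rewrite !phiE !(gramE H) !zero_oneE ?subrr// addrAC subrr ?zero_oneE// addrAC subrr ?zero_oneE.
Qed.

(** In dimension at least 5 some vector is outside the span of [e], and its component orthogonal to
    [e] is nonzero. *)
Lemma std_core_ex : exists2 w, core (e 0) (e 1) (e 2) (e 3) w & w != 0.
Proof.
have [w we] := not_spanned K_unit e (V_dim).
have C := hyp4_resid w std_hyp4; eexists; first exact: C.
apply/eqP => h; apply: we; have [_ SD SZ] := spanned_subspace (range e).
have eS i : spanned (range e) (e i) by apply: sub_spanned; exists i.
move: h => /eqP; rewrite subr_eq0 => /eqP h.
have -> : w = rscale (e 0) (phi (e 2) w) + rscale (e 1) (phi (e 3) w) +
  rscale (e 2) (phi (e 0) w) + rscale (e 3) (phi (e 1) w).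
  have sub3 (c1 c2 c3 c4 : V) : c4 - c1 - c2 - c3 = c4 - (c1 + c2 + c3) by rewrite !opprD !addrA.
  by rewrite -h sub3 addrC subrK.
have {}SZ i r : spanned (range e) (rscale (e i) r) by apply: SZ; exact: eS.
by apply: (SD _ _ (SD _ _ (SD _ _ (SZ _ _) (SZ _ _)) (SZ _ _)) (SZ _ _)).
Qed.

Lemma core_ex a b y z : hyp4 a b y z -> exists2 w, core a b y z w & w != 0.
Proof.
move=> H; have [w0 C0 w00] := std_core_ex.
have [w C qw] := core_transport std_hyp4 H C0; exists w => //.
apply: contraNneq w00 => w0E; apply/eqP; apply: (core_aniso std_hyp4 C0).
by rewrite -qw w0E !phiE.
Qed.

(** * Null sequences of central scalars fixed by the involution *)

Variable t : nat -> F.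
Hypothesis t_neq0 : forall n, t n != 0.
Hypothesis t_sigma : forall n, sigma (t n)%:A = (t n)%:A.
Hypothesis t_cvg : cvF v \oo t 0.

Definition T n : K := (t n)%:A.

Lemma TC n x : T n * x = x * T n. Proof. by rewrite /T mulr_algl mulr_algr. Qed.
Lemma sT n : sigma (T n) = T n. Proof. exact: t_sigma. Qed.
Lemma sMT n x : sigma (x * T n) = sigma x * T n. Proof. by rewrite sM sT TC. Qed.
Lemma T_neq0 n : T n != 0. Proof. by rewrite scaler_eq0 oner_eq0 orbF. Qed.
Lemma MT_eq0 n x : (x * T n == 0) = (x == 0).
Proof.
apply/eqP/eqP => [|->]; last by rewrite mul0r.
by rewrite -TC => /KM0; apply; exact: T_neq0.
Qed.

(** Convergence of [z] to 0, tested on all multiples of vectors, which is the form consumed by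
    [cvV_small]. *)
Definition smallK (z : nat -> K) := forall w, cvV v \oo (fun n => rscale w (z n)) 0.

Lemma smallT : smallK T.
Proof.
move=> w l ll; rewrite (Fform0 ll).
apply: (cvF_ext (x := fun n => t n * l w)); first by move=> n /=; rewrite (FformZ _ _ ll).
by rewrite -[X in cvF _ _ _ X](mul0r (l w)); apply: cvFM => //; exact: cvF_cst.
Qed.

Lemma smallMT (z : nat -> K) : smallK z -> smallK (fun n => z n * T n).
Proof.
move=> sz w l ll; have := sz w _ ll; rewrite (Fform0 ll) => h.
apply: (cvF_ext (x := fun n => t n * l (rscale w (z n)))).
  by move=> n /=; rewrite -rsA (FformZ _ _ ll).
by rewrite -[X in cvF _ _ _ X](mul0r 0); exact: cvFM.
Qed.

Lemma smallMl k (z : nat -> K) : smallK z -> smallK (fun n => k * z n).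
Proof. by move=> sz w l ll; have := sz (rscale w k) l ll; apply: cvF_ext => n /=; rewrite rsA. Qed.

Lemma cvV_cst u : cvV v \oo (fun=> u) u.
Proof. by move=> l ll; exact: cvF_cst. Qed.

Lemma cvV_small (x : nat -> V) u w (z : nat -> K) : cvV v \oo x u -> smallK z ->
  cvV v \oo (fun n => x n + rscale w (z n)) u.
Proof.
move=> cx sz l ll; rewrite -[u]addr0 (FformD _ _ ll).
apply: (cvF_ext (x := fun n => l (x n) + l (rscale w (z n)))).
  by move=> n /=; rewrite (FformD _ _ ll).
by apply: cvFD; [exact: cx|exact: sz].
Qed.

Lemma smallMTc k : smallK (fun n => k * T n).
Proof. exact/smallMl/smallT. Qed.

Lemma smallMTT k : smallK (fun n => k * T n * T n).
Proof. exact/smallMT/smallMTc. Qed.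

(** * Configurations of lines and planes *)

Definition isoL (L : set V) := exists u, [/\ u != 0, phi u u = 0 & L = ln u].
Definition isoP (P : set V) := exists a b,
  [/\ free2 a b, phi a a = 0, phi b b = 0, phi a b = 0 & P = pl a b].

Lemma isoL_eq L u : isoL L -> L u -> u != 0 -> L = ln u.
Proof.
move=> [a [a0 aa ->]] /lnP[x ->] ax.
have x0 : x != 0 by apply: contraNneq ax => ->; rewrite rs0.
apply/seteqP; split; apply: ln_sub; try exact: ln_subspace.
  by apply/lnP; exists x^-1; rewrite rsA KVr// rs1.
by apply/lnP; exists x.
Qed.

Lemma isoL_iso L u w : isoL L -> L u -> L w -> phi u w = 0.
Proof. by move=> [a [a0 aa ->]]; exact: tiso_ln. Qed.

Lemma isoP_iso P u w : isoP P -> P u -> P w -> phi u w = 0.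
Proof. by move=> [a [b [fab aa bb ab ->]]]; exact: tiso_pl. Qed.

Lemma isoP_perp P a b x : isoP P -> P a -> P b -> free2 a b -> phi x x = 0 ->
  phi a x = 0 -> phi b x = 0 -> pl a b x.
Proof. by move=> iP Pa Pb fab xx ax bx; apply: isotropic_perp_plane => //; exact: (isoP_iso iP). Qed.

Lemma isoP_eq P a b : isoP P -> P a -> P b -> free2 a b -> P = pl a b.
Proof.
move=> iP Pa Pb fab; apply/seteqP; split; last first.
  by case: iP Pa Pb => [c [d [_ _ _ _ ->]]] Pa Pb; apply: pl_sub => //; exact: pl_subspace.
by move=> x Px; apply: (isoP_perp iP) => //; apply: (isoP_iso iP).
Qed.

Lemma isoP_max P x : isoP P -> phi x x = 0 -> (forall a, P a -> phi a x = 0) -> P x.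
Proof.
move=> [a [b [fab aa bb ab ->]]] xx Px; apply: isotropic_perp_plane => //; apply: Px; [exact: pl_l|exact: pl_r].
Qed.

Lemma isoP_subspace P : isoP P -> Defs.subspace P.
Proof. by move=> [a [b [_ _ _ _ ->]]]; exact: pl_subspace. Qed.

Lemma isoL_subspace P : isoL P -> Defs.subspace P.
Proof. by move=> [a [_ _ ->]]; exact: ln_subspace. Qed.

Definition cfg (L P : 'I_4 -> set V) :=
  forall i, [/\ isoL (L i), isoP (P i), L i `<=` P i & L (i + 1) `<=` P i].

Definition msp (f : Mor v phi e) (L P : 'I_4 -> set V) :=
  forall i, line_space (mline f i) = L i /\ plane_space (mplane f i) = P i.

(* The configuration (L, P) lists the images of the vertices of the apartment;
   inS says that the morphism it defines is a limit of injective ones. *)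
Definition inS (L P : 'I_4 -> set V) :=
  exists2 f : Mor v phi e, closure (Mor_inj v phi e) f & msp f L P.

Lemma vconf_cfg (u p : 'I_4 -> V) : vconf phi u p ->
  cfg (fun i => ln (u i)) (fun i => pl (u i) (p i)).
Proof.
move=> c i; have [fup uu pp up uS] := c i; split.
- by exists (u i); split=> //; case: ((free2P _ _).1 fup).
- by exists (u i), (p i).
- by apply: ln_sub; [exact: pl_subspace|exact: pl_l].
- by apply: ln_sub; [exact: pl_subspace|].
Qed.

Lemma cfg_vconf L P : cfg L P -> exists u p : 'I_4 -> V,
  [/\ vconf phi u p, L = fun i => ln (u i) & P = fun i => pl (u i) (p i)].
Proof.
move=> c.
have h i : exists u p, [/\ free2 u p, phi u u = 0, phi p p = 0, phi u p = 0 & L i = ln u /\ P i = pl u p].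
  have [[u [u0 uu LE]] iP LP _] := c i.
  have Pu : P i u by apply: LP; rewrite LE; exact: ln_id.
  have [a [b [fab aa bb ab PE]]] := iP.
  have [p Pp np] : exists2 p, P i p & ~ ln u p.
    apply: contrapT => h; have {}h p : P i p -> ln u p.
      by move=> Pp; apply: contrapT => np; apply: h; exists p.
    have [|x aE] := (lnP u a).1 (h a _); first by rewrite PE; exact: pl_l.
    have [|y bE] := (lnP u b).1 (h b _); first by rewrite PE; exact: pl_r.
    have [a0 nab] := (free2P _ _).1 fab; apply: nab.
    have x0 : x != 0 by apply: contraNneq a0 => x0; rewrite aE x0 rs0.
    by apply/lnP; exists (x^-1 * y); rewrite aE rsA mulrA KVr// mul1r.
  have fup : free2 u p by apply/free2P.
  exists u, p; split=> //; try exact: (isoP_iso iP).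
  by split=> //; exact: isoP_eq.
have /choice[u /choice[p up]] := h.
have LE : L = fun i => ln (u i) by apply/funext => i; case: (up i) => _ _ _ _ [].
have PE : P = fun i => pl (u i) (p i) by apply/funext => i; case: (up i) => _ _ _ _ [].
exists u, p; split=> // i; have [fup uu pp uip _] := up i; split=> //.
by have [_ _ _] := c i; rewrite LE PE; apply; exact: ln_id.
Qed.

Lemma msp_cfg f L P : msp f L P -> cfg L P.
Proof.
have [u [p [c s]]] := mor_conf K_unit e_free f.
move=> fLP; have := vconf_cfg c.
suff -> : L = (fun i => ln (u i)) by suff -> : P = (fun i => pl (u i) (p i)) by [];
  apply/funext => i; have [_ <-] := fLP i; have [_ ->] := s i.
by apply/funext => i; have [<- _] := fLP i; have [-> _] := s i.
Qed.

Lemma cfg_mor L P : cfg L P -> exists f : Mor v phi e, msp f L P.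
Proof.
move=> /cfg_vconf[u [p [c -> ->]]].
by have [f fs] := mor_of v K_unit sigma_invol phi_herm e_free c; exists f.
Qed.

(** The approximating configurations need only be in the closure themselves, so that perturbations
    can be made in stages. *)
Lemma inS_lim L P (u p : 'I_4 -> V) (un pn : nat -> 'I_4 -> V) :
  cfg L P -> (forall i, L i = ln (u i)) -> (forall i, P i = pl (u i) (p i)) ->
  (forall i, free2 (u i) (p i)) ->
  (forall n i, free2 (un n i) (pn n i)) ->
  (forall n, inS (fun i => ln (un n i)) (fun i => pl (un n i) (pn n i))) ->
  (forall i, cvV v \oo (un^~ i) (u i)) -> (forall i, cvV v \oo (pn^~ i) (p i)) ->
  inS L P.
Proof.
move=> c LE PE fup fupn inn cu cp.
have [f fLP] := cfg_mor c.
have /choice[g gP] : forall n, exists f : Mor v phi e, closure (Mor_inj v phi e) f /\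
   msp f (fun i => ln (un n i)) (fun i => pl (un n i) (pn n i)).
  by move=> n; have [h ? ?] := inn n; exists h.
exists f => //; have cc : closed (closure (Mor_inj v phi e)) by exact: closed_closure.
rewrite (_ : closure _ = closure (closure (Mor_inj v phi e))); last exact/closure_id.
apply: (@closure_seq _ _ v _ _ phi e K_unit _ f g un un pn u u p) => //.
- by move=> n; case: (gP n).
- move=> n i; case: (gP n) => _ /(_ i)[-> _]; split=> //.
  by case: ((free2P _ _).1 (fupn n i)).
- by move=> n i; case: (gP n) => _ /(_ i)[_ ->].
- move=> i; have [-> _] := fLP i; rewrite LE; split=> //.
  by case: ((free2P _ _).1 (fup i)).
- by move=> i; have [_ ->] := fLP i; rewrite PE.
Qed.

Lemma I4P (Q : 'I_4 -> Prop) : Q 0 -> Q 1 -> Q 2 -> Q 3 -> forall i, Q i.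
Proof.
move=> q0 q1 q2 q3 [[|[|[|[|//]]]] lt].
- by rewrite (_ : Ordinal lt = 0)//; exact: val_inj.
- by rewrite (_ : Ordinal lt = 1)//; exact: val_inj.
- by rewrite (_ : Ordinal lt = 2)//; exact: val_inj.
- by rewrite (_ : Ordinal lt = 3)//; exact: val_inj.
Qed.

Lemma I4_succE : ((0 + 1)%R = 1%R :> 'I_4) * ((1 + 1)%R = 2%R :> 'I_4) * ((2 + 1)%R = 3%R :> 'I_4) * ((3 + 1)%R = 0%R :> 'I_4).
Proof. by do !split; exact: val_inj. Qed.

(** Rotating the labels preserves injectivity. The rotation is applied to approximating sequences of
    vectors rather than as a homeomorphism of the space of morphisms. *)
Lemma inS_rot L P : inS L P -> inS (fun i => L (i + 1)) (fun i => P (i + 1)).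
Proof.
move=> [f cf fLP]; have c := msp_cfg fLP; have [u [p [vc LE PE]]] := cfg_vconf c.
have c' : cfg (fun i => L (i + 1)) (fun i => P (i + 1)) by move=> i; have := c (i + 1).
have [f' f'LP] := cfg_mor c'; exists f' => //.
have fup i : free2 (u i) (p i) by case: (vc i).
have u0 i : u i != 0 by case: ((free2P _ _).1 (fup i)).
have [|||g [un [an [bn [gS gl gp cu [ca cb]]]]]] :=
  @closure_ex _ _ v _ _ phi e K_unit e_free (Mor_inj v phi e) f u u p.
- by move=> i; have [-> _] := fLP i; rewrite LE.
- by move=> i; have [_ ->] := fLP i; rewrite PE.
- exact: cf.
have /choice[g' g'P] : forall n, exists g' : Mor v phi e,
   msp g' (fun i => line_space (mline (g n) (i + 1))) (fun i => plane_space (mplane (g n) (i + 1))).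
  move=> n; apply: cfg_mor => i.
  have : msp (g n) (fun i => line_space (mline (g n) i)) (fun i => plane_space (mplane (g n) i)) by [].
  by move=> /msp_cfg/(_ (i + 1)).
apply: (@closure_seq _ _ v _ _ phi e K_unit _ f' g' (fun n i => un n (i + 1))
   (fun n i => an n (i + 1)) (fun n i => bn n (i + 1))
   (fun i => u (i + 1)) (fun i => u (i + 1)) (fun i => p (i + 1))).
- move=> n; have [gl' gp'] := gS n; split=> i j ij; apply: (addIr 1).
    apply: gl'; apply: val_inj; apply: val_inj.
    have [E1 _] := g'P n i; have [E2 _] := g'P n j.
    by rewrite -[LHS]E1 -[RHS]E2 ij.
  apply: gp'; apply: val_inj; apply: val_inj.
  have [_ E1] := g'P n i; have [_ E2] := g'P n j.
  by rewrite -[LHS]E1 -[RHS]E2 ij.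
- by move=> n i; have [-> _] := g'P n i; exact: gl.
- by move=> n i; have [_ ->] := g'P n i; exact: gp.
- by move=> i; have [-> _] := f'LP i; rewrite LE.
- by move=> i; have [_ ->] := f'LP i; rewrite PE.
- by move=> i; exact: cu.
- by move=> i; exact: ca.
- by move=> i; exact: cb.
Qed.

Lemma inS_rotI L P : inS (fun i => L (i + 1)) (fun i => P (i + 1)) -> inS L P.
Proof.
move=> /inS_rot/inS_rot/inS_rot.
have E (i : 'I_4) : i + 1 + 1 + 1 + 1 = i.
  by elim/I4P : i; exact: val_inj.
by congr inS; apply/funext => i; rewrite E.
Qed.

Lemma I4_inj (A : Type) (X : 'I_4 -> A) : (forall i, X i = X (i + 1) -> False) ->
  (forall i, X i = X (i + 2) -> False) -> injective X.
Proof.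
move=> n1 n2 i j; have: [\/ j = i, j = i + 1, i = j + 1 | j = i + 2].
  elim/I4P : i; elim/I4P : j; (try (by apply: Or41; exact: val_inj));
  (try (by apply: Or42; exact: val_inj)); (try (by apply: Or43; exact: val_inj));
  by apply: Or44; exact: val_inj.
by case=> [->//|->/n1|->/esym/n1|->/n2].
Qed.

(** A configuration with both pairs of lines opposite is injective: any equality between two lines
    or two planes would put a pair of opposite lines into one totally isotropic plane. *)
Lemma inS_inj L P : cfg L P ->
  (exists u w, [/\ L 0 u, L 2 w & phi u w != 0]) ->
  (exists u w, [/\ L 1 u, L 3 w & phi u w != 0]) -> inS L P.
Proof.
move=> c o1 o2; have [f fLP] := cfg_mor c; exists f => //; apply: subset_closure.
pose opp (i : 'I_4) := exists u w, [/\ L i u, L (i + 2) w & phi u w != 0].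
have sym i : opp i -> opp (i + 2).
  move=> [u [w [Lu Lw uw]]]; exists w, u; split=> //.
    by rewrite (_ : i + 2 + 2 = i)//; elim/I4P : i {Lu Lw}; exact: val_inj.
  by rewrite phiC s_eq0.
have oo : forall i, opp i.
  have o0 : opp 0 by case: o1 => u [w [? ? ?]]; exists u, w; split=> //; rewrite (_ : 0 + 2 = 2)//; exact: val_inj.
  have o1' : opp 1 by case: o2 => u [w [? ? ?]]; exists u, w; split=> //; rewrite (_ : 1 + 2 = 3)//; exact: val_inj.
  apply: I4P => //; [rewrite (_ : 2 = 0 + 2)|rewrite (_ : 3 = 1 + 2)]; try (by apply: val_inj); exact: sym.
have nopp i (S : set V) : isoP S -> L i `<=` S -> L (i + 2) `<=` S -> False.
  move=> iS h1 h2; have [u [w [Lu Lw /eqP]]] := oo i; apply.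
  by apply: (isoP_iso iS); [exact: h1|exact: h2].
have inc i : [/\ isoP (P i), L i `<=` P i & L (i + 1) `<=` P i] by case: (c i).
have inc' i : L (i + 2) `<=` P (i + 1).
  by have [_ _] := inc (i + 1); rewrite -addrA (_ : 1 + 1 = 2)//; exact: val_inj.
have Pnext i : P i = P (i + 1) -> False.
  move=> E; have [iP h1 h2] := inc i; apply: (nopp i _ iP h1).
  by rewrite E; exact: inc'.
have Popp i : P i = P (i + 2) -> False.
  move=> E; have [iP h1 h2] := inc i; apply: (nopp i _ iP h1).
  by rewrite E; case: (inc (i + 2)).
have Lnext i : L i = L (i + 1) -> False.
  move=> E; have [iP h1 h2] := inc (i + 1); apply: (nopp i _ iP); last exact: inc'.
  by rewrite E.
have Lopp i : L i = L (i + 2) -> False.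
  by move=> E; have [iP h1 h2] := inc i; apply: (nopp i _ iP h1); rewrite -E.
split.
  move=> i j ij; apply: (I4_inj Lnext Lopp).
  by have [<- _] := fLP i; have [<- _] := fLP j; rewrite ij.
move=> i j ij; apply: (I4_inj Pnext Popp).
by have [_ <-] := fLP i; have [_ <-] := fLP j; rewrite ij.
Qed.

(** The value at index 3 is the default of [nth], the list having three entries. *)
Definition mk4 (A : Type) (x0 x1 x2 x3 : A) : 'I_4 -> A := fun i => nth x3 [:: x0; x1; x2] i.

Definition conf1 u p u' := [/\ free2 u p, phi u u = 0, phi p p = 0, phi u p = 0 & pl u p u'].

Lemma vconf4 (u p : 'I_4 -> V) : conf1 (u 0) (p 0) (u 1) -> conf1 (u 1) (p 1) (u 2) ->
  conf1 (u 2) (p 2) (u 3) -> conf1 (u 3) (p 3) (u 0) -> vconf phi u p.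
Proof. by move=> c0 c1 c2 c3; apply: I4P; rewrite ?I4_succE. Qed.

Lemma free2_test u p a b : phi a u = 0 -> phi a p != 0 -> phi b u != 0 -> free2 u p.
Proof.
move=> au ap bu r r' E.
have r'0 : r' = 0.
  have := congr1 (phi a) E; rewrite !phiE au mul0r add0r => h; exact: (KM0 h).
split=> //; have := congr1 (phi b) E; rewrite !phiE r'0 mulr0 addr0 => h; exact: (KM0 h).
Qed.

Definition halfq w := - halve (phi w w).

(* If (b, z) is a hyperbolic pair and w is orthogonal to it, the last term makes
   this perturbation of b isotropic. *)
Definition pert b w z n := b + rscale w (T n) + rscale z (halfq w * T n * T n).

Lemma pert_cvg b w z : cvV v \oo (pert b w z) b.
Proof. by apply: cvV_small; [apply: cvV_small; [exact: cvV_cst|exact: smallT]|exact: smallMTT]. Qed.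

Lemma halfq_sym w : sigma (halfq w) = halfq w. Proof. by rewrite /halfq sN halve_sym. Qed.

Lemma halfq_neq0 w : phi w w != 0 -> halfq w != 0.
Proof.
move=> ww; rewrite /halfq oppr_eq0; apply: contraNneq ww => h.
by rewrite -(halveD (phi w w)) h addr0.
Qed.

Lemma halfq_double w : halfq w + halfq w + phi w w = 0.
Proof. by rewrite /halfq -{3}(halveD (phi w w)) addrACA !addNr addr0. Qed.

Lemma pert_iso b w z n : phi b b = 0 -> phi z z = 0 -> phi b z = 1 -> phi z b = 1 ->
  phi b w = 0 -> phi w b = 0 -> phi z w = 0 -> phi w z = 0 ->
  phi (pert b w z n) (pert b w z n) = 0.
Proof.
move=> bb zz bz zb bw wb zw wz; rewrite /pert !phiE bb zz bz zb bw wb zw wz !zero_oneE.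
by rewrite !sMT halfq_sym sT TC -!mulrDl addrAC halfq_double !mul0r.
Qed.

Lemma free2C a b : free2 a b -> free2 b a.
Proof. by move=> f r s E; have [] := f s r; [rewrite addrC|]. Qed.

Lemma cfg4 L P : cfg L P <-> [/\ [/\ isoL (L 0), isoL (L 1), isoL (L 2) & isoL (L 3)],
  [/\ isoP (P 0), isoP (P 1), isoP (P 2) & isoP (P 3)],
  [/\ L 0 `<=` P 0, L 1 `<=` P 1, L 2 `<=` P 2 & L 3 `<=` P 3] &
  [/\ L 1 `<=` P 0, L 2 `<=` P 1, L 3 `<=` P 2 & L 0 `<=` P 3]].
Proof.
split=> [c|].
  have := c 0; have := c 1; have := c 2; have := c 3.
  by rewrite !I4_succE => -[? ? ? ?] [? ? ? ?] [? ? ? ?] [? ? ? ?].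
by move=> [[? ? ? ?] [? ? ? ?] [? ? ? ?] [? ? ? ?]]; apply: I4P; rewrite I4_succE.
Qed.

Definition isob u w := [/\ free2 u w, phi u u = 0, phi w w = 0 & phi u w = 0].

Lemma conf1P u p u' : isob u p -> pl u p u' -> conf1 u p u'.
Proof. by case. Qed.

Lemma hyp4_isob a b y z : hyp4 a b y z -> isob a b.
Proof. by move=> H; split; [exact: hyp4_free H|exact: haa H|exact: hbb H|exact: hab H]. Qed.

Lemma isobC a b : isob a b -> isob b a.
Proof. by case=> f *; split=> //; [exact: free2C|exact: phi_eq0C]. Qed.

(** * Perturbation of degenerate configurations *)

Definition opposite (A B : set V) := exists u w, [/\ A u, B w & phi u w != 0].

Lemma isoL_gen L : isoL L -> exists2 u, u != 0 & L = ln u.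
Proof. by case=> u [u0 _ LE]; exists u. Qed.

Lemma phi1_neq0 a y : phi a y = 1 -> a != 0 /\ y != 0.
Proof.
by move=> ay; split; apply/eqP => E; move/eqP: ay; rewrite E phiE eq_sym oner_eq0.
Qed.

(** Let [a] and [y] span [L 0] and [L 2]. The lines [L 1] and [L 3] lie in the orthogonal of [a] and
    [y]; if they are not opposite, they are the same line [ln b]. Then [L 3] is moved by [pert] in
    the direction of a core vector [w]: it stays orthogonal to [a] and [y], but its pairing with [b]
    becomes [halfq w] times [T n] squared, which is nonzero by anisotropy. *)
Lemma inS_opposite_lines L P : cfg L P -> opposite (L 0) (L 2) -> inS L P.
Proof.
move=> cLP o; have [o13|no13] := pselect (opposite (L 1) (L 3)); first exact: inS_inj.
case: o => a [y' [La Ly' ay']]; pose y := rscale y' (phi a y')^-1.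
have := cLP; rewrite cfg4 => -[[l0 l1 l2 l3] [q0 q1 q2 q3] [s00 s11 s22 s33] [s10 s21 s32 s03]].
have Ly : L 2 y by have [_ _] := isoL_subspace l2; apply.
have ay : phi a y = 1 by rewrite phiE KVr.
clearbody y => {y' Ly' ay'}.
have [a0 y0] : a != 0 /\ y != 0 by apply: phi1_neq0.
have L0E := isoL_eq l0 La a0; have L2E := isoL_eq l2 Ly y0.
have [b b0 L1E] := isoL_gen l1; have Lb : L 1 b by rewrite L1E; exact: ln_id.
have aa := isoL_iso l0 La La; have yy := isoL_iso l2 Ly Ly; have bb := isoL_iso l1 Lb Lb.
have ab : phi a b = 0 by apply: (isoP_iso q0); [exact: s00|exact: s10].
have yb : phi y b = 0 by apply: (isoP_iso q1); [exact: s21|exact: s11].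
have [z H] := complete2 aa yy ay bb ab yb b0.
have [w C w0] := core_ex H.
have ww : phi w w != 0 by apply: contraNneq w0 => /(core_aniso H C) ->.
have L3E : L 3 = ln b.
  have [c0 c00 L3E] := isoL_gen l3; have Lc : L 3 c0 by rewrite L3E; exact: ln_id.
  have cc := isoL_iso l3 Lc Lc.
  have ac : phi a c0 = 0 by apply: (isoP_iso q3); [exact: s03|exact: s33].
  have yc : phi y c0 = 0 by apply: (isoP_iso q2); [exact: s22|exact: s32].
  have bc : phi b c0 = 0 by apply: contrapT => /eqP bc; apply: no13; exists b, c0.
  have /plP[r [s cE]] := isotropic_perp_plane (hyp4_free H) aa bb ab cc ac bc.
  move: yc; rewrite cE !phiE !(gramE H) !zero_oneE => r0.
  rewrite L3E -L1E; apply/esym; apply: isoL_eq => //.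
  by rewrite L1E; apply/lnP; exists s; rewrite cE r0 rs0 add0r.
have fab := hyp4_isob H; have fyb := hyp4_isob (hyp4V H).
pose c n := pert b w z n.
have cc n : phi (c n) (c n) = 0 by apply: pert_iso; rewrite ?(gramE H) ?(coreE C).
have ac n : isob a (c n).
  split=> //; last by rewrite /c /pert ?phiE ?(gramE H) ?(coreE C) ?zero_oneE.
  by apply: (@free2_test _ _ z y); rewrite /c /pert ?phiE ?(gramE H) ?(coreE C) ?zero_oneE ?oner_neq0.
have yc n : isob y (c n).
  split=> //; last by rewrite /c /pert ?phiE ?(gramE H) ?(coreE C) ?zero_oneE.
  by apply: (@free2_test _ _ z a); rewrite /c /pert ?phiE ?(gramE H) ?(coreE C) ?zero_oneE ?oner_neq0.
have P0E : P 0 = pl a b by apply: isoP_eq => //; [exact: s00|exact: s10|case: fab].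
have P1E : P 1 = pl b y by apply: isoP_eq => //; [exact: s11|exact: s21|apply: free2C; case: fyb].
have P2E : P 2 = pl y b.
  by apply: isoP_eq => //; [exact: s22|apply: s32; rewrite L3E; exact: ln_id|case: fyb].
have P3E : P 3 = pl b a.
  apply: isoP_eq => //; [apply: s33; rewrite L3E; exact: ln_id|exact: s03|].
  by apply: free2C; case: fab.
apply: (inS_lim (u := mk4 a b y b) (p := mk4 b y b a)
  (un := fun n => mk4 a b y (c n)) (pn := fun n => mk4 b y (c n) a)) => //.
- exact: I4P.
- exact: I4P.
- by apply: I4P; [case: fab|case/isobC: fyb|case: fyb|case/isobC: fab].
- by move=> n; apply: I4P; [case: fab|case/isobC: fyb|case: (yc n)|case/isobC: (ac n)].
- move=> n; apply: inS_inj.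
  + apply: vconf_cfg; apply: vconf4; apply: conf1P; try exact: pl_r.
    * exact: fab.
    * exact/isobC/fyb.
    * exact: yc.
    * exact/isobC/ac.
  + by exists a, y; split; [exact: ln_id|exact: ln_id|rewrite ay oner_neq0].
  + exists b, (c n); split; [exact: ln_id|exact: ln_id|].
    by rewrite /c /pert ?phiE ?(gramE H) ?(coreE C) ?zero_oneE !MT_eq0 halfq_neq0.
- by apply: I4P => /=; [exact: cvV_cst|exact: cvV_cst|exact: cvV_cst|exact: pert_cvg].
- by apply: I4P => /=; [exact: cvV_cst|exact: cvV_cst|exact: pert_cvg|exact: cvV_cst].
Qed.

Definition cvL (S : nat -> set V) (S0 : set V) := exists (un : nat -> V) u,
  [/\ forall n, un n != 0 /\ S n = ln (un n), u != 0, S0 = ln u & cvV v \oo un u].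

Definition cvP (S : nat -> set V) (S0 : set V) := exists (an bn : nat -> V) a b,
  [/\ forall n, free2 (an n) (bn n) /\ S n = pl (an n) (bn n), free2 a b, S0 = pl a b,
   cvV v \oo an a & cvV v \oo bn b].

(** Unlike in [inS_lim], the frames of the planes may be chosen independently of the vectors
    spanning the lines. *)
Lemma inS_vary L P (Ln Pn : nat -> 'I_4 -> set V) : cfg L P ->
  (forall n, inS (Ln n) (Pn n)) ->
  (forall i, cvL (Ln^~ i) (L i)) -> (forall i, cvP (Pn^~ i) (P i)) -> inS L P.
Proof.
move=> c inn cL cP.
have [f fLP] := cfg_mor c.
have /choice[g gP] : forall n, exists f : Mor v phi e, closure (Mor_inj v phi e) f /\
   msp f (Ln n) (Pn n).
  by move=> n; have [h ? ?] := inn n; exists h.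
have /choice[un /choice[u cu]] := cL.
have /choice[an /choice[bn /choice[a /choice[b cab]]]] := cP.
exists f => //; have cc : closed (closure (Mor_inj v phi e)) by exact: closed_closure.
rewrite (_ : closure _ = closure (closure (Mor_inj v phi e))); last exact/closure_id.
apply: (@closure_seq _ _ v _ _ phi e K_unit _ f g (fun n i => un i n) (fun n i => an i n) (fun n i => bn i n) u a b) => //.
- by move=> n; case: (gP n).
- by move=> n i; case: (gP n) => _ /(_ i)[-> _]; case: (cu i).
- by move=> n i; case: (gP n) => _ /(_ i)[_ ->]; case: (cab i).
- by move=> i; have [-> _] := fLP i; case: (cu i).
- by move=> i; have [_ ->] := fLP i; case: (cab i).
- by move=> i; case: (cu i).
- by move=> i; case: (cab i).
- by move=> i; case: (cab i).
Qed.

Lemma cvL_cst S : isoL S -> cvL (fun=> S) S.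
Proof. by move=> /isoL_gen[u u0 ->]; exists (fun=> u), u; split=> //; exact: cvV_cst. Qed.

Lemma cvP_cst S : isoP S -> cvP (fun=> S) S.
Proof. by move=> [a [b [fab _ _ _ ->]]]; exists (fun=> a), (fun=> b), a, b; split=> //; exact: cvV_cst. Qed.

Lemma isob_isoP a b : isob a b -> isoP (pl a b).
Proof. by case=> *; exists a, b. Qed.

Lemma isoL_ln u : u != 0 -> phi u u = 0 -> isoL (ln u).
Proof. by exists u. Qed.

Lemma isob_neq0 a b : isob a b -> a != 0.
Proof. by case=> f _ _ _; case: ((free2P _ _).1 f). Qed.

Lemma isoP_ln P u : isoP P -> P u -> ln u `<=` P.
Proof. by move=> iP Pu; apply: ln_sub => //; exact: isoP_subspace. Qed.

Lemma isoP_isoL P u : isoP P -> P u -> u != 0 -> isoL (ln u).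
Proof. by move=> iP Pu u0; exists u; split => //; exact: (isoP_iso iP). Qed.

Lemma isoP_dual P b : isoP P -> phi b b = 0 -> ~ P b -> exists2 z, P z & phi b z = 1.
Proof.
move=> iP bb nPb.
have [z Pz bz] : exists2 z, P z & phi b z != 0.
  apply: contrapT => h; apply: nPb; apply: (isoP_max iP bb) => a Pa.
  by apply: phi_eq0C; apply: contrapT => /eqP ba; apply: h; exists a.
exists (rscale z (phi b z)^-1); last by rewrite phiE KVr.
by have [_ _] := isoP_subspace iP; apply.
Qed.

Lemma isoPD P u w : isoP P -> P u -> P w -> P (u + w).
Proof. by move=> iP; have [_ + _] := isoP_subspace iP; apply. Qed.

Lemma isoPZ P u x : isoP P -> P u -> P (rscale u x).
Proof. by move=> iP; have [_ _] := isoP_subspace iP; apply. Qed.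

Lemma isoPB P u w x : isoP P -> P u -> P w -> P (u - rscale w x).
Proof. by move=> iP Pu Pw; rewrite -rsN; apply: isoPD => //; exact: isoPZ. Qed.

Lemma free2_lin a b x : free2 a b -> free2 (b + rscale a x) a.
Proof.
move=> f r s E.
have [|h r0] := f (x * r + s) r.
  by move: E; rewrite rsDl rsA -addrA -rsDr => <-; exact: addrC.
by split => //; move: h; rewrite r0 mulr0 add0r.
Qed.

Lemma cvL_lin a b : free2 a b -> cvL (fun n => ln (b + rscale a (T n))) (ln b).
Proof.
move=> f; exists (fun n => b + rscale a (T n)), b; split=> //.
- by move=> n; split=> //; case: ((free2P _ _).1 (free2_lin (x := T n) f)).
- by case: ((free2P _ _).1 (free2C f)).
- by apply: cvV_small; [exact: cvV_cst|exact: smallT].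
Qed.

Lemma isoP_other P b : isoP P -> P b -> b != 0 -> exists2 a, P a & free2 a b.
Proof.
move=> iP Pb b0; apply: contrapT => h.
have {}h a : P a -> ln b a.
  by move=> Pa; apply: contrapT => na; apply: h; exists a => //; apply: free2C; apply/free2P.
have [c [d [fcd _ _ _ PE]]] := iP; have [c0 ncd] := (free2P _ _).1 fcd; apply: ncd.
have /lnP[x cE] : ln b c by apply: h; rewrite PE; exact: pl_l.
have /lnP[y dE] : ln b d by apply: h; rewrite PE; exact: pl_r.
have x0 : x != 0 by apply: contraNneq c0 => x0; rewrite cE x0 rs0.
by apply/lnP; exists (x^-1 * y); rewrite cE rsA mulrA KVr// mul1r.
Qed.

Lemma isoP_frame P a b : isoP P -> P a -> P b -> free2 a b ->
  [/\ isob a b, P = pl a b & exists y z w, [/\ hyp4 a b y z, core a b y z w & phi w w != 0]].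
Proof.
move=> iP Pa Pb fab.
have iab : isob a b by split=> //; exact: (isoP_iso iP).
split=> //; first exact: isoP_eq.
have [_ aa bb ab] := iab; have [y [z H]] := complete4 fab aa bb ab.
have [w C w0] := core_ex H; exists y, z, w; split=> //.
by apply: contraNneq w0 => /(core_aniso H C) ->.
Qed.

Lemma pert_isob a b y z w n : hyp4 a b y z -> core a b y z w -> isob b (pert a w y n).
Proof.
move=> H C; split; last by rewrite /pert ?phiE ?(gramE H) ?(coreE C) ?zero_oneE.
- by apply: (@free2_test _ _ y z); rewrite /pert ?phiE ?(gramE H) ?(coreE C) ?zero_oneE ?oner_neq0.
- exact: hbb H.
- by apply: pert_iso; rewrite ?(gramE H) ?(coreE C).
Qed.

Lemma pert_phi a b y z w n : hyp4 a b y z -> core a b y z w -> phi w w != 0 ->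
  phi a (pert a w y n) != 0.
Proof. by move=> H C ww; rewrite /pert ?phiE ?(gramE H) ?(coreE C) ?zero_oneE !MT_eq0 halfq_neq0. Qed.

Lemma pert_notin a b y z w n : hyp4 a b y z -> core a b y z w -> phi w w != 0 ->
  ~ pl b (pert a w y n) a.
Proof.
move=> H C ww ha; move: (pert_phi n H C ww); apply/negP; rewrite negbK; apply/eqP.
by apply: (isoP_iso (isob_isoP (pert_isob n H C)) ha); exact: pl_r.
Qed.

Lemma pert_cvP a b y z w : hyp4 a b y z -> core a b y z w ->
  cvP (fun n => pl b (pert a w y n)) (pl a b).
Proof.
move=> H C; exists (fun=> b), (pert a w y), b, a; split.
- by move=> n; split=> //; case: (pert_isob n H C).
- exact/free2C/(hyp4_free H).
- apply: isoP_eq; [exact/isob_isoP/(hyp4_isob H)|exact: pl_r|exact: pl_l|].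
  exact/free2C/(hyp4_free H).
- exact: cvV_cst.
- exact: pert_cvg.
Qed.

(** If [L 0] and [L 2] are not opposite, disjointness of [P 0] and [P 2] forces [L 0 = L 1] and
    [L 3 = L 2]. In bases of [P 0] and [P 2] dual to each other, [L 0] and [L 3] are then turned
    inside these planes until [L 0] is opposite to [L 2]. *)
Lemma inS_opposite_planes L P : cfg L P -> (forall x, P 0 x -> P 2 x -> x = 0) -> inS L P.
Proof.
move=> cLP P02.
have [|no02] := pselect (opposite (L 0) (L 2)); first exact: inS_opposite_lines.
have := cLP; rewrite cfg4 => -[[l0 l1 l2 l3] [q0 q1 q2 q3] [s00 s11 s22 s33] [s10 s21 s32 s03]].
have [a a0 L1E] := isoL_gen l1; have La : L 1 a by rewrite L1E; exact: ln_id.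
have [b b0 L2E] := isoL_gen l2; have Lb : L 2 b by rewrite L2E; exact: ln_id.
have aa := isoL_iso l1 La La; have bb := isoL_iso l2 Lb Lb.
have ab : phi a b = 0 by apply: (isoP_iso q1); [exact: s11|exact: s21].
have nP0b : ~ P 0 b by move=> /P02/(_ (s22 _ Lb)) bE; rewrite bE eqxx in b0.
have nP2a : ~ P 2 a by move=> /(P02 _ (s10 _ La)) aE; rewrite aE eqxx in a0.
have fab : free2 a b.
  apply/free2P; split=> // /lnP[x bE]; apply: nP0b; rewrite bE.
  by apply: isoPZ => //; exact: s10.
have L0E : L 0 = ln a.
  have [c c0 L0E] := isoL_gen l0; have Lc : L 0 c by rewrite L0E; exact: ln_id.
  apply: contrapT => h; apply: nP0b.
  have fac : free2 a c.
    apply/free2P; split=> // ac; apply: h; rewrite -L1E L0E; apply/esym; apply: isoL_eq => //.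
    by rewrite L1E.
  rewrite (isoP_eq q0 (s10 _ La) (s00 _ Lc) fac); apply: (isoP_perp q0) => //.
  - exact: s10.
  - exact: s00.
  - by apply: contrapT => /eqP cb; apply: no02; exists c, b.
have L3E : L 3 = ln b.
  have [c c0 L3E] := isoL_gen l3; have Lc : L 3 c by rewrite L3E; exact: ln_id.
  apply: contrapT => h; apply: nP2a.
  have fbc : free2 b c.
    apply/free2P; split=> // bc; apply: h; rewrite -L2E L3E; apply/esym; apply: isoL_eq => //.
    by rewrite L2E.
  rewrite (isoP_eq q2 (s22 _ Lb) (s32 _ Lc) fbc); apply: (isoP_perp q2) => //.
  - exact: s22.
  - exact: s32.
  - exact: phi_eq0C.
  - by apply: (isoP_iso q3); [exact: s33|apply: s03; rewrite L0E; exact: ln_id].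
have P1E := isoP_eq q1 (s11 _ La) (s21 _ Lb) fab.
have P3E : P 3 = pl a b.
  by apply: isoP_eq => //; [apply: s03; rewrite L0E|apply: s33; rewrite L3E]; exact: ln_id.
have [z P0z bz] := isoP_dual q0 bb nP0b.
have [y [P2y ay zy]] : exists y, [/\ P 2 y, phi a y = 1 & phi z y = 0].
  have [y' Py' ay'] := isoP_dual q2 aa nP2a; exists (y' - rscale b (phi z y')).
  split; first by apply: isoPB => //; exact: s22.
    by rewrite !phiE ay' ab !zero_oneE.
  by rewrite !phiE (_ : phi z b = 1) ?zero_oneE ?subrr// phiC bz s1.
have H : hyp4 a b y z.
  apply: hyp4I => //.
  - exact: (isoP_iso q2).
  - exact: (isoP_iso q0).
  - exact: phi_eq0C.
  - by apply: (isoP_iso q0) => //; exact: s10.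
  - by apply: (isoP_iso q2) => //; exact: s22.
have faz : free2 a z by apply: (@free2_test _ _ b y); rewrite ?(gramE H) ?oner_neq0.
have fby : free2 b y by apply: (@free2_test _ _ a z); rewrite ?(gramE H) ?oner_neq0.
have P0E := isoP_eq q0 (s10 _ La) P0z faz.
have P2E := isoP_eq q2 (s22 _ Lb) P2y fby.
(* The opposite signs keep the two moved vectors orthogonal, so that they span the new [P 3]. *)
pose u0 n := a + rscale z (T n); pose u3 n := b + rscale y (- 1 * T n).
have iu0 n : phi (u0 n) (u0 n) = 0 by rewrite /u0 !phiE !(gramE H) !zero_oneE.
have iu3 n : phi (u3 n) (u3 n) = 0 by rewrite /u3 !phiE !(gramE H) !zero_oneE.
have fu0 n : free2 (u0 n) z by apply: free2_lin; exact: free2C.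
have fu3 n : free2 (u3 n) (u0 n).
  by apply: (@free2_test _ _ y z); rewrite /u0 /u3 !phiE !(gramE H) !zero_oneE ?oner_neq0.
have P3n n : isob (u3 n) (u0 n).
  split=> //; rewrite /u0 /u3 !phiE !(gramE H) !zero_oneE.
  by rewrite sMT sN s1 mulN1r addrN.
apply: (inS_vary (Ln := fun n => mk4 (ln (u0 n)) (L 1) (L 2) (ln (u3 n)))
   (Pn := fun n => mk4 (P 0) (P 1) (P 2) (pl (u3 n) (u0 n)))) => //.
- move=> n; apply: inS_opposite_lines; last first.
    exists (u0 n), b; split; [exact: ln_id|exact: Lb|].
    by rewrite /u0 !phiE !(gramE H) !zero_oneE sT T_neq0.
  apply/cfg4; rewrite /mk4 /=; split; split=> //.
  + by apply: isoL_ln => //; exact: (isob_neq0 (isobC (P3n n))).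
  + by apply: isoL_ln => //; exact: (isob_neq0 (P3n n)).
  + exact: isob_isoP.
  + by apply: isoP_ln => //; apply: isoPD; [|exact: s10|exact: isoPZ].
  + by apply: isoP_ln; [exact: isob_isoP|exact: pl_l].
  + by apply: isoP_ln => //; apply: isoPD; [|exact: s22|exact: isoPZ].
  + by apply: isoP_ln; [exact: isob_isoP|exact: pl_r].
- apply: I4P; rewrite /mk4 /=; [|exact: cvL_cst|exact: cvL_cst|].
  + by rewrite L0E; apply: cvL_lin; exact: free2C.
  + rewrite L3E; exists u3, b; split=> //.
    * by move=> n; split=> //; exact: (isob_neq0 (P3n n)).
    * by apply: cvV_small; [exact: cvV_cst|exact: smallMTc].
- apply: I4P; rewrite /mk4 /=; [exact: cvP_cst|exact: cvP_cst|exact: cvP_cst|].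
  exists u3, u0, b, a; split=> //.
  + exact: free2C.
  + by rewrite P3E; apply: isoP_eq; [rewrite -P3E|exact: pl_r|exact: pl_l|exact: free2C].
  + by apply: cvV_small; [exact: cvV_cst|exact: smallMTc].
  + by apply: cvV_small; [exact: cvV_cst|exact: smallT].
Qed.

Lemma isoL_equal_gen (L : 'I_4 -> set V) : isoL (L 1) -> L 2 = L 1 ->
  exists b, [/\ b != 0, L 1 = ln b, L 2 = ln b & L 1 b].
Proof. by move=> /isoL_gen[b b0 E] ->; exists b; split=> //; rewrite E; exact: ln_id. Qed.

Lemma isoL_neq L M a : isoL L -> isoL M -> L a -> a != 0 -> L <> M -> ~ M a.
Proof. by move=> iL iM La a0 LM Ma; apply: LM; rewrite (isoL_eq iL La a0) (isoL_eq iM Ma a0). Qed.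

Lemma free2_lines L M a b : isoL L -> isoL M -> L a -> M b -> a != 0 -> b != 0 ->
  L <> M -> free2 a b.
Proof.
move=> iL iM La Mb a0 b0 LM; apply/free2P; split=> // ab.
apply: (isoL_neq iM iL Mb b0 (nesym LM)).
by rewrite (isoL_eq iL La a0).
Qed.

Lemma isoP_neq P Q a b : isoP P -> isoP Q -> P a -> P b -> Q b -> free2 a b ->
  P <> Q -> ~ Q a.
Proof.
by move=> iP iQ Pa Pb Qb f PQ Qa; apply: PQ; rewrite (isoP_eq iP Pa Pb f) (isoP_eq iQ Qa Qb f).
Qed.

Lemma isoP_lin P a b : isoP P -> P b -> free2 a b -> P a -> forall x, P x ->
  exists r s, x = rscale a r + rscale b s.
Proof. by move=> iP Pb f Pa x; rewrite (isoP_eq iP Pa Pb f) => /plP. Qed.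

Lemma cvL_lin_in P a b : isoP P -> P a -> P b -> free2 a b ->
  forall n, [/\ P (b + rscale a (T n)), b + rscale a (T n) != 0 & isoL (ln (b + rscale a (T n)))].
Proof.
move=> iP Pa Pb f n.
have Pn : P (b + rscale a (T n)) by apply: isoPD => //; exact: isoPZ.
have n0 : b + rscale a (T n) != 0 by case: ((free2P _ _).1 (free2_lin (x := T n) f)).
by split=> //; exact: (isoP_isoL iP).
Qed.

Lemma line_neq a b : free2 a b -> forall n, ln (b + rscale a (T n)) <> ln b.
Proof.
move=> f n E; have : ln b (b + rscale a (T n)) by rewrite -E; exact: ln_id.
move=> /lnP[x E'].
have [|/eqP] := f (T n) (1 - x); last by rewrite (negPf (T_neq0 n)).
by rewrite rsDr rs1 rsN -E' addrA [rscale a _ + b]addrC subrr.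
Qed.

Lemma line_neq' a b : free2 a b -> forall n, ln (b + rscale a (T n)) <> ln a.
Proof.
move=> f n E; have : ln a (b + rscale a (T n)) by rewrite -E; exact: ln_id.
move=> /lnP[x E'].
have [|_ /eqP] := f (T n - x) 1; last by rewrite oner_eq0.
by rewrite rsDr rs1 rsN -E' addrC addrA subrr.
Qed.

(** The line [L 2] is moved inside [P 1] away from [L 1], which makes it opposite to [L 0]. To
    remain orthogonal to it and to [a], the line [L 3] has to leave [P 0], with a first-order term
    in the core. *)
Lemma inS_collapsed_planes_generic L P : cfg L P -> P 2 = P 0 -> P 3 = P 0 -> L 2 = L 1 ->
  L 0 <> L 1 -> L 3 <> L 1 -> L 3 <> L 0 -> P 1 <> P 0 -> inS L P.
Proof.
move=> cLP P20 P30 L21 L01 L31 L30 P10.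
have := cLP; rewrite cfg4 => -[[l0 l1 l2 l3] [q0 q1 q2 q3] [s00 s11 s22 s33] [s10 s21 s32 s03]].
have [b [b0 L1E L2E Lb]] := isoL_equal_gen l1 L21.
have [a a0 L0E] := isoL_gen l0; have La : L 0 a by rewrite L0E; exact: ln_id.
have fab : free2 a b := free2_lines l0 l1 La Lb a0 b0 L01.
have [iab P0E _] := isoP_frame q0 (s00 _ La) (s10 _ Lb) fab.
have [_ aa bb ab] := iab.
have nP1a : ~ P 1 a by apply: (isoP_neq q0 q1 (s00 _ La) (s10 _ Lb) (s11 _ Lb) fab); exact: nesym.
have [y P1y ay] := isoP_dual q1 aa nP1a.
have [z H] : exists z, hyp4 a b y z.
  by apply: complete2 => //; apply: (isoP_iso q1) => //; exact: s11.
have [w C w0] := core_ex H.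
have ww : phi w w != 0 by apply: contraNneq w0 => /(core_aniso H C) ->.
have P1E : P 1 = pl b y.
  by apply: isoP_eq => //; [exact: s11|apply: (@free2_test _ _ a z); rewrite ?(gramE H) ?oner_neq0].
have [s [s0' L3E]] : exists s, s != 0 /\ L 3 = ln (b + rscale a s).
  have [c c0 L3E] := isoL_gen l3; have Lc : L 3 c by rewrite L3E; exact: ln_id.
  have Pc : P 0 c by rewrite -P30; exact: s33.
  have [r [s cE]] := isoP_lin q0 (s10 _ Lb) fab (s00 _ La) Pc.
  have r0 : r != 0.
    apply/eqP => r0; apply: (isoL_neq l3 l1 Lc c0 L31).
    by rewrite L1E; apply/lnP; exists s; rewrite cE r0 rs0 add0r.
  have s'0 : s != 0.
    apply/eqP => s'0; apply: (isoL_neq l3 l0 Lc c0 L30).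
    by rewrite L0E; apply/lnP; exists r; rewrite cE s'0 rs0 addr0.
  exists (r * s^-1); split.
    by apply: contraNneq r0 => h; rewrite -(mulr1 r) -(KV s'0) mulrA h mul0r.
  apply: isoL_eq => //.
    have -> : b + rscale a (r * s^-1) = rscale c s^-1.
      by rewrite cE rsDl !rsA KVr// rs1 addrC.
    by have [_ _] := isoL_subspace l3; apply.
  by case: ((free2P _ _).1 (free2_lin (x := r * s^-1) fab)).
(* Chosen so that [u2] and [u3] are orthogonal: their product is [halfq w + sigma tau * s], up to
   [T n] squared. *)
pose tau := - (sigma s^-1 * halfq w).
have stau : sigma tau = - (halfq w * s^-1) by rewrite /tau sN sM sK halfq_sym.
have tau0 : tau != 0.
  rewrite oppr_eq0; apply/eqP => h; have /eqP : sigma (sigma s^-1 * halfq w) = 0 by rewrite h s0.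
  rewrite sM sK halfq_sym => /eqP h'; have /eqP := KM0 h' (halfq_neq0 ww).
  by rewrite invr_eq0 (negPf s0').
have [pf pfP pcv] : exists2 pf : nat -> V, (forall n, [/\ phi (pf n) (pf n) = 0,
    phi a (pf n) = 0, phi y (pf n) = 0, phi z (pf n) = 1 & phi b (pf n) = halfq w * T n * T n])
    & cvV v \oo pf b.
  exists (pert b w z); last exact: pert_cvg.
  move=> n; split; first by apply: pert_iso; rewrite ?(gramE H) ?(coreE C).
  all: rewrite /pert ?phiE ?(gramE H) ?(coreE C) ?zero_oneE => //.
pose u2 n := b + rscale y (tau * T n * T n).
pose u3 n := rscale a s + pf n.
have iu2 n : phi (u2 n) (u2 n) = 0 by rewrite /u2 ?phiE ?(gramE H) ?zero_oneE.
have pp n : phi (pf n) (pf n) = 0 by case: (pfP n).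
have ap n : phi a (pf n) = 0 by case: (pfP n).
have yp n : phi y (pf n) = 0 by case: (pfP n).
have zp n : phi z (pf n) = 1 by case: (pfP n).
have bp n : phi b (pf n) = halfq w * T n * T n by case: (pfP n).
have iu3 n : phi (u3 n) (u3 n) = 0.
  by rewrite /u3 !phiDl !phiDr !phiZl !phiZr pp ap (phi_eq0C (ap n)) aa !zero_oneE.
have P2n n : isob (u2 n) (u3 n).
  split=> //.
    apply: (@free2_test _ _ y z); rewrite /u2 /u3 ?phiE ?yp ?zp ?(gramE H) ?zero_oneE //.
    exact: oner_neq0.
  rewrite /u2 /u3 ?phiE ?yp ?bp ?(gramE H) ?zero_oneE.
  rewrite !sMT stau !mulNr -!mulrA !TC !mulrA.
  by rewrite divrK ?K_unit// opprK addNr.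
have P3n n : isob (u3 n) a.
  apply: isobC; split=> //.
    by apply: (@free2_test _ _ z y); rewrite /u3 ?phiE ?zp ?(gramE H) ?zero_oneE ?oner_neq0.
  by rewrite /u3 ?phiE ?ap ?(gramE H) ?zero_oneE.
have u3cv : cvV v \oo u3 (rscale a s + b).
  move=> l ll; rewrite (FformD _ _ ll).
  apply: (cvF_ext (x := fun n => l (rscale a s) + l (pf n))).
    by move=> n; rewrite /u3 /= (FformD _ _ ll).
  by apply: cvFD; [exact: cvF_cst|exact: pcv].
have u2cv : cvV v \oo u2 b by apply: cvV_small; [exact: cvV_cst|exact: smallMTT].
have fbs : free2 (rscale a s + b) a by rewrite addrC; exact: free2_lin.
have Pbs : P 0 (rscale a s + b).
  by apply: isoPD => //; [apply: isoPZ => //; exact: s00|exact: s10].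
have fbsb : free2 b (rscale a s + b).
  by apply: (@free2_test _ _ y z); rewrite ?phiE ?(gramE H) ?zero_oneE ?oner_neq0.
apply: (inS_vary (Ln := fun n => mk4 (L 0) (L 1) (ln (u2 n)) (ln (u3 n)))
   (Pn := fun n => mk4 (P 0) (P 1) (pl (u2 n) (u3 n)) (pl (u3 n) a))) => //.
- move=> n; apply: inS_opposite_lines; last first.
    exists a, (u2 n); split; [exact: La|exact: ln_id|].
    by rewrite /u2 ?phiE ?(gramE H) ?zero_oneE !MT_eq0.
  apply/cfg4; rewrite /mk4 /=; split; split=> //.
  + by apply: isoL_ln => //; exact: (isob_neq0 (P2n n)).
  + by apply: isoL_ln => //; exact: (isob_neq0 (P3n n)).
  + exact: isob_isoP.
  + exact: isob_isoP.
  + by apply: isoP_ln; [exact: isob_isoP|exact: pl_l].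
  + by apply: isoP_ln; [exact: isob_isoP|exact: pl_l].
  + by apply: isoP_ln => //; apply: isoPD; [|exact: s11|exact: isoPZ].
  + by apply: isoP_ln; [exact: isob_isoP|exact: pl_r].
  + by rewrite L0E; apply: isoP_ln; [exact: isob_isoP|exact: pl_r].
- apply: I4P; rewrite /mk4 /=; [exact: cvL_cst|exact: cvL_cst| |].
  + rewrite L2E; exists u2, b; split=> // n; split=> //; exact: (isob_neq0 (P2n n)).
  + rewrite L3E addrC; exists u3, (rscale a s + b); split=> //.
    * by move=> n; split=> //; exact: (isob_neq0 (P3n n)).
    * by case: ((free2P _ _).1 fbs).
- apply: I4P; rewrite /mk4 /=; [exact: cvP_cst|exact: cvP_cst| |].
  + exists u2, u3, b, (rscale a s + b); split=> //.
    * by move=> n; split=> //; case: (P2n n).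
    * by rewrite P20; apply: isoP_eq => //; exact: s10.
  + exists u3, (fun=> a), (rscale a s + b), a; split=> //.
    * by move=> n; split=> //; case: (P3n n).
    * by rewrite P30; apply: isoP_eq => //; exact: s00.
    * exact: cvV_cst.
Qed.

(** Coincidences excluded by the generic case are removed one at a time: [L 3] and then [L 0] are
    turned inside [P 0], and [P 1] is turned about [L 1] by means of [pert]. *)
Lemma inS_collapsed_planes L P : cfg L P -> P 2 = P 0 -> P 3 = P 0 -> L 2 = L 1 -> inS L P.
Proof.
move=> + + + +.
have S1 L' P' : cfg L' P' -> P' 2 = P' 0 -> P' 3 = P' 0 -> L' 2 = L' 1 ->
  L' 0 <> L' 1 -> P' 1 <> P' 0 -> inS L' P'.
  move=> cLP P20 P30 L21 L01 P10.
  have := cLP; rewrite cfg4 => -[[l0 l1 l2 l3] [q0 q1 q2 q3] [s00 s11 s22 s33] [s10 s21 s32 s03]].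
  have [b [b0 L1E L2E Lb]] := isoL_equal_gen l1 L21.
  have [a a0 L0E] := isoL_gen l0; have La : L' 0 a by rewrite L0E; exact: ln_id.
  have fab : free2 a b := free2_lines l0 l1 La Lb a0 b0 L01.
  have fba := free2C fab.
  have key x y : P' 0 x -> P' 0 y -> free2 x y -> L' 3 = ln y ->
     (forall n, ln (y + rscale x (T n)) <> L' 1) ->
     (forall n, ln (y + rscale x (T n)) <> L' 0) -> inS L' P'.
    move=> Px Py fxy L3E n1 n0.
    apply: (inS_vary (Ln := fun n => mk4 (L' 0) (L' 1) (L' 2) (ln (y + rscale x (T n))))
       (Pn := fun=> P')) => //.
    - move=> n; have [Pn n0' iL] := cvL_lin_in q0 Px Py fxy n.
      apply: inS_collapsed_planes_generic; rewrite /mk4 //=.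
      apply/cfg4; split; split=> //=; [rewrite P30|rewrite P20]; exact: isoP_ln.
    - apply: I4P; rewrite /mk4 /=; try exact: cvL_cst.
      by rewrite L3E; exact: cvL_lin.
    - by apply: I4P; exact: cvP_cst.
  have [L31|L31] := pselect (L' 3 = L' 1).
    apply: (key a b) => //; try (by [exact: s00|exact: s10]).
    - by rewrite L31.
    - by rewrite L1E; exact: line_neq.
    - by rewrite L0E; exact: line_neq'.
  have [L30|L30] := pselect (L' 3 = L' 0).
    apply: (key b a) => //; try (by [exact: s00|exact: s10]).
    - by rewrite L30.
    - by rewrite L1E; exact: line_neq'.
    - by rewrite L0E; exact: line_neq.
  exact: inS_collapsed_planes_generic.
have S2 L' P' : cfg L' P' -> P' 2 = P' 0 -> P' 3 = P' 0 -> L' 2 = L' 1 ->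
  P' 1 <> P' 0 -> inS L' P'.
  move=> cLP P20 P30 L21 P10.
  have [L01|L01] := pselect (L' 0 = L' 1); last exact: S1.
  have := cLP; rewrite cfg4 => -[[l0 l1 l2 l3] [q0 q1 q2 q3] [s00 s11 s22 s33] [s10 s21 s32 s03]].
  have [b [b0 L1E L2E Lb]] := isoL_equal_gen l1 L21.
  have [a Pa fab] := isoP_other q0 (s10 _ Lb) b0.
  apply: (inS_vary (Ln := fun n => mk4 (ln (b + rscale a (T n))) (L' 1) (L' 2) (L' 3))
       (Pn := fun=> P')) => //.
  - move=> n; have [Pn n0' iL] := cvL_lin_in q0 Pa (s10 _ Lb) fab n.
    apply: S1; rewrite /mk4 //=; last by rewrite L1E; exact: line_neq.
    by apply/cfg4; split; split=> //=; rewrite ?P30; exact: isoP_ln.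
  - apply: I4P; rewrite /mk4 /=; try exact: cvL_cst.
    by rewrite L01 L1E; exact: cvL_lin.
  - by apply: I4P; exact: cvP_cst.
move=> cLP P20 P30 L21.
have [P10|P10] := pselect (P 1 = P 0); last exact: S2.
have := cLP; rewrite cfg4 => -[[l0 l1 l2 l3] [q0 q1 q2 q3] [s00 s11 s22 s33] [s10 s21 s32 s03]].
have [b [b0 L1E L2E Lb]] := isoL_equal_gen l1 L21.
have [a Pa fab] := isoP_other q0 (s10 _ Lb) b0.
have [iab P0E [y [z [w [H C ww]]]]] := isoP_frame q0 Pa (s10 _ Lb) fab.
apply: (inS_vary (Ln := fun=> L) (Pn := fun n => mk4 (P 0) (pl b (pert a w y n)) (P 2) (P 3))) => //.
- move=> n; have iP := isob_isoP (pert_isob n H C).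
  apply: S2; rewrite /mk4 //=; last first.
    by move=> E; apply: (pert_notin (n := n) H C ww); rewrite E.
  apply/cfg4; split; split=> //=; [rewrite L1E|rewrite L2E]; apply: isoP_ln => //; exact: pl_l.
- by apply: I4P; exact: cvL_cst.
- apply: I4P; rewrite /mk4 /=; try exact: cvP_cst.
  by rewrite P10 P0E; exact: (pert_cvP H C).
Qed.

(** Again [L 2] moves inside [P 1] to become opposite to [L 0]. Here [P 2] is not [P 0] and can be
    carried along; the moved [P 2] contains a vector [u3] close to [b] and orthogonal to [a], which
    spans the new [L 3]. *)
Lemma inS_collapsed_lines_generic L P : cfg L P -> P 3 = P 0 -> L 2 = L 1 -> L 3 = L 1 ->
  L 0 <> L 1 -> P 1 <> P 0 -> P 2 <> P 0 -> inS L P.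
Proof.
move=> cLP P30 L21 L31 L01 P10 P20.
have := cLP; rewrite cfg4 => -[[l0 l1 l2 l3] [q0 q1 q2 q3] [s00 s11 s22 s33] [s10 s21 s32 s03]].
have [b [b0 L1E L2E Lb]] := isoL_equal_gen l1 L21.
have Lb2 : L 2 b by rewrite L2E; exact: ln_id.
have [a a0 L0E] := isoL_gen l0; have La : L 0 a by rewrite L0E; exact: ln_id.
have fab : free2 a b := free2_lines l0 l1 La Lb a0 b0 L01.
have [iab P0E _] := isoP_frame q0 (s00 _ La) (s10 _ Lb) fab.
have [_ aa bb ab] := iab.
have nP1a : ~ P 1 a by apply: (isoP_neq q0 q1 (s00 _ La) (s10 _ Lb) (s11 _ Lb) fab); exact: nesym.
have nP2a : ~ P 2 a by apply: (isoP_neq q0 q2 (s00 _ La) (s10 _ Lb) (s22 _ Lb2) fab); exact: nesym.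
have [y P1y ay] := isoP_dual q1 aa nP1a.
have [z H] : exists z, hyp4 a b y z.
  by apply: complete2 => //; apply: (isoP_iso q1) => //; exact: s11.
have P1E : P 1 = pl b y.
  by apply: isoP_eq => //; [exact: s11|apply: (@free2_test _ _ a z); rewrite ?(gramE H) ?oner_neq0].
have [c [P2c ac zc cc bc]] : exists c, [/\ P 2 c, phi a c = 1, phi z c = 0, phi c c = 0 & phi b c = 0].
  have [c' Pc' ac'] := isoP_dual q2 aa nP2a.
  have Pc : P 2 (c' - rscale b (phi z c')) by apply: isoPB => //; exact: s22.
  exists (c' - rscale b (phi z c')); split=> //.
  - by rewrite !phiE ac' !(gramE H) !zero_oneE.
  - by rewrite !phiE !(gramE H) !zero_oneE subrr.
  - exact: (isoP_iso q2).
  - by apply: (isoP_iso q2) => //; exact: s22.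
have cz := phi_eq0C zc; have cb := phi_eq0C bc.
have ca : phi c a = 1 by rewrite phiC ac s1.
have P2E : P 2 = pl b c.
  apply: isoP_eq => //; first exact: s22.
  by apply: (@free2_test _ _ a z); rewrite ?(gramE H) ?ac ?oner_neq0.
have fbc : free2 b c by apply: (@free2_test _ _ a z); rewrite ?(gramE H) ?ac ?oner_neq0.
pose al := phi y c.
have cy : phi c y = sigma al by rewrite phiC.
pose u2 n := b + rscale y (- 1 * T n).
(* The term along [z] cancels the pairing [al] of [y] with [c], so that [p2] is orthogonal to [u2].
   The normalisation [phi a c = 1] makes [u2 + p2 t] orthogonal to [a]. *)
pose p2 n := c + rscale z (al * T n).
pose u3 n := u2 n + rscale (p2 n) (T n).
have GE := (haa H, hbb H, hyy H, hzz H, hab H, hba H, hyz H, hzy H,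
  (hay H, hya H, hbz H, hzb H, haz H, hza H, hby H, hyb H),
  (ac, ca, zc, cz, bc, cb, cc, cy, erefl al : phi y c = al)).
have iu2 n : phi (u2 n) (u2 n) = 0 by rewrite /u2 ?phiE ?GE ?zero_oneE.
have ip2 n : phi (p2 n) (p2 n) = 0 by rewrite /p2 ?phiE ?GE ?zero_oneE.
have up2 n : phi (u2 n) (p2 n) = 0.
  by rewrite /u2 /p2 ?phiE ?GE ?zero_oneE sMT sN s1 mulN1r mulNr TC addrN.
have P2n n : isob (u2 n) (p2 n).
  split=> //; apply: free2C.
  by apply: (@free2_test _ _ z a); rewrite /u2 /p2 ?phiE ?GE ?zero_oneE ?oner_neq0.
have iu3 n : phi (u3 n) (u3 n) = 0.
  by apply: (tiso_pl (iu2 n) (ip2 n) (up2 n)); apply/plP; exists 1, (T n); rewrite rs1.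
have P3n n : isob (u3 n) a.
  apply: isobC; split=> //.
    by apply: (@free2_test _ _ z y); rewrite /u3 /u2 /p2 ?phiE ?GE ?zero_oneE ?oner_neq0.
  by rewrite /u3 /u2 /p2 ?phiE ?GE ?zero_oneE mulN1r addNr.
have u2cv : cvV v \oo u2 b by apply: cvV_small; [exact: cvV_cst|exact: smallMTc].
have u3cv : cvV v \oo u3 b.
  have h : cvV v \oo (fun n => b + rscale y (- 1 * T n) + rscale c (T n) + rscale z (al * T n * T n)) b.
    by apply: cvV_small; [apply: cvV_small; [|exact: smallT]|exact: smallMTT].
  by move=> l ll; have := h l ll; apply: cvF_ext => n; rewrite /u3 /p2 /= rsDl rsA addrA.
apply: (inS_vary (Ln := fun n => mk4 (L 0) (L 1) (ln (u2 n)) (ln (u3 n)))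
   (Pn := fun n => mk4 (P 0) (P 1) (pl (u2 n) (p2 n)) (pl (u3 n) a))) => //.
- move=> n; apply: inS_opposite_lines; last first.
    exists a, (u2 n); split; [exact: La|exact: ln_id|].
    by rewrite /u2 ?phiE ?GE ?zero_oneE mulN1r oppr_eq0 T_neq0.
  apply/cfg4; rewrite /mk4 /=; split; split=> //.
  + by apply: isoL_ln => //; exact: (isob_neq0 (P2n n)).
  + by apply: isoL_ln => //; exact: (isob_neq0 (P3n n)).
  + exact: isob_isoP.
  + exact: isob_isoP.
  + by apply: isoP_ln; [exact: isob_isoP|exact: pl_l].
  + by apply: isoP_ln; [exact: isob_isoP|exact: pl_l].
  + by apply: isoP_ln => //; apply: isoPD; [|exact: s11|exact: isoPZ].
  + apply: isoP_ln; first exact: isob_isoP.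
    by apply/plP; exists 1, (T n); rewrite rs1.
  + by rewrite L0E; apply: isoP_ln; [exact: isob_isoP|exact: pl_r].
- apply: I4P; rewrite /mk4 /=; [exact: cvL_cst|exact: cvL_cst| |].
  + by rewrite L2E; exists u2, b; split=> // n; split=> //; exact: (isob_neq0 (P2n n)).
  + by rewrite L31 L1E; exists u3, b; split=> // n; split=> //; exact: (isob_neq0 (P3n n)).
- apply: I4P; rewrite /mk4 /=; [exact: cvP_cst|exact: cvP_cst| |].
  + exists u2, p2, b, c; split=> //.
    * by move=> n; split=> //; case: (P2n n).
    * by apply: cvV_small; [exact: cvV_cst|exact: smallMTc].
  + exists u3, (fun=> a), b, a; split=> //.
    * by move=> n; split=> //; case: (P3n n).
    * exact: free2C.
    * rewrite P30; apply: isoP_eq => //; [exact: s10|exact: s00|exact: free2C].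
    * exact: cvV_cst.
Qed.

(** The generic position is reached by turning [L 0] inside [P 0], and [P 2] and [P 1] about the
    common line. *)
Lemma inS_collapsed_lines L P : cfg L P -> P 3 = P 0 -> L 2 = L 1 -> L 3 = L 1 -> inS L P.
Proof.
move=> + + + +.
have S1 L' P' : cfg L' P' -> P' 3 = P' 0 -> L' 2 = L' 1 -> L' 3 = L' 1 ->
  P' 1 <> P' 0 -> P' 2 <> P' 0 -> inS L' P'.
  move=> cLP P30 L21 L31 P10 P20.
  have [L01|L01] := pselect (L' 0 = L' 1); last exact: inS_collapsed_lines_generic.
  have := cLP; rewrite cfg4 => -[[l0 l1 l2 l3] [q0 q1 q2 q3] [s00 s11 s22 s33] [s10 s21 s32 s03]].
  have [b [b0 L1E L2E Lb]] := isoL_equal_gen l1 L21.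
  have [a Pa fab] := isoP_other q0 (s10 _ Lb) b0.
  apply: (inS_vary (Ln := fun n => mk4 (ln (b + rscale a (T n))) (L' 1) (L' 2) (L' 3))
       (Pn := fun=> P')) => //.
  - move=> n; have [Pn n0' iL] := cvL_lin_in q0 Pa (s10 _ Lb) fab n.
    apply: inS_collapsed_lines_generic; rewrite /mk4 //=; last by rewrite L1E; exact: line_neq.
    by apply/cfg4; split; split=> //=; rewrite ?P30; exact: isoP_ln.
  - apply: I4P; rewrite /mk4 /=; try exact: cvL_cst.
    by rewrite L01 L1E; exact: cvL_lin.
  - by apply: I4P; exact: cvP_cst.
have S2 L' P' : cfg L' P' -> P' 3 = P' 0 -> L' 2 = L' 1 -> L' 3 = L' 1 ->
  P' 1 <> P' 0 -> inS L' P'.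
  move=> cLP P30 L21 L31 P10.
  have [P20|P20] := pselect (P' 2 = P' 0); last exact: S1.
  have := cLP; rewrite cfg4 => -[[l0 l1 l2 l3] [q0 q1 q2 q3] [s00 s11 s22 s33] [s10 s21 s32 s03]].
  have [b [b0 L1E L2E Lb]] := isoL_equal_gen l1 L21.
  have L3E : L' 3 = ln b by rewrite L31.
  have [a Pa fab] := isoP_other q0 (s10 _ Lb) b0.
  have [iab P0E [y [z [w [H C ww]]]]] := isoP_frame q0 Pa (s10 _ Lb) fab.
  apply: (inS_vary (Ln := fun=> L') (Pn := fun n => mk4 (P' 0) (P' 1) (pl b (pert a w y n)) (P' 3))) => //.
  - move=> n; have iP := isob_isoP (pert_isob n H C).
    apply: S1; rewrite /mk4 //=; last first.
      by move=> E; apply: (pert_notin (n := n) H C ww); rewrite E.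
    by apply/cfg4; split; split=> //=; rewrite ?L2E ?L3E; apply: isoP_ln => //; exact: pl_l.
  - by apply: I4P; exact: cvL_cst.
  - apply: I4P; rewrite /mk4 /=; try exact: cvP_cst.
    by rewrite P20 P0E; exact: (pert_cvP H C).
move=> cLP P30 L21 L31.
have [P10|P10] := pselect (P 1 = P 0); last exact: S2.
have := cLP; rewrite cfg4 => -[[l0 l1 l2 l3] [q0 q1 q2 q3] [s00 s11 s22 s33] [s10 s21 s32 s03]].
have [b [b0 L1E L2E Lb]] := isoL_equal_gen l1 L21.
have [a Pa fab] := isoP_other q0 (s10 _ Lb) b0.
have [iab P0E [y [z [w [H C ww]]]]] := isoP_frame q0 Pa (s10 _ Lb) fab.
apply: (inS_vary (Ln := fun=> L) (Pn := fun n => mk4 (P 0) (pl b (pert a w y n)) (P 2) (P 3))) => //.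
- move=> n; have iP := isob_isoP (pert_isob n H C).
  apply: S2; rewrite /mk4 //=; last first.
    by move=> E; apply: (pert_notin (n := n) H C ww); rewrite E.
  by apply/cfg4; split; split=> //=; rewrite ?L1E ?L2E; apply: isoP_ln => //; exact: pl_l.
- by apply: I4P; exact: cvL_cst.
- apply: I4P; rewrite /mk4 /=; try exact: cvP_cst.
  by rewrite P10 P0E; exact: (pert_cvP H C).
Qed.

Lemma cfg_rot L P : cfg L P -> cfg (fun i => L (i + 1)) (fun i => P (i + 1)).
Proof. by move=> c i; have := c (i + 1). Qed.

(** When neither [P 1] nor [P 3] equals [P 0], the lines [L 0] and [L 3] are moved together inside
    [P 0 = P 2] to [ln (m n)], and [P 3] is turned so as to contain it. Afterwards [P 1] and [P 3]
    meet only in 0, and [inS_opposite_planes] applies after a rotation. *)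
Lemma inS_line_star_opp L P : cfg L P -> L 1 = L 0 -> L 2 = L 0 -> L 3 = L 0 -> P 2 = P 0 -> inS L P.
Proof.
move=> cLP L10 L20 L30 P20.
have [P30|P30] := pselect (P 3 = P 0); first by apply: inS_collapsed_lines => //; rewrite ?L10.
have [P10|P10] := pselect (P 1 = P 0).
  by apply: inS_rotI; apply: inS_collapsed_lines; rewrite /= ?I4_succE ?P10 ?L20 ?L30//; exact: cfg_rot.
have := cLP; rewrite cfg4 => -[[l0 l1 l2 l3] [q0 q1 q2 q3] [s00 s11 s22 s33] [s10 s21 s32 s03]].
have [b b0 L0E] := isoL_gen l0; have Lb : L 0 b by rewrite L0E; exact: ln_id.
have [a Pa fab] := isoP_other q0 (s00 _ Lb) b0.
have [iab P0E _] := isoP_frame q0 Pa (s00 _ Lb) fab.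
have [_ aa bb ab] := iab.
have P1b : P 1 b by apply: s11; rewrite L10.
have nP1a : ~ P 1 a by apply: (isoP_neq q0 q1 Pa (s00 _ Lb) P1b fab); exact: nesym.
have nP3a : ~ P 3 a by apply: (isoP_neq q0 q3 Pa (s00 _ Lb) (s03 _ Lb) fab); exact: nesym.
have [y P1y ay] := isoP_dual q1 aa nP1a.
have [z H] : exists z, hyp4 a b y z.
  by apply: complete2 => //; apply: (isoP_iso q1).
have P1E : P 1 = pl b y.
  by apply: isoP_eq => //; apply: (@free2_test _ _ a z); rewrite ?(gramE H) ?oner_neq0.
have [c [P3c ac zc cc bc]] : exists c, [/\ P 3 c, phi a c = 1, phi z c = 0, phi c c = 0 & phi b c = 0].
  have [c' Pc' ac'] := isoP_dual q3 aa nP3a.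
  have Pc : P 3 (c' - rscale b (phi z c')) by apply: isoPB => //; exact: s03.
  exists (c' - rscale b (phi z c')); split=> //.
  - by rewrite !phiE ac' !(gramE H) !zero_oneE.
  - by rewrite !phiE !(gramE H) !zero_oneE subrr.
  - exact: (isoP_iso q3).
  - by apply: (isoP_iso q3) => //; exact: s03.
have cz := phi_eq0C zc; have cb := phi_eq0C bc.
have ca : phi c a = 1 by rewrite phiC ac s1.
have fbc : free2 b c by apply: (@free2_test _ _ a z); rewrite ?(gramE H) ?ac ?oner_neq0.
have P3E : P 3 = pl b c by apply: isoP_eq => //; exact: s03.
pose m n := b + rscale a (T n).
pose p3 n := c + rscale z (- 1 * T n).
have GE := (haa H, hbb H, hyy H, hzz H, hab H, hba H, hyz H, hzy H,
  (hay H, hya H, hbz H, hzb H, haz H, hza H, hby H, hyb H), (ac, ca, zc, cz, bc, cb, cc)).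
have Pm n : P 0 (m n) by apply: isoPD => //; [exact: s00|exact: isoPZ].
have mE n : free2 (m n) a by exact: free2_lin.
have m0 n : m n != 0 by case: ((free2P _ _).1 (mE n)).
have iLm n : isoL (ln (m n)) by exact: (isoP_isoL q0 (Pm n) (m0 n)).
have P3n n : isob (m n) (p3 n).
  split; try by rewrite /m /p3 ?phiE ?GE ?zero_oneE.
    apply: free2C.
    by apply: (@free2_test _ _ z a); rewrite /m /p3 ?phiE ?GE ?zero_oneE ?oner_neq0.
  by rewrite /m /p3 ?phiE ?GE ?zero_oneE sT mulN1r ?addNr ?addrN.
apply: (inS_vary (Ln := fun n => mk4 (ln (m n)) (L 1) (L 2) (ln (m n)))
   (Pn := fun n => mk4 (P 0) (P 1) (P 2) (pl (m n) (p3 n)))) => //.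
- move=> n; apply: inS_rotI; apply: inS_opposite_planes.
    apply: cfg_rot; apply/cfg4; rewrite /mk4 /=; split; split=> //.
    + exact: isob_isoP.
    + exact: isoP_ln.
    + by apply: isoP_ln; [exact: isob_isoP|exact: pl_l].
    + by rewrite P20; apply: isoP_ln.
    + by apply: isoP_ln; [exact: isob_isoP|exact: pl_l].
  rewrite /mk4 /= => x; rewrite P1E => /plP[r [s xE]] /plP[r' [s' xE']].
  have s'0 : s' = 0.
    have : phi b x = 0 by rewrite xE ?phiE ?GE ?zero_oneE.
    rewrite xE' /m /p3 ?phiE ?GE ?zero_oneE => /eqP; rewrite mulN1r mulNr oppr_eq0.
    by move=> /eqP h; apply: (KM0 h); exact: T_neq0.
  rewrite s'0 rs0 addr0 in xE'.
  have s0' : s = 0.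
    by have := congr1 (phi a) xE; rewrite xE' /m ?phiE ?GE ?zero_oneE.
  have : phi y x = 0 by rewrite xE s0' ?phiE ?GE ?zero_oneE.
  rewrite xE' /m ?phiE ?GE ?zero_oneE => h; rewrite (KM0 h (T_neq0 n)) rs0//.
- apply: I4P; rewrite /mk4 /=; try exact: cvL_cst.
    by rewrite L0E; exact: cvL_lin.
  by rewrite L30 L0E; exact: cvL_lin.
- apply: I4P; rewrite /mk4 /=; try exact: cvP_cst.
  exists m, p3, b, c; split=> //.
  + by move=> n; split=> //; case: (P3n n).
  + by apply: cvV_small; [exact: cvV_cst|exact: smallT].
  + by apply: cvV_small; [exact: cvV_cst|exact: smallMTc].
Qed.

(** When [L 1] and [L 3] differ from [L 0 = L 2], the planes [P 0] and [P 1] are turned together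
    about this line in the direction of the core, carrying [L 1] with them. The moved [L 1] is no
    longer orthogonal to [a], hence is opposite to [L 3]. *)
Lemma inS_plane_star_opp L P : cfg L P -> P 1 = P 0 -> P 2 = P 0 -> P 3 = P 0 -> L 2 = L 0 -> inS L P.
Proof.
move=> cLP P10 P20 P30 L20.
have [L10|L10] := pselect (L 1 = L 0).
  by apply: inS_collapsed_planes => //; rewrite L20 L10.
have [L30|L30] := pselect (L 3 = L 0).
  by apply: inS_rotI; apply: inS_collapsed_planes; rewrite /= ?I4_succE ?P10 ?P20 ?P30 ?L20 ?L30//; exact: cfg_rot.
have := cLP; rewrite cfg4 => -[[l0 l1 l2 l3] [q0 q1 q2 q3] [s00 s11 s22 s33] [s10 s21 s32 s03]].
have [b b0 L0E] := isoL_gen l0; have Lb : L 0 b by rewrite L0E; exact: ln_id.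
have [a a0 L1E] := isoL_gen l1; have La : L 1 a by rewrite L1E; exact: ln_id.
have fab : free2 a b := free2_lines l1 l0 La Lb a0 b0 L10.
have [iab P0E [y [z [w [H C ww]]]]] := isoP_frame q0 (s10 _ La) (s00 _ Lb) fab.
have [c c0 L3E] := isoL_gen l3; have Lc : L 3 c by rewrite L3E; exact: ln_id.
have P0c : P 0 c by rewrite -P20; exact: s32.
have [s [r cE]] := isoP_lin q0 (s00 _ Lb) fab (s10 _ La) P0c.
have s0' : s != 0.
  apply/eqP => s0'; apply: (isoL_neq l3 l0 Lc c0 L30).
  by rewrite L0E; apply/lnP; exists r; rewrite cE s0' rs0 add0r.
have iP n := isob_isoP (pert_isob n H C).
have L2E : L 2 = ln b by rewrite L20.
apply: (inS_vary (Ln := fun n => mk4 (L 0) (ln (pert a w y n)) (L 2) (L 3))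
   (Pn := fun n => mk4 (pl b (pert a w y n)) (pl b (pert a w y n)) (P 2) (P 3))) => //.
- move=> n; apply: inS_rotI; apply: inS_opposite_lines.
    apply: cfg_rot; apply/cfg4; rewrite /mk4 /=; split; split=> //.
    + by apply: (isoP_isoL (iP n)); [exact: pl_r|exact: (isob_neq0 (isobC (pert_isob n H C)))].
    + by rewrite L0E; apply: isoP_ln => //; exact: pl_l.
    + by apply: isoP_ln => //; exact: pl_r.
    + by apply: isoP_ln => //; exact: pl_r.
    + by rewrite L2E; apply: isoP_ln => //; exact: pl_l.
  exists (pert a w y n), c; rewrite /mk4 /=; split => //; first exact: ln_id.
  have hb : phi (pert a w y n) b = 0 by apply: phi_eq0C; case: (pert_isob n H C).
  rewrite cE phiDr !phiZr hb mul0r addr0.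
  apply/eqP => h; have h2 : phi (pert a w y n) a = 0.
    by apply: (mulIr (K_unit s0')); rewrite mul0r.
  by move: (pert_phi n H C ww); rewrite (phi_eq0C h2) eqxx.
- apply: I4P; rewrite /mk4 /=; try exact: cvL_cst.
  rewrite L1E; exists (pert a w y), a; split=> //; last exact: pert_cvg.
  by move=> n; split=> //; exact: (isob_neq0 (isobC (pert_isob n H C))).
- apply: I4P; rewrite /mk4 /=; try exact: cvP_cst.
    by rewrite P0E; exact: (pert_cvP H C).
  by rewrite P10 P0E; exact: (pert_cvP H C).
Qed.

(** * Reduction to stars with a common line or a common plane *)

Lemma inS_shift k L P : inS (fun i => L (i + k)) (fun i => P (i + k)) -> inS L P.
Proof.
have E1 (A : Type) (X : 'I_4 -> A) : (fun i => X (i + 0)) = X.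
  by apply/funext => i; rewrite addr0.
have E2 (A : Type) (X : 'I_4 -> A) : (fun i => X (i + 2)) = fun i => X (i + 1 + 1).
  by apply/funext => i; rewrite -addrA I4_succE.
have E3 (A : Type) (X : 'I_4 -> A) : (fun i => X (i + 3)) = fun i => X (i + 1 + 1 + 1).
  by apply/funext => i; rewrite -!addrA !I4_succE [1 + 2](_ : _ = 3)//; exact: val_inj.
elim/I4P : k.
- by rewrite !E1.
- exact: inS_rotI.
- by rewrite !E2 => h; do 2!apply: inS_rotI.
- by rewrite !E3 => h; do 3!apply: inS_rotI.
Qed.

Lemma cfg_shift k L P : cfg L P -> cfg (fun i => L (i + k)) (fun i => P (i + k)).
Proof. by move=> c i; have := c (i + k); rewrite addrAC. Qed.

Lemma I4_shiftE (i : 'I_4) : ((3 + (i + 1))%R = i) * ((0 + (i + 1))%R = (i + 1)%R) * ((1 + (i + 3))%R = i) *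
   ((2 + (i + 3))%R = (i + 1)%R) * ((0 + i)%R = i) * ((2 + i)%R = (i + 2)%R).
Proof. by elim/I4P : i; do !split; exact: val_inj. Qed.

(** Distinct consecutive lines span [Q], so a plane other than [Q] forces its two lines to coincide.
    If [P 3] also differed from [Q], the vector [x] would be orthogonal to lines spanning [Q], hence
    in [Q], hence on both [L 1] and [L 3], and all lines would be equal. What remains is a collapsed
    configuration up to rotation. *)
Lemma inS_common_plane L P Q : cfg L P -> isoP Q -> (forall i, L i `<=` Q) ->
  ~ (L 1 = L 0 /\ L 2 = L 0 /\ L 3 = L 0) -> P 1 <> Q ->
  (exists x, [/\ P 1 x, P 3 x & x != 0]) -> inS L P.
Proof.
move=> cLP iQ LQ nall P1Q [x [P1x P3x x0]].
have PQ i : L i <> L (i + 1) -> P i = Q.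
  move=> LL; have [iL iP t1 t2] := cLP i; have [iL' _ _ _] := cLP (i + 1).
  have [a a0 E] := isoL_gen iL; have [b b0 E'] := isoL_gen iL'.
  have La : L i a by rewrite E; exact: ln_id.
  have Lb : L (i + 1) b by rewrite E'; exact: ln_id.
  have f := free2_lines iL iL' La Lb a0 b0 LL.
  by rewrite (isoP_eq iP (t1 _ La) (t2 _ Lb) f) (isoP_eq iQ (LQ _ _ La) (LQ _ _ Lb) f).
have LL i : P i <> Q -> L i = L (i + 1).
  by move=> PiQ; apply: contrapT => /PQ.
have := cLP; rewrite cfg4 => -[[l0 l1 l2 l3] [q0 q1 q2 q3] [s00 s11 s22 s33] [s10 s21 s32 s03]].
have L12 : L 1 = L 2 by rewrite (LL _ P1Q) I4_succE.
have P3Q : P 3 = Q.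
  apply: contrapT => P3Q; have L30 : L 3 = L 0 by rewrite (LL _ P3Q) I4_succE.
  have L31 : L 3 <> L 1.
    by move=> E; apply: nall; rewrite -L12 -L30 E.
  have [c c0 L3E] := isoL_gen l3; have Lc : L 3 c by rewrite L3E; exact: ln_id.
  have [b b0 L1E] := isoL_gen l1; have Lb : L 1 b by rewrite L1E; exact: ln_id.
  have fcb := free2_lines l3 l1 Lc Lb c0 b0 L31.
  have xx : phi x x = 0 by exact: (isoP_iso q1).
  have Qx : Q x.
    rewrite (isoP_eq iQ (LQ _ _ Lc) (LQ _ _ Lb) fcb); apply: (isoP_perp iQ) => //.
    - exact: LQ Lc.
    - exact: LQ Lb.
    - by apply: (isoP_iso q3) => //; exact: s33.
    - by apply: (isoP_iso q1) => //; exact: s11.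
  have bx : ln b x.
    apply: contrapT => nbx; apply: P1Q; have f : free2 b x by apply/free2P.
    by rewrite (isoP_eq q1 (s11 _ Lb) P1x f) (isoP_eq iQ (LQ _ _ Lb) Qx f).
  have cx : ln c x.
    apply: contrapT => ncx; apply: P3Q; have f : free2 c x by apply/free2P.
    by rewrite (isoP_eq q3 (s33 _ Lc) P3x f) (isoP_eq iQ (LQ _ _ Lc) Qx f).
  by apply: L31; rewrite (isoL_eq l3 _ x0) ?L3E// (isoL_eq l1 _ x0)// L1E.
have [P0Q|P0Q] := pselect (P 0 = Q); have [P2Q|P2Q] := pselect (P 2 = Q).
- by apply: inS_collapsed_planes => //; rewrite ?P2Q ?P3Q.
- have L23 : L 2 = L 3 by rewrite (LL _ P2Q) I4_succE.
  by apply: inS_collapsed_lines => //; rewrite ?P3Q ?P0Q -?L23 ?L12.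
- have L01 : L 0 = L 1 by rewrite (LL _ P0Q) I4_succE.
  have e33 : (3 + 3)%R = 2 :> 'I_4 by exact: val_inj.
  have e23 : (2 + 3)%R = 1 :> 'I_4 by exact: val_inj.
  have e13 : (1 + 3)%R = 0 :> 'I_4 by exact: val_inj.
  apply: (@inS_shift 3); apply: inS_collapsed_lines => /=; first exact: cfg_shift.
  + by rewrite add0r e33 P2Q P3Q.
  + by rewrite e23 e13 L01.
  + by rewrite e33 e13 -L12 L01.
- exfalso; apply: nall; have L01 : L 0 = L 1 by rewrite (LL _ P0Q) I4_succE.
  have L23 : L 2 = L 3 by rewrite (LL _ P2Q) I4_succE.
  by rewrite L01 -L23 -L12.
Qed.

(** Outside the closure [L i] is never opposite to [L (i + 2)], so all lines are mutually
    orthogonal: they are equal, or they lie in one totally isotropic plane. The preceding lemmas,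
    applied after a rotation, rule out every further coincidence. *)
Lemma classification L P : cfg L P ->
  [\/ inS L P, (forall i, L i = L 0) /\ injective P | (forall i, P i = P 0) /\ injective L].
Proof.
move=> cLP; have [|nin] := pselect (inS L P); first by move=> h; apply: Or31.
have no i u w : L i u -> L (i + 2) w -> phi u w = 0.
  move=> Lu Lw; apply: contrapT => /eqP uw; apply: nin; apply: (@inS_shift i).
  by apply: inS_opposite_lines; [exact: cfg_shift|exists u, w; rewrite !I4_shiftE].
have orth i j u w : L i u -> L j w -> phi u w = 0.
  have [iL iP t1 t2] := cLP i; have [iL' iP' t1' t2'] := cLP j.
  have: [\/ j = i, j = i + 1, i = j + 1 | j = i + 2].
    elim/I4P : i {iL iP t1 t2}; elim/I4P : j {iL' iP' t1' t2'}; (try (by apply: Or41; exact: val_inj));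
    (try (by apply: Or42; exact: val_inj)); (try (by apply: Or43; exact: val_inj));
    by apply: Or44; exact: val_inj.
  case=> E Lu Lw.
  - by rewrite E in Lw; exact: (isoL_iso iL).
  - by apply: (isoP_iso iP); [exact: t1|apply: t2; rewrite -E].
  - by apply: (isoP_iso iP'); [apply: t2'; rewrite -E|exact: t1'].
  - by apply: (no i); rewrite -?E.
have [[L10 [L20 L30]]|nall] := pselect (L 1 = L 0 /\ L 2 = L 0 /\ L 3 = L 0).
  have all : forall i, L i = L 0 by apply: I4P.
  apply: Or32; split=> //; apply: I4_inj => i Pi; apply: nin.
    apply: (@inS_shift (i + 1)); apply: inS_collapsed_lines => /=; rewrite ?I4_shiftE //; first exact: cfg_shift.
    - by rewrite all [RHS]all.
    - by rewrite all [RHS]all.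
  apply: (@inS_shift i); apply: inS_line_star_opp => /=; rewrite ?I4_shiftE //; first exact: cfg_shift.
  - by rewrite all [RHS]all.
  - by rewrite all [RHS]all.
  - by rewrite all [RHS]all.
have [i [j Lij]] : exists i j, L i <> L j.
  apply: contrapT => h; apply: nall.
  by do !split; apply: contrapT => h'; apply: h; [exists 1, 0|exists 2, 0|exists 3, 0].
have iL k : isoL (L k) by case: (cLP k).
have [a a0 LiE] := isoL_gen (iL i); have [b b0 LjE] := isoL_gen (iL j).
have La : L i a by rewrite LiE; exact: ln_id.
have Lb : L j b by rewrite LjE; exact: ln_id.
have fab := free2_lines (iL i) (iL j) La Lb a0 b0 Lij.
have iab : isob a b by split=> //; [exact: (orth i i)|exact: (orth j j)|exact: (orth i j)].
have iQ := isob_isoP iab.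
have LQ k : L k `<=` pl a b.
  move=> x Lx; have [_ aa bb ab] := iab; apply: isotropic_perp_plane => //.
  - exact: (orth k k).
  - exact: (orth i k).
  - exact: (orth j k).
have [allP|/existsNP[k Pk]] := pselect (forall k, P k = pl a b).
  apply: Or33; split=> [k|]; first by rewrite !allP.
  apply: I4_inj => k Lk; apply: nin.
    apply: (@inS_shift (k + 3)); apply: inS_collapsed_planes => /=; rewrite ?I4_shiftE //; first exact: cfg_shift.
    - by rewrite !allP.
    - by rewrite !allP.
  apply: (@inS_shift k); apply: inS_plane_star_opp => /=; rewrite ?I4_shiftE //; first exact: cfg_shift.
  - by rewrite !allP.
  - by rewrite !allP.
  - by rewrite !allP.
exfalso; apply: (nin); apply: (@inS_shift (k + 3)); apply: (inS_common_plane (Q := pl a b)) => //=.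
- exact: cfg_shift.
- move=> [h1 [h2 h3]]; apply: Lij.
  have E m : L m = L (0 + (k + 3)).
    have H : forall q, L (q + (k + 3)) = L (0 + (k + 3)) by apply: I4P.
    by have := H (m - (k + 3)); rewrite subrK.
  by rewrite E [RHS]E.
- by rewrite I4_shiftE.
- apply: contrapT => h; apply: nin; apply: (@inS_shift k); apply: inS_opposite_planes; first exact: cfg_shift.
  move=> x; rewrite !I4_shiftE => Px Px'; apply: contrapT => /eqP x0; apply: h; exists x.
  rewrite I4_shiftE (_ : 3 + (k + 3) = k + 2)//.
  by elim/I4P : k {Pk Px Px'}; exact: val_inj.
Qed.

Hypothesis F_local : local_field v.
Hypothesis sigma_cont : sigma_continuous v sigma.
Hypothesis sigma_scal : forall a : F, exists b : F, sigma a%:A = b%:A.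
Let phi_cvg_eq := phi_cvg_eq sigma_invol sigma_cont sigma_scal phi_herm.
Let phi_cvg_neq0 := phi_cvg_neq0 sigma_invol sigma_cont sigma_scal phi_herm.

(** * Line-type quadripods *)

Lemma msp_inj f g L P : msp f L P -> msp g L P -> f = g.
Proof.
move=> fs gs; case: f g fs gs => [ml mp mi] [ml' mp' mi'] fs gs.
have E1 : ml = ml'.
  apply/funext => i; apply: val_inj; apply: val_inj.
  by have [/= fi _] := fs i; have [/= gi _] := gs i; exact: (etrans fi (esym gi)).
have E2 : mp = mp'.
  apply/funext => i; apply: val_inj; apply: val_inj.
  by have [/= _ fi] := fs i; have [/= _ gi] := gs i; exact: (etrans fi (esym gi)).
by clear fs gs; move: mi mi'; rewrite E1 E2 => mi mi'; congr Morphism; exact: Prop_irrelevance.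
Qed.

Lemma inSP f L P : msp f L P -> closure (Mor_inj v phi e) f <-> inS L P.
Proof.
move=> fLP; split=> [cf|[g cg gLP]]; first by exists f.
by rewrite (msp_inj fLP gLP).
Qed.

Lemma msp_id (f : Mor v phi e) :
  msp f (fun i => line_space (mline f i)) (fun i => plane_space (mplane f i)).
Proof. by []. Qed.

(** A vector [d'] orthogonal to [b] and [d] lies in their plane. Used in the contrapositive:
    distinct planes through [b] have nonorthogonal representatives. *)
Lemma star_orth P P' b d d' : isoP P -> isoP P' -> P b -> P' b -> P d -> P' d' ->
  free2 b d -> free2 b d' -> phi d d' = 0 -> P = P'.
Proof.
move=> iP iP' Pb P'b Pd P'd' f f' dd'.
rewrite (isoP_eq iP' P'b P'd' f'); apply: isoP_eq => //.
rewrite (isoP_eq iP Pb Pd f); apply: (isoP_perp iP) => //; exact: (isoP_iso iP').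
Qed.

(** Symmetry without the bound on the dimension, which [dim_star] deduces from the vanishing sum. *)
Definition symV (L P : 'I_4 -> set V) :=
  exists d : 'I_4 -> V, [/\ forall i, (P i `\` L 0) (d i),
    d 0 + d 1 + d 2 + d 3 = 0 & phi (d 1) (d 2) = phi (d 0) (d 3)].

Lemma sum4_zero (d0 d1 d2 d3 : V) : d0 + d1 + d2 + d3 = 0 -> d2 = - (d0 + d1 + d3).
Proof. by move=> /eqP; rewrite addrAC addr_eq0 => /eqP ->; rewrite opprK. Qed.

(* The approximating lines are <b>, <b + d0 t>, <b + (d0 + d1) t - y A t^2> and
   <b - d3 t>, where A = phi d0 d1. *)
Lemma symV_inS L P : cfg L P -> (forall i, L i = L 0) -> injective P -> symV L P -> inS L P.
Proof.
move=> cLP LL Pinj [d' [Pd' sum' rel']].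
have := cLP; rewrite cfg4 => -[[l0 l1 l2 l3] [q0 q1 q2 q3] [s00 s11 s22 s33] [s10 s21 s32 s03]].
have [b b0 L0E] := isoL_gen l0; have Lb : L 0 b by rewrite L0E; exact: ln_id.
have iP i : isoP (P i) by case: (cLP i).
have Pb i : P i b by case: (cLP i) => _ _ + _; apply; rewrite LL.
have [y [yy by1]] : exists y, phi y y = 0 /\ phi b y = 1.
  have [a Pa fab] := isoP_other q0 (Pb 0) b0.
  have [_ _ [y [z [w [H C ww]]]]] := isoP_frame q0 Pa (Pb 0) fab.
  by exists z; split; [exact: hzz H|exact: hbz H].
have yb : phi y b = 1 by rewrite phiC by1 s1.
have bd' i : phi b (d' i) = 0 by apply: (isoP_iso (iP i)); [|case: (Pd' i)].
have bb : phi b b = 0 by apply: (isoP_iso q0).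
(* Multiples of [b] do not affect the products of the [d' i], all orthogonal to [b]; removing them
   makes the [d i] orthogonal to [y] as well. *)
pose d i := d' i - rscale b (phi y (d' i)).
have Pd i : P i (d i) by apply: isoPB => //; case: (Pd' i).
have yd i : phi y (d i) = 0 by rewrite /d !phiE yb !zero_oneE subrr.
have bd i : phi b (d i) = 0 by rewrite /d !phiE bb bd' !zero_oneE.
have db i : phi (d i) b = 0 by apply: phi_eq0C.
have dy i : phi (d i) y = 0 by apply: phi_eq0C.
have dd i j : phi (d i) (d j) = phi (d' i) (d' j).
  by rewrite /d !phiE bb bd' (phi_eq0C (bd' i)) !zero_oneE.
have sum : d 0 + d 1 + d 2 + d 3 = 0.
  have E : phi y (d' 0) + phi y (d' 1) + phi y (d' 2) + phi y (d' 3) = 0.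
    by rewrite -!phiDr sum' !phiE.
  transitivity (d' 0 + d' 1 + d' 2 + d' 3 -
     rscale b (phi y (d' 0) + phi y (d' 1) + phi y (d' 2) + phi y (d' 3))).
    by rewrite /d !rsDr !opprD !addrA; do ![congr (_ - _); rewrite ?[_ - _ + d' _]addrAC].
  by rewrite sum' E rs0 subrr.
have d0 i : d i != 0.
  apply/eqP => di0; case: (Pd' i) => _; apply; rewrite L0E; apply/lnP.
  by exists (phi y (d' i)); apply/eqP; rewrite -subr_eq0; apply/eqP.
have fbd i : free2 b (d i).
  by apply/free2P; split=> // /lnP[x E]; have := yd i; rewrite E !phiE yb !zero_oneE => x0;
     move: (d0 i); rewrite E x0 rs0 eqxx.
have rel : phi (d 1) (d 2) = phi (d 0) (d 3) by rewrite !dd.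
have iso i : phi (d i) (d i) = 0 by exact: (isoP_iso (iP i)).
clearbody d => {d' Pd' sum' rel' bd' dd}.
have neq i j : i != j -> phi (d i) (d j) != 0.
  move=> /eqP ij; apply/eqP => h; apply: ij; apply: Pinj.
  exact: (star_orth (iP i) (iP j) (Pb i) (Pb j) (Pd i) (Pd j)).
have d2E := sum4_zero sum.
set A := phi (d 0) (d 1); set B := phi (d 0) (d 3).
have g10 : phi (d 1) (d 0) = sigma A by rewrite phiC.
have g02 : phi (d 0) (d 2) = - (A + B) by rewrite d2E !phiE iso !zero_oneE.
have g12 : phi (d 1) (d 2) = B by rewrite rel.
have g13 : phi (d 1) (d 3) = - (sigma A + B).
  by move: g12; rewrite d2E !phiE iso g10 !zero_oneE => <-; rewrite opprD opprK addKr.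
have A0 : A != 0 by apply: neq. have B0 : B != 0 by apply: neq.
pose u1 n := b + rscale (d 0) (T n).
pose p1 n := d 1 + rscale y (- A * T n).
pose p2 n := d 2 + rscale y (A * T n).
pose u3 n := b + rscale (d 3) (- 1 * T n).
pose u2 n := u1 n + rscale (p1 n) (T n).
have GE := (iso, yd, bd, db, dy, bb, yy, by1, yb, (g10, g02, g12, g13),
  (erefl A : phi (d 0) (d 1) = A), (erefl B : phi (d 0) (d 3) = B)).
have iu1 n : phi (u1 n) (u1 n) = 0 by rewrite /u1 ?phiE ?GE ?zero_oneE.
have ip1 n : phi (p1 n) (p1 n) = 0 by rewrite /p1 ?phiE ?GE ?zero_oneE.
have up1 n : phi (u1 n) (p1 n) = 0.
  by rewrite /u1 /p1 ?phiE ?GE ?zero_oneE sT TC -mulrDl ?addNr ?addrN mul0r.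
have i1 n : isob (u1 n) (p1 n).
  split=> //; apply: free2C.
  by apply: (@free2_test _ _ y (d 0)); rewrite /u1 /p1 ?phiE ?GE ?zero_oneE ?oner_neq0.
have iu2 n : phi (u2 n) (u2 n) = 0.
  by apply: (tiso_pl (iu1 n) (ip1 n) (up1 n)); apply/plP; exists 1, (T n); rewrite rs1.
have ip2 n : phi (p2 n) (p2 n) = 0 by rewrite /p2 ?phiE ?GE ?zero_oneE.
have up2 n : phi (u2 n) (p2 n) = 0.
  rewrite /u2 /u1 /p1 /p2 ?phiE ?GE ?zero_oneE sT !TC -!mulrDl.
  by rewrite -addrA [B + A]addrC addNr mul0r.
have i2 n : isob (u2 n) (p2 n).
  split=> //; apply: free2C.
  by apply: (@free2_test _ _ y (d 1)); rewrite /u2 /u1 /p1 /p2 ?phiE ?GE ?zero_oneE ?oner_neq0.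
(* The path closes up because the [d i] have sum zero and the corrections of [p1] and [p2] along [y]
   cancel. *)
have u3E n : u3 n = u2 n + rscale (p2 n) (T n).
  have -> : u3 n = b + rscale (d 0 + d 1 + d 2) (T n).
    by move/eqP: sum; rewrite addr_eq0 => /eqP ->; rewrite /u3 mulN1r rsNl rsN.
  rewrite /u2 /u1 /p1 /p2 !rsDl !rsA mulNr mulNr rsN.
  by rewrite -!addrA; congr (_ + (_ + (_ + _))); rewrite addrCA addNr addr0.
have i3 n : isob (u3 n) (d 3).
  split; try by rewrite /u3 ?phiE ?GE ?zero_oneE.
  apply: free2C.
  by apply: (@free2_test _ _ y (d 0)); rewrite /u3 ?phiE ?GE ?zero_oneE ?oner_neq0.
have i0 : isob b (d 0) by split.
have PE i : P i = pl b (d i) by apply: isoP_eq.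
have u1cv : cvV v \oo u1 b by apply: cvV_small; [exact: cvV_cst|exact: smallT].
have p1cv : cvV v \oo p1 (d 1) by apply: cvV_small; [exact: cvV_cst|exact: smallMTc].
have p2cv : cvV v \oo p2 (d 2) by apply: cvV_small; [exact: cvV_cst|exact: smallMTc].
have u3cv : cvV v \oo u3 b by apply: cvV_small; [exact: cvV_cst|exact: smallMTc].
have u2cv : cvV v \oo u2 b.
  have h : cvV v \oo (fun n => b + rscale (d 0) (T n) + rscale (d 1) (T n) + rscale y (- A * T n * T n)) b.
    by apply: cvV_small; [apply: cvV_small; [|exact: smallT]|exact: smallMTT].
  by move=> l ll; have := h l ll; apply: cvF_ext => n; rewrite /u2 /u1 /p1 /= rsDl rsA addrA.
apply: (inS_lim (u := fun=> b) (p := d) (un := fun n => mk4 b (u1 n) (u2 n) (u3 n))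
   (pn := fun n => mk4 (d 0) (p1 n) (p2 n) (d 3))) => //.
- by move=> i; rewrite LL.
- by move=> n; apply: I4P; [exact: fbd|case: (i1 n)|case: (i2 n)|case: (i3 n)].
- move=> n; apply: inS_inj.
  + apply: vconf_cfg; apply: vconf4; apply: conf1P; rewrite /mk4 /=.
    * exact: i0.
    * by apply/plP; exists 1, (T n); rewrite rs1.
    * exact: i1.
    * by apply/plP; exists 1, (T n); rewrite rs1.
    * exact: i2.
    * by apply/plP; exists 1, (T n); rewrite rs1 u3E.
    * exact: i3.
    * by apply/plP; exists 1, (T n); rewrite rs1 /u3 mulN1r rsN subrK.
  + exists b, (u2 n); split; [exact: ln_id|exact: ln_id|].
    by rewrite /u2 /u1 /p1 ?phiE ?GE ?zero_oneE !MT_eq0 oppr_eq0.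
  + exists (u1 n), (u3 n); split; [exact: ln_id|exact: ln_id|].
    by rewrite /u1 /u3 ?phiE ?GE ?zero_oneE sT mulN1r !mulrN oppr_eq0 TC !MT_eq0.
- by apply: I4P; rewrite /mk4 /=; [exact: cvV_cst| | |].
- by apply: I4P; rewrite /mk4 /=; [exact: cvV_cst| | |exact: cvV_cst].
Qed.

Lemma cvV_unique (U : set_system nat) (x : nat -> V) a b : ProperFilter U ->
  cvV v U x a -> cvV v U x b -> a = b.
Proof.
move=> PU ca cb; rewrite (Vcoord_sum a) (Vcoord_sum b); apply: eq_bigr => i _.
congr (rscale _ _%:A); apply: (cvF_unique (U := U) (v := v)).
  by apply: ca; exact: Vcoord_form.
by apply: cb; exact: Vcoord_form.
Qed.

Lemma cvVD (U : set_system nat) (x x' : nat -> V) a b : Filter U ->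
  cvV v U x a -> cvV v U x' b -> cvV v U (fun n => x n + x' n) (a + b).
Proof.
move=> FU ca cb l ll; rewrite (FformD _ _ ll).
apply: (cvF_ext (x := fun n => l (x n) + l (x' n))).
  by move=> n; rewrite /= (FformD _ _ ll).
by apply: cvFD; [exact: ca|exact: cb].
Qed.

Lemma cvV_mono (U W : set_system nat) (x : nat -> V) a : W `<=` U -> cvV v W x a -> cvV v U x a.
Proof. by move=> WU ca l ll; apply: (cvF_nmono WU); exact: ca. Qed.

Lemma cvV_eq (U : set_system nat) (x x' : nat -> V) a : Filter U ->
  (forall n, x n = x' n) -> cvV v U x a -> cvV v U x' a.
Proof. by move=> FU xx ca l ll; apply: cvF_ext (ca l ll) => n; rewrite /= xx. Qed.

(* Divide the n-th vectors by their largest coordinate and take limits along an ultrafilter. *)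
Lemma normalized_ultralimit (U : set_system nat) (x : nat -> 'I_4 -> V) : UltraFilter U ->
  U [set n | exists i, x n i != 0] ->
  exists (c : nat -> F) (D : 'I_4 -> V),
    (forall i, cvV v U (fun n => rscale (x n i) (c n)%:A) (D i)) /\ exists i, D i != 0.
Proof.
move=> UU Ux.
pose I : finType := ('I_4 * ('I_(dim V) * 'I_(\dim {:K})))%type.
have dK : (0 < \dim {:K})%N.
  by rewrite lt0n dimv_eq0; apply/eqP => K0; have := memvf (1 : K); rewrite K0 memv0 oner_eq0.
(* The maximum requires a point of the index set, which exists because [V] and [K] are nonzero. *)
pose k0 : I := (0, (Ordinal (leq_trans (isT : (0 < 5)%N) V_dim), Ordinal dK)).
pose co n (k : I) : F := Vcoord k.2 (x n k.1).
have /choice[km kmP] : forall n, exists k : I, forall k', v (co n k') <= v (co n k).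
  move=> n; exists [arg max_(k > k0) v (co n k)]%O.
  by case: arg_maxP => // k _ h k'; exact: h.
pose c n := (co n (km n))^-1.
have vc n k : co n (km n) != 0 -> v (c n * co n k) <= 1.
  by move=> k1; rewrite absvM absvV mulrC ler_pdivrMr ?absv_gt0// mul1r.
have Uc : U [set n | co n (km n) != 0].
  apply: filterS Ux => n /= [i xi]; apply: contraNneq xi => k1.
  rewrite (Vcoord_sum (x n i)) big1// => k _.
  have := kmP n (i, k); rewrite k1 absv0 => vle.
  have : v (co n (i, k)) = 0 by apply/eqP; rewrite eq_le vle absv_ge0.
  by move=> /absv_eq0; rewrite /co /= => ->; rewrite scale0r rs0.
have /choice[lim limP] : forall k : I, exists r : F, cvF v U (fun n => c n * co n k) r.
  move=> k; apply: (@bounded_ultralimit _ _ _ F_local _ _ UU _ 1).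
  by apply: filterS Uc => n /=; exact: vc.
pose D i := \sum_k rscale (Vbase k) (lim (i, k))%:A.
have coZ n i k : Vcoord k (rscale (x n i) (c n)%:A) = c n * co n (i, k).
  by rewrite (FformZ _ _ (Vcoord_form k)).
have cD i : cvV v U (fun n => rscale (x n i) (c n)%:A) (D i).
  move=> l ll; rewrite /D (Fform_sum _ _ _ ll).
  apply: (cvF_ext (x := fun n => \sum_k c n * co n (i, k) * l (Vbase k))).
    move=> n /=; rewrite [in RHS](Vcoord_sum (rscale _ _)) (Fform_sum _ _ _ ll).
    by apply: eq_bigr => k _; rewrite (FformZ _ _ ll) coZ.
  apply: cvF_sum => k _; rewrite (FformZ _ _ ll); apply: cvFM; [exact: limP|exact: cvF_cst].
exists c, D; split=> //.
(* If all limits vanished, every rescaled coordinate would have absolute value below 1 at some [n],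
   whereas the largest one equals 1 there. *)
apply: contrapT => /forallNP D0.
have {}D0 i : D i = 0 by apply/eqP; have /negP := D0 i; rewrite negbK.
have small (k : I) : U [set n | v (c n * co n k) < 1].
  have := cD k.1 _ (Vcoord_form k.2) 1 ltr01; rewrite D0 (Fform0 (Vcoord_form k.2)).
  by apply: filterS => n /=; rewrite subr0 coZ; case: k.
have Uall : U [set n | forall k : I, v (c n * co n k) < 1].
  exact: (@filter_forall _ I (fun k n => v (c n * co n k) < 1) U).
have [n [/= h1 h2]] := filter_ex (filterI Uall Uc).
by have := h1 (km n); rewrite /c mulVf// absv1 ltxx.
Qed.

Lemma cvV_cst_filter (U : set_system nat) u : Filter U -> cvV v U (fun=> u) u.
Proof. by move=> FU l ll; exact: cvF_cst. Qed.

(** What injectivity of the approximants means for spanning vectors. The first and third vectors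
    cannot be orthogonal: the first three would then be mutually orthogonal, and the planes 0 and 1
    would coincide. *)
Lemma inS_seq L P (u : 'I_4 -> V) (p : 'I_4 -> V) :
  (forall i, L i = ln (u i)) -> (forall i, P i = pl (u i) (p i)) ->
  (forall i, free2 (u i) (p i)) -> inS L P ->
  exists un an bn : nat -> 'I_4 -> V,
  [/\ forall n i, phi (un n i) (un n (i + 1)) = 0 /\ phi (un n i) (un n i) = 0,
    forall n i j, i != j -> ln (un n i) <> ln (un n j),
    forall n i, [/\ phi (an n i) (un n i) = 0, phi (an n i) (un n (i + 1)) = 0,
      phi (bn n i) (un n i) = 0 & phi (bn n i) (un n (i + 1)) = 0],
    forall n i, un n i != 0 /\ phi (un n 0) (un n 2) != 0 &
    forall i, [/\ cvV v \oo (un^~ i) (u i), cvV v \oo (an^~ i) (u i) & cvV v \oo (bn^~ i) (p i)]].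
Proof.
move=> LE PE fup [f cf fLP].
have u0 i : u i != 0 by case: ((free2P _ _).1 (fup i)).
have [|||g [un [an [bn [gS gl gp cu [ca cb]]]]]] :=
  @closure_ex _ _ v _ _ phi e K_unit e_free (Mor_inj v phi e) f u u p.
- by move=> i; have [-> _] := fLP i; rewrite LE.
- by move=> i; have [_ ->] := fLP i; rewrite PE.
- exact: cf.
have gc n : cfg (fun i => ln (un n i)) (fun i => pl (an n i) (bn n i)).
  apply: (@msp_cfg (g n)) => i; split; first by case: (gl n i).
  by case: (gp n i).
have mem n i : pl (an n i) (bn n i) (un n i) /\ pl (an n i) (bn n i) (un n (i + 1)).
  by have [_ _ h1 h2] := gc n i; split; [apply: h1|apply: h2]; exact: ln_id.
have iP n i : isoP (pl (an n i) (bn n i)) by case: (gc n i).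
have neq n i j : i != j -> ln (un n i) <> ln (un n j).
  move=> /eqP ij E; apply: ij; case: (gS n) => inj _; apply: inj.
  apply: val_inj; apply: val_inj; have [_ E1] := gl n i; have [_ E2] := gl n j.
  by apply: (etrans E1); rewrite E; exact: esym E2.
exists un, an, bn; split.
- move=> n i; have [m1 m2] := mem n i.
  by split; exact: (isoP_iso (iP n i)).
- exact: neq.
- move=> n i; have [m1 m2] := mem n i.
  by split; apply: (isoP_iso (iP n i)) => //; first [exact: pl_l|exact: pl_r].
- move=> n i; split; first by case: (gl n i).
  apply/eqP => h; case: (gS n) => _ /(_ 0 1) inj; suff /inj : mplane (g n) 0 = mplane (g n) 1 by [].
  apply: val_inj; apply: val_inj; have [_ E0] := gp n 0; have [_ E1] := gp n 1.
  apply: (etrans E0); apply: (etrans _ (esym E1)).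
  have [[m00 m01] [m11 m12]] := (mem n 0, mem n 1); rewrite !I4_succE in m01 m12.
  have f01 : free2 (un n 0) (un n 1).
    apply: (free2_lines (L := ln (un n 0)) (M := ln (un n 1))); try exact: ln_id.
    - by case: (gc n 0).
    - by case: (gc n 1).
    - by case: (gl n 0).
    - by case: (gl n 1).
    - exact: neq.
  have f12 : free2 (un n 1) (un n 2).
    apply: (free2_lines (L := ln (un n 1)) (M := ln (un n 2))); try exact: ln_id.
    - by case: (gc n 1).
    - by case: (gc n 2).
    - by case: (gl n 1).
    - by case: (gl n 2).
    - exact: neq.
  rewrite [RHS](isoP_eq (iP n 1) m11 m12 f12); apply: isoP_eq => //.
  rewrite (isoP_eq (iP n 0) m00 m01 f01); apply: (isoP_perp (iP n 0)) => //.
  - exact: (isoP_iso (iP n 1)).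
  - exact: (isoP_iso (iP n 1)).
- by move=> i; split.
Qed.

(** The vanishing sum expresses [d 2] through the other three, so that four vectors span
    everything. *)
Lemma dim_star (P : 'I_4 -> set V) b (d : 'I_4 -> V) : (forall i, P i = pl b (d i)) ->
  d 0 + d 1 + d 2 + d 3 = 0 ->
  exists2 k, (k <= 4)%N & has_dim (spanned (\bigcup_i P i)) k.
Proof.
move=> PE sum; pose x : 'I_4 -> V := mk4 b (d 0) (d 1) (d 3).
have [k k4 hk] := fin_dim K_unit x; exists k => //.
suff -> : spanned (\bigcup_i P i) = spanned (range x) by [].
have sS := spanned_subspace (range x); have [_ SD SZ] := sS.
have xS i : spanned (range x) (x i) by apply: sub_spanned; exists i.
apply/seteqP; split; apply: spanned_sub; try exact: spanned_subspace.
  move=> w [i _]; rewrite PE; move: w; apply: pl_sub => //; first exact: (xS 0).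
  move: i; apply: I4P; [exact: (xS 1)|exact: (xS 2)| |exact: (xS 3)].
  rewrite (sum4_zero sum) -[- _]rs1 rsNl -rsN; apply: SZ.
  by apply: (SD); [apply: (SD); [exact: (xS 1)|exact: (xS 2)]|exact: (xS 3)].
move=> _ [i _ <-]; apply: sub_spanned.
have h j : (\bigcup_i P i) (d j) by exists j => //; rewrite PE; exact: pl_r.
move: i; apply: I4P; [|exact: (h 0)|exact: (h 1)|exact: (h 3)].
by exists 0 => //; rewrite PE; exact: pl_l.
Qed.

(* The witnesses are limits of the rescaled differences of consecutive vectors
   spanning the approximating lines, normalised against y. *)
Lemma inS_symS L P : cfg L P -> (forall i, L i = L 0) -> injective P -> inS L P ->
  (exists2 d, (d <= 4)%N & has_dim (spanned (\bigcup_i P i)) d) /\ symV L P.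
Proof.
move=> cLP LL Pinj inn.
have := cLP; rewrite cfg4 => -[[l0 l1 l2 l3] [q0 q1 q2 q3] [s00 s11 s22 s33] [s10 s21 s32 s03]].
have [b b0 L0E] := isoL_gen l0; have Lb : L 0 b by rewrite L0E; exact: ln_id.
have iP i : isoP (P i) by case: (cLP i).
have Pb i : P i b by case: (cLP i) => _ _ + _; apply; rewrite LL.
have [y by1] : exists y, phi y b = 1.
  have [a Pa fab] := isoP_other q0 (Pb 0) b0.
  have [_ _ [y [z [w [H C ww]]]]] := isoP_frame q0 Pa (Pb 0) fab.
  by exists z; exact: hzb H.
have bb : phi b b = 0 by apply: (isoP_iso q0).
have /choice[p pP] : forall i, exists p, P i p /\ free2 b p.
  move=> i; have [p Pp f] := isoP_other (iP i) (Pb i) b0; exists p; split => //; exact: free2C.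
have [|||| un [an [bn [orth neq perp un0 cv]]]] := @inS_seq L P (fun=> b) p.
- by move=> i; rewrite LL.
- by move=> i; case: (pP i) => Pp f; exact: isoP_eq.
- by move=> i; case: (pP i).
- exact: inn.
have un1 n i : un n i != 0 by case: (un0 n i).

have [U [UU ooU]] := ultra_oo.
have PU : ProperFilter U by case: UU.
have cc a : cvV v U (fun=> a) a by exact: cvV_cst_filter.
have cu i := cvV_mono ooU (let: And3 h _ _ := cv i in h).
have ca i := cvV_mono ooU (let: And3 _ h _ := cv i in h).
have cb i := cvV_mono ooU (let: And3 _ _ h := cv i in h).
have Ul : U [set n | forall i, phi y (un n i) != 0].
  apply: (@filter_forall _ 'I_4 (fun i n => phi y (un n i) != 0) U) => i.
  apply: (phi_cvg_neq0 _ (cc y) (cu i)).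
  by rewrite by1 oner_neq0.
(* Normalised to pair to 1 with [y]: the differences [d n i] are then orthogonal to [y], a condition
   that survives in the limit. *)
pose ut n i := rscale (un n i) (phi y (un n i))^-1.
pose d n (i : 'I_4) := ut n (i + 1) - ut n i.
have uto n i : phi (ut n i) (ut n (i + 1)) = 0.
  by rewrite /ut !phiE; case: (orth n i) => -> _; rewrite !zero_oneE.
have uto' n i : phi (ut n (i + 1)) (ut n i) = 0 by apply: phi_eq0C.
have utt n i : phi (ut n i) (ut n i) = 0.
  by rewrite /ut !phiE; case: (orth n i) => _ ->; rewrite !zero_oneE.
have utz n i : phi y (un n i) != 0 -> phi y (ut n i) = 1 by move=> h; rewrite /ut !phiE KVr.
have utl n i : phi y (un n i) != 0 -> ln (un n i) = ln (ut n i).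
  move=> h; apply: isoL_eq; first by apply: isoL_ln => //; case: (orth n i).
    by apply/lnP; exists (phi y (un n i))^-1.
  by apply: contraTneq isT => E; have := utz n i h; rewrite E !phiE => /esym/eqP; rewrite oner_eq0.
have uut n i : phi (un n i) (ut n i) = 0 /\ phi (un n i) (ut n (i + 1)) = 0.
  by rewrite /ut !phiE; case: (orth n i) => -> ->; rewrite !zero_oneE.
have but n i : phi (bn n i) (ut n i) = 0 /\ phi (bn n i) (ut n (i + 1)) = 0.
  by rewrite /ut !phiE; case: (perp n i) => _ _ -> ->; rewrite !zero_oneE.
clearbody ut.
have dsum n : d n 0 + d n 1 + d n 2 + d n 3 = 0.
  have tele w w' w'' : (w - w') + (w'' - w) = w'' - w' by rewrite addrC addrA subrK.
  by rewrite /d !I4_succE !tele subrr.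
have ddd n i : phi (d n i) (d n i) = 0 by rewrite /d !phiE !utt uto uto' !zero_oneE.
have d12 n : phi (d n 1) (d n 2) = phi (d n 0) (d n 3).
  move: (uto n 0) (uto n 1) (uto n 2) (uto n 3) (uto' n 0) (uto' n 1) (uto' n 2) (uto' n 3).
  by rewrite /d !I4_succE !phiE => E0 E1 E2 E3 E4 E5 E6 E7; rewrite ?(E0, E1, E2, E3, E4, E5, E6, E7) ?utt !zero_oneE.
have d01 n : phi (d n 0) (d n 1) = phi (d n 3) (d n 2).
  move: (uto n 0) (uto n 1) (uto n 2) (uto n 3) (uto' n 0) (uto' n 1) (uto' n 2) (uto' n 3).
  by rewrite /d !I4_succE !phiE => E0 E1 E2 E3 E4 E5 E6 E7; rewrite ?(E0, E1, E2, E3, E4, E5, E6, E7) ?utt !zero_oneE.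
have ud n i : phi (un n i) (d n i) = 0.
  by rewrite /d !phiE; case: (uut n i) => -> ->; rewrite !zero_oneE.
have bd n i : phi (bn n i) (d n i) = 0.
  by rewrite /d !phiE; case: (but n i) => -> ->; rewrite !zero_oneE.
have yd n i : (forall i, phi y (un n i) != 0) -> phi y (d n i) = 0.
  by move=> h; rewrite /d !phiE !utz// subrr.
have Ud : U [set n | exists i, d n i != 0].
  apply: filterS Ul => n /= h; apply: contrapT => /forallNP dn0.
  have := neq n 0 1 isT; apply; rewrite !utl//; congr ln.
  by have /negP := dn0 0; rewrite negbK /d I4_succE subr_eq0 => /eqP.
clearbody d.
have [c [D [cD D0]]] := normalized_ultralimit UU Ud.
pose dn n i := rscale (d n i) (c n)%:A.
have ph0 : phi 0 0 = 0 by rewrite !phiE.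
have lim0 (x : nat -> V) x0 i : cvV v U x x0 -> U [set n | phi (x n) (d n i) = 0] -> phi x0 (D i) = 0.
  move=> cx Ux; rewrite -ph0.
  apply: (phi_cvg_eq PU cx (cD i) (cc 0) (cc 0)).
  by apply: filterS Ux => n /= E; rewrite !phiE E mul0r.
have limE i j k l : (forall n, phi (d n i) (d n j) = phi (d n k) (d n l)) -> phi (D i) (D j) = phi (D k) (D l).
  move=> E; apply: (phi_cvg_eq PU (cD i) (cD j) (cD k) (cD l)).
  by apply: filterE => n /=; rewrite !phiE E.
have DD i : phi (D i) (D i) = 0.
  rewrite -ph0; apply: (phi_cvg_eq PU (cD i) (cD i) (cc 0) (cc 0)).
  by apply: filterE => n /=; rewrite !phiE ddd !zero_oneE.
(* Since [phi y b = 1], a nonzero limit [D i] cannot lie in [ln b]. *)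
have yD i : phi y (D i) = 0.
  by apply: (lim0 _ _ _ (cc y)); apply: filterS Ul => n /=; exact: yd.
have bD i : phi b (D i) = 0 by apply: (lim0 _ _ _ (cu i)); apply: filterE => n; exact: ud.
have pD i : phi (p i) (D i) = 0 by apply: (lim0 _ _ _ (cb i)); apply: filterE => n; exact: bd.
have D12 : phi (D 1) (D 2) = phi (D 0) (D 3) by apply: limE.
have D01 : phi (D 0) (D 1) = phi (D 3) (D 2) by apply: limE.
have Dsum : D 0 + D 1 + D 2 + D 3 = 0.
  apply: (cvV_unique PU _ (cc 0)).
  apply: (cvV_eq _ _ (cvVD _ (cvVD _ (cvVD _ (cD 0) (cD 1)) (cD 2)) (cD 3))) => n /=.
  by rewrite -!rsDl dsum rs0l.
(* The limit is isotropic and orthogonal to [b] and [p i], which span [P i]. *)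
have PD i : P i (D i).
  case: (pP i) => Pp f; rewrite (isoP_eq (iP i) (Pb i) Pp f).
  by apply: (isoP_perp (iP i)).
have PE i : D i != 0 -> P i = pl b (D i) /\ free2 b (D i).
  move=> Di; have f : free2 b (D i).
    by apply/free2P; split=> // /lnP[x E]; have := yD i; rewrite E !phiE by1 !zero_oneE => x0;
       move: Di; rewrite E x0 rs0 eqxx.
  by split=> //; exact: isoP_eq.
have orth0 i j : i != j -> phi (D i) (D j) = 0 -> D i = 0 \/ D j = 0.
  move=> /eqP ij h; apply: contrapT => /not_orP[/eqP Di /eqP Dj]; apply: ij; apply: Pinj.
  have [_ fi] := PE i Di; have [_ fj] := PE j Dj.
  exact: (star_orth (iP i) (iP j) (Pb i) (Pb j) (PD i) (PD j)).
have pair i j : i != j -> D i + D j = 0 -> D i = 0 /\ D j = 0.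
  move=> ij /eqP; rewrite addr_eq0 => /eqP E.
  have : phi (D i) (D j) = 0 by rewrite E !phiE DD oppr0.
  by case/(orth0 _ _ ij) => h; move: E; rewrite h; [move/esym/eqP; rewrite oppr_eq0 => /eqP -> |move=> ->; rewrite oppr0].
(* If one [D i] vanished, the relations [D12] and [D01] would make two products vanish which share
   the limit opposite to it. By [orth0] either that limit or both of its neighbours are 0, and the
   sum relation kills the rest, against [D0]. *)
have Dn0 : forall i, D i != 0.
  have zz : (forall i, D i = 0) -> False by move=> h; case: D0 => i; rewrite h eqxx.
  apply: I4P; apply/negP => /eqP h; apply: zz; move: D12 D01 Dsum; rewrite h !phiE ?zero_oneE.
  - move=> /orth0 -/(_ isT) h1 /esym/orth0 -/(_ isT) h2 S.
    have [D2|/eqP D2] := eqVneq (D 2) 0.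
      by move: S; rewrite D2 !zero_oneE => /pair -/(_ isT)[D1 D3]; apply: I4P.
    case: h1 h2 => // D1 [] // D3; case: D2; by move: S; rewrite D1 D3 !zero_oneE.
  - move=> /esym/orth0 -/(_ isT) h1 /esym/orth0 -/(_ isT) h2 S.
    have [D3|/eqP D3] := eqVneq (D 3) 0.
      by move: S; rewrite D3 !zero_oneE => /pair -/(_ isT)[D1 D2]; apply: I4P.
    case: h1 h2 => // D1 [] // D2; case: D3; by move: S; rewrite D1 D2 !zero_oneE.
  - move=> /esym/orth0 -/(_ isT) h1 /orth0 -/(_ isT) h2 S.
    have [D0'|/eqP D0'] := eqVneq (D 0) 0.
      by move: S; rewrite D0' !zero_oneE => /pair -/(_ isT)[D1 D3]; apply: I4P.
    case: h1 h2 => // D1 [] // D3; case: D0'; by move: S; rewrite D1 D3 !zero_oneE.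
  - move=> /orth0 -/(_ isT) h1 /orth0 -/(_ isT) h2 S.
    have [D1|/eqP D1] := eqVneq (D 1) 0.
      by move: S; rewrite D1 !zero_oneE => /pair -/(_ isT)[D2 D3]; apply: I4P.
    case: h1 h2 => // D2 [] // D3; case: D1; by move: S; rewrite D2 D3 !zero_oneE.
have PD' i : P i = pl b (D i) by case: (PE i (Dn0 i)).
split; first exact: (dim_star PD').
exists D; split=> // i; split=> //; rewrite L0E => /lnP[x E].
by have := yD i; rewrite E !phiE by1 !zero_oneE => x0; move: (Dn0 i); rewrite E x0 rs0 eqxx.
Qed.

(** * Plane-type quadripods *)

(** In the basis [u1], [u2] the four lines have coordinates (1 : 0), (0 : 1), (1 : 1), (c : 1), that
    is infinity, 0, 1 and the cross-ratio. *)
Definition normal_form (L P : 'I_4 -> set V) c u1 u2 :=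
  [/\ P 0 = pl u1 u2, L 0 = ln u1, L 1 = ln u2, L 2 = ln (u1 + u2)
    & L 3 = ln (rscale u1 c + u2)].

Lemma ln_rs u x : x != 0 -> ln (rscale u x) = ln u.
Proof.
move=> x0; apply/seteqP; split=> w /lnP[y ->]; apply/lnP.
  by exists (x * y); rewrite rsA.
by exists (x^-1 * y); rewrite rsA mulrA KVr// mul1r.
Qed.

Lemma pl_rs u w (x y : K) : x != 0 -> y != 0 -> pl (rscale u x) (rscale w y) = pl u w.
Proof.
move=> x0 y0; apply/seteqP; split; apply: pl_sub; try exact: pl_subspace; apply/plP.
- by exists x, 0; rewrite rs0 addr0.
- by exists 0, y; rewrite rs0 add0r.
- by exists x^-1, 0; rewrite rs0 addr0 rsA KVr// rs1.
- by exists 0, y^-1; rewrite rs0 add0r rsA KVr// rs1.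
Qed.

Lemma star_normal_form L P : cfg L P -> (forall i, P i = P 0) -> injective L ->
  exists c u1 u2, [/\ isob u1 u2, normal_form L P c u1 u2, c != 0 & c != 1].
Proof.
move=> cLP PP Linj.
have := cLP; rewrite cfg4 => -[[l0 l1 l2 l3] [q0 q1 q2 q3] [s00 s11 s22 s33] [s10 s21 s32 s03]].
have [x0 x00 L0E] := isoL_gen l0; have Lx0 : L 0 x0 by rewrite L0E; exact: ln_id.
have [x1 x10 L1E] := isoL_gen l1; have Lx1 : L 1 x1 by rewrite L1E; exact: ln_id.
have [x2 x20 L2E] := isoL_gen l2; have Lx2 : L 2 x2 by rewrite L2E; exact: ln_id.
have [x3 x30 L3E] := isoL_gen l3; have Lx3 : L 3 x3 by rewrite L3E; exact: ln_id.
have neq i j : i != j -> L i <> L j by move=> /eqP ij /Linj.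
have f01 : free2 x0 x1 := free2_lines l0 l1 Lx0 Lx1 x00 x10 (neq 0 1 isT).
have P0x2 : P 0 x2 by rewrite -(PP 2); exact: s22.
have P0x3 : P 0 x3 by rewrite -(PP 2); exact: s32.
have P0x0 : P 0 x0 by apply: s00. have P0x1 : P 0 x1 by apply: s10.
have P0E : P 0 = pl x0 x1 by apply: isoP_eq.
move: (P0x2) (P0x3); rewrite P0E => /plP[p [r x2E]] /plP[s [r' x3E]].
have p0 : p != 0.
  apply/eqP => z; apply: (neq 2 1 isT); rewrite L2E L1E x2E z rs0 add0r ln_rs//.
  by apply: contraNneq x20 => r0; rewrite x2E z r0 !rs0 addr0.
have r0 : r != 0.
  apply/eqP => z; apply: (neq 2 0 isT); rewrite L2E L0E x2E z rs0 addr0 ln_rs//.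
have r'0 : r' != 0.
  apply/eqP => z; apply: (neq 3 0 isT); rewrite L3E L0E x3E z rs0 addr0 ln_rs//.
  by apply: contraNneq x30 => r'0; rewrite x3E z r'0 !rs0 addr0.
have rV0 : r'^-1 * r != 0.
  by apply/eqP => /KM0; rewrite invr_eq0 => /(_ r'0)/eqP; rewrite (negPf r0).
pose c := p^-1 * (s * (r'^-1 * r)).
have L3E' : L 3 = ln (rscale (rscale x0 p) c + rscale x1 r).
  by rewrite L3E -(ln_rs x3 rV0) x3E rsDl !rsA /c (mulrA r') KVr// mul1r (mulrA p) KVr// mul1r.
exists c, (rscale x0 p), (rscale x1 r); split.
- split; rewrite ?phiE ?(isoP_iso q0 P0x0 P0x0) ?(isoP_iso q0 P0x1 P0x1) ?(isoP_iso q0 P0x0 P0x1) ?zero_oneE//.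
  move=> y y'; rewrite !rsA => /f01[] /KM0 /(_ p0) -> /KM0 /(_ r0) ->; split=> //.
- split; rewrite ?ln_rs//; last by rewrite L2E x2E.
  by rewrite pl_rs.
- apply/eqP => c0; apply: (neq 3 1 isT).
  by rewrite L3E' c0 rs0 add0r ln_rs.
- by apply/eqP => c1; apply: (neq 3 2 isT); rewrite L3E' c1 rs1 L2E x2E.
Qed.

Lemma normal_form_neq L P c u1 u2 : injective L -> normal_form L P c u1 u2 -> c != 0 /\ c != 1.
Proof.
move=> Linj [_ _ L1 L2 L3]; split; apply/eqP => c0.
  have /Linj // : L 3 = L 1 by rewrite L3 L1 c0 rs0 add0r.
have /Linj // : L 3 = L 2 by rewrite L3 L2 c0 rs1.
Qed.

Lemma linear_form_phi u : linear_form (phi u).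
Proof. by split=> [w w'|w x]; rewrite phiE. Qed.

Lemma ln_eq u u' : u != 0 -> ln u = ln u' -> exists2 x, x != 0 & u = rscale u' x.
Proof.
move=> u0 E; have : ln u' u by rewrite -E; exact: ln_id.
move=> /lnP[x ux]; exists x => //.
by apply: contraNneq u0 => x0; rewrite ux x0 rs0.
Qed.

(* The coordinates a, b of the homography are normalised to be dual to u1, u2. *)
Lemma cross_ratioP f L P c : msp f L P -> (forall i, P i = P 0) ->
  cross_ratio f c <-> exists u1 u2, isob u1 u2 /\ normal_form L P c u1 u2.
Proof.
move=> fLP PP; have cLP := msp_cfg fLP.
have E i : line_space (mline f i) = L i by case: (fLP i).
have EP : plane_space (mplane f 0) = P 0 by case: (fLP 0).
have := cLP; rewrite cfg4 => -[[l0 l1 l2 l3] [q0 q1 q2 q3] [s00 s11 s22 s33] [s10 s21 s32 s03]].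
rewrite /cross_ratio !E EP; split; last first.
  move=> [u1 [u2 [[f12 u11 u22 u12] [P0E L0E L1E L2E L3E]]]].
  have [y1 [y2 H]] := complete4 f12 u11 u22 u12.
  (* A homography is here a function on all subsets, so a spanning vector is chosen by [xget], and
     sets that are not lines receive the default [None]. The values on lines do not depend on the
     choice, by [hE]. *)
  pose h (S : set V) : option K :=
    if pselect (exists2 u, u != 0 & S = ln u) is left ex
    then let: u := xget 0 [set u | u != 0 /\ S = ln u] in
      if phi y2 u == 0 then None else Some (phi y1 u / phi y2 u)
    else None.
  have hE u : u != 0 -> h (ln u) = if phi y2 u == 0 then None else Some (phi y1 u / phi y2 u).
    move=> u0; rewrite /h; case: pselect => [ex|[]]; last by exists u.
    case: xgetP => [w _ [w0 wE]|/(_ u)[]//].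
    have [x x0 wx] := ln_eq w0 (esym wE).
    rewrite wx !phiE; have [->|b0] := eqVneq (phi y2 u) 0; first by rewrite mul0r eqxx.
    have -> : (phi y2 u * x == 0) = false by apply/eqP => /KM0/(_ b0)/eqP; rewrite (negPf x0).
    by congr Some; rewrite invrM ?K_unit// mulrA mulrK ?K_unit.
  exists h; split.
    exists (phi y1), (phi y2); split; [exact: linear_form_phi|exact: linear_form_phi| |].
      by move=> u; rewrite P0E => /plP[x [y ->]]; rewrite !phiE !(gramE H) !zero_oneE => -> ->; rewrite !rs0 addr0.
    by move=> u _; exact: hE.
  rewrite L0E L1E L2E L3E.
  have test a b u : phi a u = 1 \/ phi b u = 1 -> u != 0.
    by move=> uu; apply/eqP => u0; case: uu; rewrite u0 !phiE => /esym/eqP; rewrite oner_eq0.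
  have t1 : u1 != 0 by apply: (test y1 y1); left; rewrite (gramE H).
  have t2 : u2 != 0 by apply: (test y2 y2); left; rewrite (gramE H).
  have t3 : u1 + u2 != 0 by apply: (test y1 y1); left; rewrite !phiE !(gramE H) !zero_oneE.
  have t4 : rscale u1 c + u2 != 0 by apply: (test y2 y2); left; rewrite !phiE !(gramE H) !zero_oneE.
  by rewrite !hE// !phiE !(gramE H) !zero_oneE !eqxx !oner_eq0 !invr1 !zero_oneE.
move=> [h [[a [b [[aD aZ] [bD bZ] inj hE]]] [h0 h1 h2 h3]]].
have [x0 x00 L0E] := isoL_gen l0; have P0x0 : P 0 x0 by apply: s00; rewrite L0E; exact: ln_id.
have [x1 x10 L1E] := isoL_gen l1; have P0x1 : P 0 x1 by apply: s10; rewrite L1E; exact: ln_id.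
have [x2 x20 L2E] := isoL_gen l2.
have P0x2 : P 0 x2 by rewrite -(PP 2); apply: s22; rewrite L2E; exact: ln_id.
have [x3 x30 L3E] := isoL_gen l3.
have P0x3 : P 0 x3 by rewrite -(PP 2); apply: s32; rewrite L3E; exact: ln_id.
move: h0 h1 h2 h3; rewrite L0E L1E L2E L3E !hE//.
have [b0 _|//] := eqVneq (b x0) 0.
have [//|b1 [a1]] := eqVneq (b x1) 0.
have [//|b2 [a2]] := eqVneq (b x2) 0.
have [//|b3 [a3]] := eqVneq (b x3) 0.
have {}a1 : a x1 = 0 by rewrite -(divrK (K_unit b1) (a x1)) a1 mul0r.
have {}a2 : a x2 = b x2 by rewrite -(divrK (K_unit b2) (a x2)) a2 mul1r.
have {}a3 : a x3 = c * b x3 by rewrite -(divrK (K_unit b3) (a x3)) a3.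
have a0 : a x0 != 0 by apply: contraNneq x00 => a0; rewrite (inj _ P0x0 a0 b0).
have f01 : free2 x0 x1.
  apply/free2P; split=> // /lnP[x xE]; move: b1; rewrite xE bZ b0 mul0r eqxx //.
have a00 : (a x0)^-1 != 0 by rewrite invr_eq0.
have b10 : (b x1)^-1 != 0 by rewrite invr_eq0.
pose u1 := rscale x0 (a x0)^-1; pose u2 := rscale x1 (b x1)^-1.
have P0E : P 0 = pl u1 u2 by rewrite pl_rs//; exact: isoP_eq.
have au1 : a u1 = 1 by rewrite aZ KVr.
have bu1 : b u1 = 0 by rewrite bZ b0 mul0r.
have au2 : a u2 = 0 by rewrite aZ a1 mul0r.
have bu2 : b u2 = 1 by rewrite bZ KVr.
have E1 : ln x0 = ln u1 by rewrite ln_rs.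
have E2 : ln x1 = ln u2 by rewrite ln_rs.
clearbody u1 u2.
have i12 : isob u1 u2.
  have P01 : P 0 u1 by rewrite P0E; exact: pl_l.
  have P02 : P 0 u2 by rewrite P0E; exact: pl_r.
  split; try exact: (isoP_iso q0).
  move=> x y xE; have := congr1 a xE; have := congr1 b xE.
  have aZ0 : a 0 = 0 by have := aZ 0 0; rewrite rs0 mulr0.
  have bZ0 : b 0 = 0 by have := bZ 0 0; rewrite rs0 mulr0.
  by rewrite aD bD !aZ !bZ au1 au2 bu1 bu2 aZ0 bZ0 !zero_oneE.
exists u1, u2; split=> //; split; rewrite ?L0E ?L1E ?L2E ?L3E//.
  move: (P0x2); rewrite P0E => /plP[x [y xE]]; move: a2 b2.
  by rewrite xE aD bD !aZ !bZ au1 au2 bu1 bu2 !zero_oneE => ->  y0; rewrite -rsDl ln_rs.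
move: (P0x3); rewrite P0E => /plP[x [y xE]]; move: a3 b3.
rewrite xE aD bD !aZ !bZ au1 au2 bu1 bu2 !zero_oneE => ->  y0; rewrite -rsA -rsDl ln_rs//.
Qed.

(* The approximating lines are <u1>, <u2>, <u1 + u2 + w3 t + y1 A t^2> and
   <u1 c + u2 + w4 t + y2 B t^2>; the three equations make them isotropic and
   orthogonal to their neighbours. *)
Lemma star_suff L P c u1 u2 y1 y2 w3 w4 (A B : K) : cfg L P -> (forall i, P i = P 0) ->
  injective L -> hyp4 u1 u2 y1 y2 -> normal_form L P c u1 u2 ->
  core u1 u2 y1 y2 w3 -> core u1 u2 y1 y2 w4 ->
  A + sigma A + phi w3 w3 = 0 -> B + sigma B + phi w4 w4 = 0 ->
  sigma A * c + B + phi w3 w4 = 0 -> A != 0 -> B != 0 -> inS L P.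
Proof.
move=> cLP PP Linj H nf C3 C4 e33 e44 e34 A0 B0.
have [c0 c1] := normal_form_neq Linj nf; case: nf => P0E L0E L1E L2E L3E.
pose u3 n := u1 + u2 + rscale w3 (T n) + rscale y1 (A * T n * T n).
pose u4 n := rscale u1 c + u2 + rscale w4 (T n) + rscale y2 (B * T n * T n).
have GE := (gramE H, coreE C3, coreE C4).
have i33 n : phi (u3 n) (u3 n) = 0.
  rewrite /u3 !phiE !GE !zero_oneE !sMT sT TC -!mulrDl.
  by rewrite addrAC e33 !mul0r.
have i44 n : phi (u4 n) (u4 n) = 0.
  rewrite /u4 !phiE !GE !zero_oneE !sMT sT TC -!mulrDl.
  by rewrite addrAC e44 !mul0r.
have i34 n : phi (u3 n) (u4 n) = 0.
  rewrite /u3 /u4 !phiE !GE !zero_oneE !sMT sT TC.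
  have -> : sigma A * T n * T n * c = sigma A * c * T n * T n.
    by rewrite -(mulrA _ _ c) TC mulrA -(mulrA _ _ c) TC mulrA.
  by rewrite -!mulrDl addrC addrA e34 !mul0r.

have p1u3 n : phi u1 (u3 n) = A * T n * T n by rewrite /u3 !phiE !GE !zero_oneE.
have p2u4 n : phi u2 (u4 n) = B * T n * T n by rewrite /u4 !phiE !GE !zero_oneE.
have p2u3 n : phi u2 (u3 n) = 0 by rewrite /u3 !phiE !GE !zero_oneE.
have p1u4 n : phi u1 (u4 n) = 0 by rewrite /u4 !phiE !GE !zero_oneE.
have p41 n : phi (u4 n) u1 = 0 by apply: phi_eq0C.
have y2u3 n : phi y2 (u3 n) = 1 by rewrite /u3 !phiE !GE !zero_oneE.
have y1u3 n : phi y1 (u3 n) = 1 by rewrite /u3 !phiE !GE !zero_oneE.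
have y2u4 n : phi y2 (u4 n) = 1 by rewrite /u4 !phiE !GE !zero_oneE.
have y1u4 n : phi y1 (u4 n) = c by rewrite /u4 !phiE !GE !zero_oneE.
have c3 : cvV v \oo u3 (u1 + u2) by apply: cvV_small; [apply: cvV_small; [exact: cvV_cst|exact: smallT]|exact: smallMTT].
have c4 : cvV v \oo u4 (rscale u1 c + u2) by apply: cvV_small; [apply: cvV_small; [exact: cvV_cst|exact: smallT]|exact: smallMTT].
clearbody u3 u4.
have f12 : free2 u1 u2 := hyp4_free H.
have f2 : free2 u2 (u1 + u2) by apply: (@free2_test _ _ y1 y2); rewrite ?phiE ?(gramE H) ?zero_oneE ?oner_neq0.
have c1' : c - 1 != 0 by rewrite subr_eq0.
have f3 : free2 (u1 + u2) (rscale u1 c + u2).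
  apply: (@free2_test _ _ (y1 - y2) y2); rewrite ?phiE ?(gramE H) ?zero_oneE ?oner_neq0// subrr//.
have f4 : free2 (rscale u1 c + u2) u1.
  by apply: free2C; apply: (@free2_test _ _ y2 y1); rewrite ?phiE ?(gramE H) ?zero_oneE ?oner_neq0.
have g1 n : free2 u2 (u3 n) by apply: (@free2_test _ _ y1 y2); rewrite ?y1u3 ?(gramE H) ?oner_neq0.
have g2 n : free2 (u3 n) (u4 n).
  by apply: (@free2_test _ _ (y1 - y2) y2); rewrite ?phiE ?y1u3 ?y2u3 ?y1u4 ?y2u4 ?oner_neq0// subrr.
have g3 n : free2 (u4 n) u1.
  by apply: free2C; apply: (@free2_test _ _ y2 y1); rewrite ?y2u4 ?(gramE H) ?oner_neq0.
have iP : isoP (P 0) by case: (cLP 0).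
have PE a b : P 0 a -> P 0 b -> free2 a b -> P 0 = pl a b by exact: isoP_eq.
have P1 : P 0 u1 by rewrite P0E; exact: pl_l.
have P2 : P 0 u2 by rewrite P0E; exact: pl_r.
have P3 : P 0 (u1 + u2) by apply: isoPD.
have P4 : P 0 (rscale u1 c + u2) by apply: isoPD => //; exact: isoPZ.
apply: (inS_lim (u := mk4 u1 u2 (u1 + u2) (rscale u1 c + u2)) (p := mk4 u2 (u1 + u2) (rscale u1 c + u2) u1)
  (un := fun n => mk4 u1 u2 (u3 n) (u4 n)) (pn := fun n => mk4 u2 (u3 n) (u4 n) u1)) => //.
- exact: I4P.
- by apply: I4P; rewrite ?(PP 1) ?(PP 2) ?(PP 3); exact: PE.
- exact: I4P.
- by move=> n; apply: I4P; [exact: f12|exact: g1|exact: g2|exact: g3].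
- move=> n; apply: inS_inj.
  + have [u11 u22 u12] := And3 (haa H) (hbb H) (hab H).
    apply: vconf_cfg; apply: vconf4; rewrite /mk4 /=; split=> //; try exact: pl_r.
  + exists u1, (u3 n); split; [exact: ln_id|exact: ln_id|].
    by rewrite p1u3 !MT_eq0.
  + exists u2, (u4 n); split; [exact: ln_id|exact: ln_id|].
    by rewrite p2u4 !MT_eq0.
- by apply: I4P; rewrite /mk4 /=; try exact: cvV_cst.
- by apply: I4P; rewrite /mk4 /=; try exact: cvV_cst.
Qed.

(** For trivial [sigma] the first two equations of [star_suff] force [A] and [B] to be minus half
    the values of [q] at [w3] and [w4]. The third then says that [q] at [w4 - w3] is [1 - c] times
    [q] at [w3]; the hypothesis provides such a difference [d], once its values are carried over to
    the present core. *)
Lemma star_suff_id L P c u1 u2 w w' : sigma =1 id -> cfg L P -> (forall i, P i = P 0) ->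
  injective L -> isob u1 u2 -> normal_form L P c u1 u2 ->
  core_orthogonal phi e w -> w != 0 -> core_orthogonal phi e w' -> w' != 0 ->
  1 - c = phi w w * (phi w' w')^-1 -> inS L P.
Proof.
move=> sid cLP PP Linj [f12 u11 u22 u12] nf /core_orthogonalP C w0 /core_orthogonalP C' w'0 cE.
have comm (x y : K) : x * y = y * x by rewrite -(sid (x * y)) sM !sid.
have [c0 c1] := normal_form_neq Linj nf.
have [y1 [y2 H]] := complete4 f12 u11 u22 u12.
have [w3 C3 q3] := core_transport std_hyp4 H C'.
have [d Cd qd] := core_transport std_hyp4 H C.
have q'0 : phi w' w' != 0 by apply: contraNneq w'0 => z; rewrite (core_aniso std_hyp4 C' z).
have C4 : core u1 u2 y1 y2 (w3 + d).
  by apply: coreI; rewrite !phiE !(coreE C3) !(coreE Cd) !zero_oneE.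
have qq : phi d d = phi w3 w3 * (1 - c) by rewrite qd q3 cE comm -mulrA mulVr ?K_unit// mulr1.
have q4E : halfq w3 * c + halfq (w3 + d) + phi w3 (w3 + d) = 0.
  have E (x : V) : halfq x + halfq x = - phi x x by rewrite -[RHS]add0r -(halfq_double x) addrK.
  apply: halve_inj; rewrite !addr0 addrACA [_ * c + _ + _]addrACA -mulrDl !E.
  rewrite !phiE (phiC d w3) sid qq mulrBr mulr1 mulNr -opprD addrC.
  apply/eqP; rewrite subr_eq0; apply/eqP.
  rewrite [RHS]addrC -!addrA addNr addr0; congr (_ + (_ + _)); exact: addrC.
have q40 : phi (w3 + d) (w3 + d) != 0.
  apply/eqP => z; have /eqP := core_aniso H C4 z; rewrite addr_eq0 => /eqP E.
  have dd : phi d d = phi w3 w3 by rewrite E !phiE opprK.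
  have /KM0 : phi w3 w3 * c = 0.
    have <- : phi w3 w3 - phi w3 w3 * (1 - c) = phi w3 w3 * c by rewrite mulrBr mulr1 subKr.
    by rewrite -qq dd subrr.
  by rewrite q3 => /(_ q'0)/eqP; rewrite (negPf c0).
apply: (star_suff (A := halfq w3) (B := halfq (w3 + d)) cLP PP Linj H nf C3 C4) => //.
- by rewrite halfq_sym halfq_double.
- by rewrite halfq_sym halfq_double.
- by rewrite halfq_sym.
- by apply: halfq_neq0; rewrite q3.
- exact: halfq_neq0.
Qed.

(** The same vector [w x] serves as [w3] and as [w4]. With the coefficients [- sigma A] and
    [- B - sigma A], where [B = A * (1 - c)], the equations of [star_suff] reduce to the norm
    equation for [A] and to [B] being skew. *)
Lemma star_suff_nid L P c u1 u2 : cfg L P -> (forall i, P i = P 0) ->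
  injective L -> isob u1 u2 -> normal_form L P c u1 u2 ->
  (forall k, k != 0 -> sigma k = k -> exists A x : K, [/\ A != 0,
     sigma (A * (1 - c)) = - (A * (1 - c)) & A + sigma A = sigma x * k * x]) -> inS L P.
Proof.
move=> cLP PP Linj [f12 u11 u22 u12] nf norm.
have [c0 c1] := normal_form_neq Linj nf.
have [y1 [y2 H]] := complete4 f12 u11 u22 u12.
have [w C w0] := core_ex H.
have q0 : phi w w != 0 by apply: contraNneq w0 => z; rewrite (core_aniso H C z).
have [A [x [A0 sB AE]]] := norm _ q0 (q_sym w).
have Cx : core u1 u2 y1 y2 (rscale w x) by apply: coreI; rewrite !phiE !(coreE C) !zero_oneE.
have qx : phi (rscale w x) (rscale w x) = A + sigma A by rewrite AE !phiE -?mulrA.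
set B := A * (1 - c) in sB.
apply: (star_suff (A := - sigma A) (B := - B - sigma A) cLP PP Linj H nf Cx Cx).
- by rewrite qx sN sK -opprD [sigma A + A]addrC addNr.
- by rewrite qx sD !sN sK sB opprK [X in X + _]addrACA addNr add0r -opprD [sigma A + A]addrC addNr.
- rewrite sN sK qx mulNr [_ + (- B - _)]addrA -opprD /B mulrBr mulr1 [_ + (A - _)]addrC subrK.
  by rewrite -opprD addNr.
- by rewrite oppr_eq0 s_eq0.
- rewrite -opprD oppr_eq0 addr_eq0; apply/eqP => E.
  have : A = B by rewrite -[A]sK -[sigma A]opprK -E sN sB opprK.
  rewrite /B mulrBr mulr1 => /eqP; rewrite -subr_eq0 opprB addrC subrK => /eqP/KM0/(_ A0)/eqP.
  by rewrite (negPf c0).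
Qed.

(* w and w' are obtained by projecting u3 and u4 to the orthogonal of <a, b>
   along <y, z>; the fraction is the cross-ratio of the lines of <a, b> close to
   <a>, <b>, <u3>, <u4>. *)
Lemma cross_identity (kf : K -> F) a b y z u3 u4 : (forall x, x = (kf x)%:A) ->
  sigma =1 id -> hyp4 a b y z -> phi u3 u3 = 0 -> phi u4 u4 = 0 -> phi u3 u4 = 0 ->
  phi b u3 = 0 -> phi a u4 = 0 -> phi a u3 != 0 -> phi y u3 != 0 -> phi z u4 != 0 ->
  exists w w', [/\ [/\ phi a w = 0, phi b w = 0, phi a w' = 0 & phi b w' = 0],
    phi w' w' != 0 &
    phi w w = phi w' w' *
      (1 - (kf (phi y u4) * kf (phi z u3) / (kf (phi y u3) * kf (phi z u4)))%:A)].
Proof.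
move=> kfE sid H u33 u44 u34 bu3 au4 au3 yu3 zu4.
have kfI x x' : kf x = kf x' -> x = x' by move=> h; rewrite (kfE x) (kfE x') h.
have kfA (r : F) : kf r%:A = r by apply: (@scal_inj _ K); rewrite -kfE.
have kfD x x' : kf (x + x') = kf x + kf x' by apply: (@scal_inj _ K); rewrite -kfE scalerDl -!kfE.
have kfM x x' : kf (x * x') = kf x * kf x'.
  by apply: (@scal_inj _ K); rewrite -kfE -scalerA -mulr_algl -!kfE.
have kf0 : kf 0 = 0 by rewrite -(kfA 0) scale0r.
have kf1 : kf 1 = 1 by rewrite -(kfA 1) scale1r.
have kfN x : kf (- x) = - kf x by apply: (addrI (kf x)); rewrite -kfD !subrr kf0.
have kfn0 x : x != 0 -> kf x != 0 by apply: contraNneq => h; apply/eqP/kfI; rewrite h kf0.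
have t0 := two_neq0 F_char.
have sC p r : phi p r = phi r p by rewrite phiC sid.
(* This factor equalises the pairings of the two projected vectors with [z], so that their
   difference [w] is also orthogonal to [z]. *)
pose s : K := (kf (phi z u3) / kf (phi z u4))%:A.
exists (rscale (u4 - rscale z (phi b u4)) s - (u3 - rscale y (phi a u3))), (u3 - rscale y (phi a u3)).
have g : (phi u3 y = phi y u3) * (phi u3 z = phi z u3) * (phi u4 y = phi y u4) *
  (phi u4 z = phi z u4) * (phi u3 a = phi a u3) * (phi u4 b = phi b u4) by rewrite !(sC u3) !(sC u4).
have ay := kfn0 _ au3; have yy := kfn0 _ yu3; have zz := kfn0 _ zu4.
split.
- by rewrite !phiE !(gramE H) bu3 au4 !zero_oneE !subrr ?mul0r ?zero_oneE.
- rewrite !phiE u33 !(gramE H) !g !sid !zero_oneE.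
  apply/eqP => /(congr1 kf); rewrite kf0 !(kfD, kfN, kfM) => /eqP.
  have -> : forall p r : F, - (p * r) - (r * p) = - (2 * (p * r)) by move=> p r; ring.
  by rewrite oppr_eq0 !mulf_eq0 (negPf t0) (negPf ay) (negPf yy).
apply: kfI; rewrite !phiE u33 u44 u34 (sC u4 u3) u34 !(gramE H) !g !sid !zero_oneE.
rewrite !(kfD, kfN, kfM, kf1, kfA).
by field; rewrite yy zz.
Qed.

(** One approximating apartment, far enough in the sequence, suffices, and no limit of core vectors
    is taken: the exact quotient obtained from [cross_identity] differs from [1 - c] by a square,
    which is absorbed into the numerator vector. *)
Lemma star_nec (kf : K -> F) L P c u1 u2 : (forall x, x = (kf x)%:A) ->
  sigma =1 id -> cfg L P -> (forall i, P i = P 0) -> injective L -> isob u1 u2 ->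
  normal_form L P c u1 u2 -> inS L P ->
  exists w w', [/\ core_orthogonal phi e w, w != 0, core_orthogonal phi e w', w' != 0
    & 1 - c = phi w w * (phi w' w')^-1].
Proof.
move=> kfE sid cLP PP Linj [f12 u11 u22 u12] nf inn.
have [c0 c1] := normal_form_neq Linj nf; case: nf => P0E L0E L1E L2E L3E.
have kfA (r : F) : kf r%:A = r by apply: (@scal_inj _ K); rewrite -kfE.
have kfD x x' : kf (x + x') = kf x + kf x' by apply: (@scal_inj _ K); rewrite -kfE scalerDl -!kfE.
have kfM x x' : kf (x * x') = kf x * kf x'.
  by apply: (@scal_inj _ K); rewrite -kfE -scalerA -mulr_algl -!kfE.
have kf0 : kf 0 = 0 by rewrite -(kfA 0) scale0r.
have kf1 : kf 1 = 1 by rewrite -(kfA 1) scale1r.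
have kfI x x' : kf x = kf x' -> x = x' by move=> h; rewrite (kfE x) (kfE x') h.
have kfN x : kf (- x) = - kf x by apply: (addrI (kf x)); rewrite -kfD !subrr kf0.
have kfZ (r : F) x : kf (r *: x) = r * kf x by rewrite -mulr_algl kfM kfA.
have kfn0 x : (kf x != 0) = (x != 0).
  by apply/idP/idP; apply: contraNneq => h; [rewrite h kf0|apply/eqP/kfI; rewrite h kf0].
have sC p r : phi p r = phi r p by rewrite phiC sid.
have iP : isoP (P 0) by case: (cLP 0).
have [y1 [y2 H]] := complete4 f12 u11 u22 u12.
pose b := mk4 u1 u2 (u1 + u2) (rscale u1 c + u2).
have Lb i : L i = ln (b i) by move: i; apply: I4P.
have Pb i : P 0 (b i) by rewrite -(PP i); case: (cLP i) => _ _ h _; apply: h; rewrite Lb; exact: ln_id.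
have b0 i : b i != 0.
  have [[x [x0 _ E]] _ _ _] := cLP i; apply: contraNneq x0 => bi.
  have : ln (b i) x by rewrite -Lb E; exact: ln_id.
  by rewrite bi => /lnP[y ->]; rewrite rs0l.
have /choice[p pP] : forall i, exists p, P 0 p /\ free2 (b i) p.
  by move=> i; have [p Pp f] := isoP_other iP (Pb i) (b0 i); exists p; split => //; exact: free2C.
have [|||| un [an [bn [orth neq perp un0 cv]]]] := @inS_seq L P b p.
- exact: Lb.
- by move=> i; rewrite PP; case: (pP i) => Pp f; exact: isoP_eq.
- by move=> i; case: (pP i).
- exact: inn.
have PO : ProperFilter (\oo : set_system nat) by exact: _.
have cu y i : cvF v \oo (fun n => kf (phi y (un n i))) (kf (phi y (b i))).
  have [h _ _] := cv i.
  have kfl : Flinear_form (fun (r : F) (x : K) => r *: x) kf by move=> r x x'; rewrite kfD kfZ.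
  exact: (phi_cvg sigma_invol sigma_cont sigma_scal phi_herm _ (cvV_cst y) h kfl).
pose a y i n := kf (phi y (un n i)).
(* The determinants of the lines projected to the limit plane along coordinates [y1], [y2]; [cr]
   below is the cross-ratio of the projected lines, and converges to [c]. *)
pose de2 i j n := a y1 i n * a y2 j n - a y1 j n * a y2 i n.
have cde i j : cvF v \oo (de2 i j) (kf (phi y1 (b i)) * kf (phi y2 (b j)) - kf (phi y1 (b j)) * kf (phi y2 (b i))).
  by apply: cvFB; apply: cvFM; exact: cu.
have dE : (kf (phi y1 (b 0)) = 1) * (kf (phi y1 (b 1)) = 0) * (kf (phi y1 (b 2)) = 1) * (kf (phi y1 (b 3)) = kf c) *
   ((kf (phi y2 (b 0)) = 0) * (kf (phi y2 (b 1)) = 1) * (kf (phi y2 (b 2)) = 1) * (kf (phi y2 (b 3)) = 1)).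
  by rewrite /b /mk4 /= !phiE !(gramE H) !zero_oneE.
have cD := cde 0 1; have cal := cde 2 1; have cbe := cde 0 2; have cga := cde 3 1; have cde' := cde 0 3.
rewrite !dE !zero_oneE in cD cal cbe cga cde'.
have fc : 1 - kf c != 0 by rewrite subr_eq0 eq_sym -kf1; apply: contraNneq c1 => /kfI ->.
have [eps eps0 sq] := squares_near1 F_local F_char.
pose cr n := de2 3 1 n * de2 0 2 n / (de2 2 1 n * de2 0 3 n).
have ccr : cvF v \oo (fun n => 1 - cr n) (1 - kf c).
  apply: cvFB; first exact: cvF_cst.
  have n11 : (1 * 1 : F) != 0 by rewrite mulr1 oner_neq0.
  by have := cvFM (cvFM cga cbe) (cvFV n11 (cvFM cal cde')); rewrite !mulr1 invr1 mulr1; apply; exact: _.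
have cq : cvF v \oo (fun n => (1 - kf c) / (1 - cr n)) 1.
  by rewrite -[X in cvF _ _ _ X](divff fc); apply: cvFM; [exact: cvF_cst|exact: cvFV].
have ne x : cvF v \oo x 1 -> \oo [set n | x n != 0] by move=> cx; apply: (cvF_neq0 cx); exact: oner_neq0.
have [n [/= [Dn aln] [[den crn] /sq[y0 y0E]]]] := filter_ex (filterI (filterI (ne _ cD) (ne _ cal))
   (filterI (filterI (ne _ cde') (cvF_neq0 ccr fc)) (cq _ eps0))).
have cE : 1 - kf c = (1 - cr n) * y0 ^+ 2 by rewrite -y0E mulrC divfK.
set D := de2 0 1 n in Dn.
(* By Cramer's rule, [x1] and [x2] form the basis of the plane of [y1], [y2] dual to the first two
   approximating vectors. *)
pose x1 := rscale (rscale y1 (a y2 1 n)%:A - rscale y2 (a y1 1 n)%:A) (D^-1)%:A.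
pose x2 := rscale (rscale y2 (a y1 0 n)%:A - rscale y1 (a y2 0 n)%:A) (D^-1)%:A.
have kp y i : phi y (un n i) = (a y i n)%:A by exact: kfE.
have ax1 i : phi x1 (un n i) = (de2 i 1 n / D)%:A.
  by apply: kfI; rewrite /x1 !phiE !kp !sid !(kfM, kfD, kfN, kfA) /de2; field.
have ax2 i : phi x2 (un n i) = (de2 0 i n / D)%:A.
  by apply: kfI; rewrite /x2 !phiE !kp !sid !(kfM, kfD, kfN, kfA) /de2; field.
have x11 : phi x1 x1 = 0 by rewrite /x1 !phiE !(gramE H) !zero_oneE.
have x22 : phi x2 x2 = 0 by rewrite /x2 !phiE !(gramE H) !zero_oneE.
have x12 : phi x1 x2 = 0 by rewrite /x1 /x2 !phiE !(gramE H) !zero_oneE.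
clearbody x1 x2.
have de0 i : de2 i i n = 0 by rewrite /de2 subrr.
have orth4 : [/\ phi (un n 0) (un n 1) = 0, phi (un n 1) (un n 2) = 0, phi (un n 2) (un n 3) = 0
    & phi (un n 3) (un n 0) = 0].
  by move: (orth n 0) (orth n 1) (orth n 2) (orth n 3); rewrite !I4_succE => -[? _] [? _] [? _] [? _].
have iso i : phi (un n i) (un n i) = 0 by case: (orth n i).
case: orth4 => o01 o12 o23 o30.
have H' : hyp4 (un n 0) (un n 1) x1 x2.
  by apply: hyp4I => //; rewrite sC ?ax1 ?ax2 ?de0 ?mul0r ?scale0r// divff// scale1r.
have A3 : phi (un n 0) (un n 2) != 0 by case: (un0 n 0).
have sc0 (r : F) : r != 0 -> (r%:A : K) != 0 by rewrite scaler_eq0 oner_eq0 orbF.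
have := @cross_identity kf (un n 0) (un n 1) x1 x2 (un n 2) (un n 3) kfE sid H' (iso 2) (iso 3) o23 o12.
rewrite !ax1 !ax2 => /(_ _ A3 _ _)[|||w [w' [[aw bw aw' bw'] q'0 qE]]].
- by rewrite sC.
- by apply: sc0; rewrite mulf_neq0 ?invr_eq0.
- by apply: sc0; rewrite mulf_neq0 ?invr_eq0.
have f01 := hyp4_free H'; have Hs := std_hyp4.
have tr x : phi (un n 0) x = 0 -> phi (un n 1) x = 0 ->
    exists2 x', core_orthogonal phi e x' & phi x' x' = phi x x.
  move=> h0 h1; have [x' [h0' h1'] <-] := plane_perp f01 (iso 0) (iso 1) o01
    (hyp4_free Hs) (haa Hs) (hbb Hs) (hab Hs) h0 h1.
  by have [x'' C <-] := core_proj Hs h0' h1'; exists x'' => //; apply/core_orthogonalP.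
have [w1 C1 q1] := tr _ aw bw; have [w2 C2 q2] := tr _ aw' bw'.
have crE : kf (phi w w) = kf (phi w' w') * (1 - cr n).
  rewrite qE kfM kfD kfN kf1 !kfA; congr (_ * (1 - _)); rewrite /cr; field.
  by rewrite ?Dn ?aln ?den.
have y00 : y0 != 0 by apply: contraNneq fc => y00; rewrite cE y00 expr0n mulr0.
have cE' : 1 - c = phi w1 w1 * (phi w2 w2)^-1 * (y0%:A * y0%:A).
  apply: kfI; rewrite q1 q2 kfD kfN kf1 cE.
  have kV x : x != 0 -> kf x^-1 = (kf x)^-1.
    by move=> x0; apply: (mulfI (x := kf x)); rewrite ?kfn0// -kfM KVr// kf1 divff ?kfn0.
  rewrite !kfM kV// crE kfA; field; by rewrite kfn0.
exists (rscale w1 y0%:A), w2.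
have fc' : 1 - c != 0 by rewrite -kfn0 kfD kfN kf1.
have w10 : w1 != 0 by apply: contraNneq fc' => z; rewrite cE' z !phiE !mul0r.
split=> //.
- by move=> i; rewrite !phiE C1 mul0r.
- by apply/eqP => /rs_eq0 -/(_ K_unit w10) /eqP; apply/negP; exact: sc0.
- by apply: contraNneq q'0 => z; rewrite -q2 z !phiE.
- by apply: kfI; rewrite cE' !phiE !sid !kfM; ring.
Qed.

(** * Orthogonal complements of dimension one *)

Definition core_line := forall a b y z, hyp4 a b y z -> forall w w',
  core a b y z w -> core a b y z w' -> w != 0 -> exists x, w' = rscale w x.

(** Modulo [b], the planes are isotropic lines in a space spanned by [a], [y] and one core vector.
    With [P 0] and [P 1] represented by [a] and [y], representatives of [P 2] and [P 3] have nonzero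
    core components; when these are made equal, the difference is a combination of [a] and [y],
    which gives four vectors with sum zero. *)
Lemma core_line_symV L P : sigma =1 id -> core_line -> cfg L P -> (forall i, L i = L 0) ->
  injective P -> symV L P.
Proof.
move=> sid cl cLP LL Pinj.
have comm (x x' : K) : x * x' = x' * x by rewrite -(sid (x * x')) sM !sid.
have sC p r : phi p r = phi r p by rewrite phiC sid.
have := cLP; rewrite cfg4 => -[[l0 l1 l2 l3] [q0 q1 q2 q3] [s00 s11 s22 s33] [s10 s21 s32 s03]].
have [b b0 L0E] := isoL_gen l0; have Lb : L 0 b by rewrite L0E; exact: ln_id.
have iP i : isoP (P i) by case: (cLP i).
have Pb i : P i b by case: (cLP i) => _ _ + _; apply; rewrite LL.
have bb : phi b b = 0 by apply: (isoP_iso q0).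
have oth i : exists2 a, P i a & free2 b a.
  by have [a Pa f] := isoP_other (iP i) (Pb i) b0; exists a => //; exact: free2C.
have neq i j p r : i != j -> P i p -> P j r -> free2 b p -> free2 b r -> phi p r != 0.
  move=> /eqP ij Pp Pr fp fr; apply/eqP => h; apply: ij; apply: Pinj.
  exact: (star_orth (iP i) (iP j) (Pb i) (Pb j) Pp Pr fp fr).
have [a Pa fa] := oth 0; have [y' Py' fy'] := oth 1.
have ay' : phi a y' != 0 by apply: (neq 0 1).
pose y := rscale y' (phi a y')^-1.
have Py : P 1 y by apply: isoPZ.
have ay : phi a y = 1 by rewrite phiZr KVr.
have aa : phi a a = 0 by apply: (isoP_iso q0).
have yy : phi y y = 0 by apply: (isoP_iso q1).
have ab : phi a b = 0 by apply: (isoP_iso q0).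
have yb : phi y b = 0 by apply: (isoP_iso q1).
clearbody y; have [z H] := complete2 aa yy ay bb ab yb b0.
have nL d : d != 0 -> phi z d = 0 -> ~ ln b d.
  move=> d0 zd /lnP[x E]; move: zd; rewrite E phiZr (hzb H) mul1r => x0.
  by move: d0; rewrite E x0 rs0 eqxx.
have fb d : d != 0 -> phi z d = 0 -> free2 b d by move=> d0 zd; apply/free2P; split=> //; exact: nL.
have py i : i != 0 -> i != 1 -> exists p w, [/\ P i p, p != 0, phi z p = 0,
    core a b y z w /\ w != 0 & p = rscale a (phi y p) + rscale y (phi a p) + w].
  move=> /eqP i0 /eqP i1; have [p' Pp' fp'] := oth i.
  pose p := p' - rscale b (phi z p').
  have Pp : P i p by apply: isoPB.
  have zp : phi z p = 0 by rewrite /p phiDr phiNr phiZr (hzb H) mul1r subrr.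
  have p0 : p != 0.
    rewrite /p subr_eq0; apply/eqP => E; have [_] := (free2P _ _).1 fp'; apply; apply/lnP.
    by exists (phi z p').
  have bp : phi b p = 0 by apply: (isoP_iso (iP i)).
  have pp : phi p p = 0 by apply: (isoP_iso (iP i)).
  clearbody p; have := hyp4_resid p H; rewrite zp bp !rs0 !subr0 => C.
  have pE : p = rscale a (phi y p) + rscale y (phi a p) + (p - rscale a (phi y p) - rscale y (phi a p)).
    by rewrite -[p - _ - _]addrA -opprD [RHS]addrC subrK.
  move: pE C; move: (p - _ - _) => w pE C.
  exists p, w; split=> //; split=> //; apply/eqP => w0.
  have : phi y p * phi a p = 0.
    apply: halve_inj; rewrite addr0; move: pp; rewrite {1 2}pE w0 addr0.
    by rewrite !phiE !(gramE H) !sid !zero_oneE [phi a p * _]comm.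
  have Pd j d x : P j d -> p = rscale d x -> i = j.
    move=> Pd E; apply: Pinj; have Pjp : P j p by rewrite E; exact: isoPZ.
    rewrite (isoP_eq (iP i) (Pb i) Pp (fb _ p0 zp)); apply/esym.
    exact: (isoP_eq (iP j) (Pb j) Pjp (fb _ p0 zp)).
  have [yp|yp] := eqVneq (phi y p) 0.
    by move=> _; apply: i1; apply: (Pd _ _ _ Py (_ : _ = rscale y (phi a p))); rewrite {1}pE w0 yp rs0 add0r addr0.
  move=> /KM0/(_ yp) ap; apply: i0; apply: (Pd _ _ _ Pa (_ : _ = rscale a (phi y p))).
  by rewrite {1}pE w0 ap rs0 !addr0.
have [p2 [w2 [P2 p20 zp2 [C2 w20] p2E]]] := py 2 isT isT.
have [p3 [w3 [P3 p30 zp3 [C3 w30] p3E]]] := py 3 isT isT.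
have [x w3E] := cl _ _ _ _ H _ _ C2 C3 w20.
have x0 : x != 0 by apply: contraNneq w30 => x0; rewrite w3E x0 rs0.
pose r0 := phi y p2 * x - phi y p3; pose r1 := phi a p2 * x - phi a p3.
have E23 : rscale p2 x - p3 = rscale a r0 + rscale y r1.
  rewrite {1}p2E {1}p3E w3E !rsDl !rsA /r0 /r1 !rsDr !rsN.
  by rewrite -!/(_ - _) opprD addrACA subrr addr0 opprD addrACA.
have p22 : phi p2 p2 = 0 by apply: (isoP_iso q2).
have p33 : phi p3 p3 = 0 by apply: (isoP_iso q3).
have p23 : phi p2 p3 != 0 by apply: (neq 2 3) => //; exact: fb.
have qn0 : phi (rscale p2 x - p3) (rscale p2 x - p3) != 0.
  rewrite !phiE p22 p33 (sC p3) sid !zero_oneE (comm (phi p2 p3)); apply/eqP => h.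
  have /KM0 /(_ x0)/eqP : x * phi p2 p3 = 0.
    apply: halve_inj; rewrite addr0; apply/eqP; rewrite -oppr_eq0 opprD; apply/eqP.
    by rewrite -[RHS]h.
  by rewrite (negPf p23).
have r00 : r0 != 0 by apply: contraNneq qn0 => z0; rewrite E23 z0 rs0 add0r !phiE yy !zero_oneE.
have r10 : r1 != 0 by apply: contraNneq qn0 => z0; rewrite E23 z0 rs0 addr0 !phiE aa !zero_oneE.
have rs0' w (k : K) : w != 0 -> k != 0 -> rscale w k != 0.
  by move=> w0 k0; apply/eqP => /rs_eq0 -/(_ K_unit w0) /eqP; rewrite (negPf k0).
have [a0 y0] := phi1_neq0 ay.
exists (mk4 (- rscale a r0) (- rscale y r1) (rscale p2 x) (- p3)); split.
- rewrite L0E; apply: I4P; rewrite /mk4 /=.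
  + split; first by rewrite -rsN; exact: isoPZ.
    by apply: nL; rewrite ?oppr_eq0 ?rs0' ?phiNr ?phiZr ?(hza H) ?mul0r ?oppr0.
  + split; first by rewrite -rsN; exact: isoPZ.
    by apply: nL; rewrite ?oppr_eq0 ?rs0' ?phiNr ?phiZr ?(hzy H) ?mul0r ?oppr0.
  + by split; [exact: isoPZ|apply: nL; rewrite ?rs0' ?phiZr ?zp2 ?mul0r].
  + split; first by rewrite -[p3]rs1 -rsN; exact: isoPZ.
    by apply: nL; rewrite ?oppr_eq0 ?phiNr ?zp3 ?oppr0.
- by rewrite /mk4 /= -opprD -addrA E23 addNr.
- rewrite /mk4 /=.
  (* The symmetry relation is obtained by comparing [q] on the two sides, each a sum of two
     isotropic vectors, and dividing by 2. *)
  have E : rscale p2 x - rscale y r1 = p3 + rscale a r0.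
    by apply/eqP; rewrite subr_eq -addrA -E23 addrC subrK.
  apply: halve_inj; have := congr1 (fun d => phi d d) E.
  rewrite !phiE p22 p33 aa yy !zero_oneE (sC _ p2) (sC p3 a) !sid.
  by rewrite !opprK (comm x) (comm _ r0) -!mulrA (mulrA (phi p2 y)) (mulrA r1) (comm r1) -!mulrA.
Qed.

(** Six vectors in dimension 5 are dependent, and pairing with the frame leaves a relation between
    [w] and [w'] alone. *)
Lemma dim5_core_line : dim V = 5%N -> core_line.
Proof.
move=> d5 a b y z H w w' C C' w0.
have [bs bsE] := spanned_dim V.
pose s : 'I_6 -> V := fun i => nth 0 [:: a; b; y; z; w; w'] i.
have [||x [[i xi] E]] := linear_dependence K_unit (y := bs) (z := s); rewrite ?d5//.
  by move=> i; rewrite bsE.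
move: E; rewrite !big_ord_recl big_ord0 /s /= addr0.
set x0 := x _; set x1 := x _; set x2 := x _; set x3 := x _; set x4 := x _; set x5 := x _ => E.
have k p : phi p (rscale a x0 + (rscale b x1 + (rscale y x2 + (rscale z x3 + (rscale w x4 + rscale w' x5))))) = 0.
  by rewrite E !phiE.
have [x00 x10 x20 x30] : [/\ x0 = 0, x1 = 0, x2 = 0 & x3 = 0].
  split; [have := k y|have := k z|have := k a|have := k b];
    by rewrite !phiE !(gramE H) !(coreE C) !(coreE C') !zero_oneE.
move: E; rewrite x00 x10 x20 x30 !rs0 !add0r => E.
have x50 : x5 != 0.
  apply/eqP => x50; have x40 : x4 = 0.
    by move: E; rewrite x50 rs0 addr0 => /rs_eq0; apply.
  have xx : forall j, x j = 0.
    move=> [j jlt]; move: x00 x10 x20 x30 x40 x50; rewrite /x0 /x1 /x2 /x3 /x4 /x5.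
    by case: j jlt => [|[|[|[|[|[|//]]]]]] jlt h0 h1 h2 h3 h4 h5;
      [rewrite -h0|rewrite -h1|rewrite -h2|rewrite -h3|rewrite -h4|rewrite -h5]; congr x; exact: val_inj.
  by rewrite xx eqxx in xi.
exists (- (x4 * x5^-1)); rewrite rsN -rsA; apply/eqP; rewrite -addr_eq0 addrC.
rewrite -[w']rs1 -(KVr x50) -rsA -rsDl E rs0l //.
Qed.

(** If [w2] is the part of [w'] orthogonal to [w], a square root [s] of [- q(w2) / q(w)] makes
    [w2 + w s] isotropic, hence zero by anisotropy of the core. *)
Lemma sqrt_core_line : sigma =1 id -> (forall x : K, exists y : K, x = y * y) -> core_line.
Proof.
move=> sid sq a b y z H w w' C C' w0.
have comm (x x' : K) : x * x' = x' * x by rewrite -(sid (x * x')) sM !sid.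
have q0 : phi w w != 0 by apply: contraNneq w0 => h; rewrite (core_aniso H C h).
pose r := (phi w w)^-1 * phi w w'; pose w2 := w' - rscale w r.
have ww2 : phi w w2 = 0 by rewrite /w2 phiDr phiNr phiZr /r mulrA KVr// mul1r subrr.
have w2w := phi_eq0C ww2.
have [s sE] := sq (- (phi w2 w2 * (phi w w)^-1)).
have w2E : w' = w2 + rscale w r by rewrite subrK.
have C2 : core a b y z (w2 + rscale w s).
  by apply: coreI; rewrite /w2 !phiE !(coreE C) !(coreE C') !zero_oneE.
clearbody w2; have := core_aniso H C2.
rewrite !phiE ww2 w2w sid !zero_oneE mulrA (comm s) -mulrA -sE mulrN (comm (phi w w)) -mulrA KV// mulr1 subrr => /(_ erefl) E.
exists (r - s); move/eqP: E; rewrite addr_eq0 => /eqP w2s.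
by rewrite w2E w2s rsDr rsN addrC.
Qed.

(** On a line the values of a quadratic form differ by squares. *)
Lemma core_line_square c : sigma =1 id -> core_line -> 1 - c != 0 ->
  (exists w w', [/\ core_orthogonal phi e w, w != 0, core_orthogonal phi e w', w' != 0
     & 1 - c = phi w w * (phi w' w')^-1]) <-> exists x, 1 - c = x * x.
Proof.
move=> sid cl c1.
have comm (x x' : K) : x * x' = x' * x by rewrite -(sid (x * x')) sM !sid.
split=> [[w [w' [/core_orthogonalP C w0 /core_orthogonalP C' w'0 cE]]]|[x xE]].
  have [x wE] := cl _ _ _ _ std_hyp4 _ _ C' C w'0; exists x.
  have q0 : phi w' w' != 0 by apply: contraNneq w'0 => h; rewrite (core_aniso std_hyp4 C' h).
  by rewrite cE wE !phiE sid (comm (phi w' w') x) -!mulrA KVr// mulr1.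
have [w C w0] := std_core_ex.
have q0 : phi w w != 0 by apply: contraNneq w0 => h; rewrite (core_aniso std_hyp4 C h).
have x0 : x != 0 by apply: contraNneq c1 => h; rewrite xE h mul0r.
exists (rscale w x), w; split=> //; try exact/core_orthogonalP.
- by apply/core_orthogonalP/coreI; rewrite phiZr (coreE C) mul0r.
- by apply/eqP => /rs_eq0 -/(_ K_unit w0) /eqP; rewrite (negPf x0).
- by rewrite xE !phiE sid (comm (phi w w) x) -!mulrA KVr// mulr1.
Qed.

(** * Translation to quadripods *)

(** A repeated value could be omitted, leaving at most [n] values for [n.+1] indices. This converts
    the cardinality in the definition of quadripods into distinctness. *)
Lemma card_range_I (A : Type) n (X : 'I_n -> A) : (range X #= `I_n)%card <-> injective X.
Proof.
split=> [h|inj]; last first.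
  rewrite (card_eql (inj_card_eq _)); first by rewrite card_eq_sym; exact: card_II.
  by move=> i j _ _; exact: inj.
move=> i j; apply: contraPP => ij Xij.
case: n => [|n] in X h i j ij Xij *; first by case: i {ij Xij}.
have sub : range X `<=` range (X \o lift j).
  move=> _ [k _ <-]; case: (unliftP j k) => [k' ->|->]; first by exists k'.
  case: (unliftP j i) ij => [i' iE _|iE]; last by rewrite iE.
  by exists i' => //=; rewrite -iE.
have : (`I_n.+1 #<= `I_n)%card.
  rewrite card_eq_sym in h; move: h; rewrite card_eq_le => /andP[h _].
  apply: (card_le_trans h); apply: (card_le_trans (subset_card_le sub)).
  apply: (card_le_trans (card_image_le _ _)).
  by have := @card_II n; rewrite card_eq_sym card_eq_le => /andP[].
by rewrite card_le_II ltnn.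
Qed.

(** Four of the eight chambers of the apartment. When all lines, or all planes, have the same image,
    the other four chambers give no new edge. *)
Definition diag_chamber (i : 'I_4) : apt_chamber e :=
  exist _ (i, i) (mem_set ((apt_incident e_free i i).2 (or_introl erefl))).

Lemma chamber_eq (c d : chamber v phi) : (\val c).1 = (\val d).1 -> (\val c).2 = (\val d).2 -> c = d.
Proof. by move=> h1 h2; apply: val_inj; rewrite [LHS]surjective_pairing [RHS]surjective_pairing h1 h2. Qed.

Lemma line_star_quadripod (f : Mor v phi e) :
  line_quadripod f <-> (forall i, line_space (mline f i) = line_space (mline f 0)) /\
    injective (fun i => plane_space (mplane f i)).
Proof.
have rng : (forall i, mline f i = mline f 0) ->
    image_chambers f = range (fun i => mchamber f (diag_chamber i)).
  move=> LL; apply/seteqP; split=> [_ [c _ <-]|_ [i _ <-]]; last by exists (diag_chamber i).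
  by exists (\val c).2 => //; apply: chamber_eq => //=; rewrite LL [RHS]LL.
split=> [[[card _] [l lE]]|[LL Pinj]].
  have LL i : mline f i = l by apply: (lE (mchamber f (diag_chamber i))); exists (diag_chamber i).
  split=> [i|i j /val_inj/val_inj Pij]; first by rewrite !LL.
  move: card; rewrite rng; last by move=> k; rewrite !LL.
  move=> /card_range_I; apply; apply: chamber_eq => //=; by rewrite !LL.
have {}LL i : mline f i = mline f 0 by apply: val_inj; apply: val_inj; exact: LL.
split; last by exists (mline f 0) => _ [c _ <-] /=; rewrite LL.
split; last by move=> _ _ [c _ <-] [d _ <-]; left; rewrite /= LL [RHS]LL.
rewrite rng//; apply/card_range_I => i j /(congr1 (fun c => plane_space (\val c).2)) /=; exact: Pinj.
Qed.

Lemma plane_star_quadripod (f : Mor v phi e) :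
  plane_quadripod f <-> (forall i, plane_space (mplane f i) = plane_space (mplane f 0)) /\
    injective (fun i => line_space (mline f i)).
Proof.
have rng : (forall i, mplane f i = mplane f 0) ->
    image_chambers f = range (fun i => mchamber f (diag_chamber i)).
  move=> LL; apply/seteqP; split=> [_ [c _ <-]|_ [i _ <-]]; last by exists (diag_chamber i).
  by exists (\val c).1 => //; apply: chamber_eq => //=; rewrite LL [RHS]LL.
split=> [[[card _] [l lE]]|[LL Pinj]].
  have LL i : mplane f i = l by apply: (lE (mchamber f (diag_chamber i))); exists (diag_chamber i).
  split=> [i|i j /val_inj/val_inj Pij]; first by rewrite !LL.
  move: card; rewrite rng; last by move=> k; rewrite !LL.
  move=> /card_range_I; apply; apply: chamber_eq => //=; by rewrite !LL.
have {}LL i : mplane f i = mplane f 0 by apply: val_inj; apply: val_inj; exact: LL.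
split; last by exists (mplane f 0) => _ [c _ <-] /=; rewrite LL.
split; last by move=> _ _ [c _ <-] [d _ <-]; right; rewrite /= LL [RHS]LL.
rewrite rng//; apply/card_range_I => i j /(congr1 (fun c => line_space (\val c).1)) /=; exact: Pinj.
Qed.

Lemma closure_or_star (f : Mor v phi e) :
  [\/ closure (Mor_inj v phi e) f, line_quadripod f | plane_quadripod f].
Proof.
have fI := msp_id f.
case: (classification (msp_cfg fI)) => [/(inSP fI)|/line_star_quadripod|/plane_star_quadripod] h.
- exact: Or31.
- exact: Or32.
- exact: Or33.
Qed.

Lemma line_quadripod_closure (f : Mor v phi e) : line_quadripod f ->
  closure (Mor_inj v phi e) f <-> symmetric_quadripod f.
Proof.
move=> /line_star_quadripod[LL Pinj]; have fI := msp_id f; have cf := msp_cfg fI.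
split=> [/(inSP fI)|[_ s]]; first exact: inS_symS.
by apply/(inSP fI); exact: symV_inS.
Qed.

Lemma plane_quadripod_nid (f : Mor v phi e) :
  (forall g k, g != 0 -> k != 0 -> sigma k = k -> exists A x : K, [/\ A != 0,
     sigma (A * g) = - (A * g) & A + sigma A = sigma x * k * x]) ->
  plane_quadripod f -> closure (Mor_inj v phi e) f.
Proof.
move=> norm /plane_star_quadripod[PP Linj]; have fI := msp_id f; have cf := msp_cfg fI.
have [c [u1 [u2 [i12 nf c0 c1]]]] := star_normal_form cf PP Linj.
apply/(inSP fI); apply: (star_suff_nid cf PP Linj i12 nf) => k k0 sk.
by apply: norm => //; rewrite subr_eq0 eq_sym.
Qed.

(** The side conclusion [c != 1] is needed when [1 - c] is compared with squares, zero being a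
    square but not a quotient of nonzero values. *)
Lemma plane_quadripod_id (f : Mor v phi e) c : (forall x : K, exists r : F, x = r%:A) ->
  sigma =1 id -> plane_quadripod f -> cross_ratio f c ->
  (closure (Mor_inj v phi e) f <-> exists w w', [/\ core_orthogonal phi e w, w != 0,
     core_orthogonal phi e w', w' != 0 & 1 - c = phi w w * (phi w' w')^-1]) /\ c != 1.
Proof.
move=> /choice[kf kfE] sid /plane_star_quadripod[PP Linj].
have fI := msp_id f; have cf := msp_cfg fI.
move=> /(cross_ratioP _ fI PP)[u1 [u2 [i12 nf]]]; split; last by case: (normal_form_neq Linj nf).
split=> [/(inSP fI) inn|[w [w' [C w0 C' w'0 E]]]].
  exact: (star_nec kfE sid cf PP Linj i12 nf inn).
by apply/(inSP fI); exact: (star_suff_id sid cf PP Linj i12 nf C w0 C' w'0 E).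
Qed.

Lemma plane_quadripod_cross_ratio (f : Mor v phi e) : plane_quadripod f ->
  exists c, cross_ratio f c.
Proof.
move=> /plane_star_quadripod[PP Linj]; have fI := msp_id f; have cf := msp_cfg fI.
have [c [u1 [u2 [i12 nf _ _]]]] := star_normal_form cf PP Linj.
by exists c; apply/(cross_ratioP _ fI PP); exists u1, u2.
Qed.

Lemma line_quadripod_core_line (f : Mor v phi e) : sigma =1 id -> core_line ->
  line_quadripod f -> closure (Mor_inj v phi e) f.
Proof.
move=> sid cl /line_star_quadripod[LL Pinj]; have fI := msp_id f; have cf := msp_cfg fI.
by apply/(inSP fI); apply: symV_inS => //; exact: core_line_symV.
Qed.

Lemma plane_quadripod_core_line (f : Mor v phi e) c : (forall x : K, exists r : F, x = r%:A) ->
  sigma =1 id -> core_line -> plane_quadripod f -> cross_ratio f c ->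
  closure (Mor_inj v phi e) f <-> exists x, 1 - c = x * x.
Proof.
move=> kf sid cl qf cr; have [E c1] := plane_quadripod_id kf sid qf cr.
by rewrite E; apply: core_line_square => //; rewrite subr_eq0 eq_sym.
Qed.

End Geometry.

Theorem theorem13 (R : realType) (F : fieldType) (v : absolute_value R F)
    (K : falgType F) (sigma : K -> K) (V : vectType K^c)
    (phi : V -> V -> K) (e : 'I_4 -> V)
    (F_local : local_field v) (F_char : 2%N \notin [pchar F])
    (K_cases : \dim {:K} = 1%N \/ quaternion_division_algebra K)
    (sigma_invol : involutive_antiautomorphism sigma)
    (sigma_cont : sigma_continuous v sigma)
    (sigma_std : quaternion_division_algebra K -> ~ Hamilton_quaternions v K ->
       standard_quaternionic_involution sigma)
    (V_dim : (5 <= dim V)%N)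
    (phi_herm : hermitian_form sigma phi)
    (phi_nondeg : nondegenerate_form phi)
    (phi_index : Witt_index phi 2)
    (e_std : standard_frame phi e) :
  [/\ (* (1) *)
      forall f : Mor v phi e, ~ quadripod f -> closure (Mor_inj v phi e) f,
      (* (2) *)
      forall f : Mor v phi e, line_quadripod f ->
        (closure (Mor_inj v phi e) f <-> symmetric_quadripod f),
      (* (3) *)
      forall f : Mor v phi e, plane_quadripod f ->
        (closure (Mor_inj v phi e) f <->
          ~ (sigma =1 id) \/
          (sigma =1 id /\
           exists c, cross_ratio f c /\
             exists w w',
               [/\ core_orthogonal phi e w, w != 0,
                   core_orthogonal phi e w', w' != 0
                 & 1 - c = phi w w * (phi w' w')^-1]))
    & (* the case where sigma is the identity *)
      sigma =1 id ->
      [/\ dim V = 5%N -> forall f : Mor v phi e, line_quadripod f ->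
            closure (Mor_inj v phi e) f,
          dim V = 5%N -> forall (f : Mor v phi e) (c : K),
            plane_quadripod f -> cross_ratio f c ->
            (closure (Mor_inj v phi e) f <-> exists x : K, 1 - c = x ^+ 2),
          dim V = 5%N -> \dim {:K} = 1%N ->
            forall h : {rmorphism R -> F}, topological_iso v h ->
            forall (f : Mor v phi e) (r : R),
            plane_quadripod f -> cross_ratio f (h r)%:A ->
            (closure (Mor_inj v phi e) f <-> r <= 1),
          dim V = 5%N -> \dim {:K} = 1%N ->
            (exists h : {rmorphism R[i] -> F}, topological_iso v h) ->
            forall f : Mor v phi e, plane_quadripod f ->
            closure (Mor_inj v phi e) f
        & \dim {:K} = 1%N ->
            (exists h : {rmorphism R[i] -> F}, topological_iso v h) ->
            closure (Mor_inj v phi e) = [set: Mor v phi e]]].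
Proof.
have K_unit := division_unit K_cases.
have sS := sigma_scalar F_char K_cases sigma_invol.
have [t [t0 ts tc]] := small_scalars F_local sigma_invol sigma_cont sS.
have cases := closure_or_star K_unit sigma_invol phi_herm F_char phi_nondeg phi_index e_std V_dim
  t0 ts tc.
have pid := @plane_quadripod_id _ _ _ _ _ _ _ _ K_unit sigma_invol phi_herm F_char phi_nondeg
  phi_index e_std _ t0 ts tc F_local sigma_cont sS.
have lcl := @line_quadripod_core_line _ _ _ _ _ _ _ _ K_unit sigma_invol phi_herm F_char phi_nondeg
  phi_index e_std V_dim _ t0 ts tc.
have pcl := @plane_quadripod_core_line _ _ _ _ _ _ _ _ K_unit sigma_invol phi_herm F_char phi_nondeg
  phi_index e_std V_dim _ t0 ts tc F_local sigma_cont sS.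
have pcr := @plane_quadripod_cross_ratio _ _ v _ _ _ _ _ K_unit sigma_invol phi_herm F_char phi_nondeg
  phi_index e_std.
have d5 := dim5_core_line K_unit sigma_invol phi_herm.
split.
- by move=> f nq; case: (cases f) => // -[].
- by move=> f; apply: (line_quadripod_closure K_unit sigma_invol phi_herm F_char phi_nondeg
    phi_index e_std V_dim t0 ts tc F_local sigma_cont sS).
- move=> f qf; have [sid|nid] := pselect (sigma =1 id); last first.
    split=> _; first by left.
    apply: (plane_quadripod_nid K_unit sigma_invol phi_herm F_char phi_nondeg phi_index e_std
      V_dim t0 ts tc _ qf).
    exact: (norm_equation F_char K_cases sigma_invol sigma_std nid).
  have Ks := id_scalar F_char K_cases sigma_invol sid.
  split=> [clf|[//|[_ [c [cr ww]]]]]; last by have [h _] := pid f c Ks sid qf cr; exact/h.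
  have [c cr] := pcr f qf; right; split=> //; exists c; split=> //.
  by have [h _] := pid f c Ks sid qf cr; exact/h.
- move=> sid; have Ks := id_scalar F_char K_cases sigma_invol sid.
  have AM (a b : F) : (a * b)%:A = a%:A * b%:A :> K by rewrite mulr_algl scalerA.
  have sq : (exists h : {rmorphism R[i] -> F}, topological_iso v h) ->
      forall x : K, exists y : K, x = y * y.
    move=> [h ih] x; have [r ->] := Ks x; have [s ->] := complex_square ih r.
    by exists s%:A; rewrite AM.
  have plane_sq : core_line phi -> (forall x : K, exists y : K, x = y * y) ->
      forall f : Mor v phi e, plane_quadripod f -> closure (Mor_inj v phi e) f.
    move=> cl sqK f qf; have [c cr] := pcr f qf; apply/(pcl f c Ks sid cl qf cr).
    exact: sqK.
  split.
  + by move=> V5 f; apply: (lcl f sid (d5 V5)).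
  + by move=> V5 f c qf cr; apply: (pcl f c Ks sid (d5 V5) qf cr).
  + move=> V5 _ h ih f r qf cr.
    rewrite (pcl f _ Ks sid (d5 V5) qf cr) -subr_ge0 -(real_square _ ih).
    have hE : (h (1 - r))%:A = 1 - (h r)%:A :> K by rewrite rmorphB rmorph1 scalerBl scale1r.
    split=> [[x]|[x xE]]; last by exists x%:A; rewrite -hE xE AM.
    have [s ->] := Ks x => E; exists s; apply: (@scal_inj _ K); rewrite AM -E; exact: hE.
  + by move=> V5 _ ih; apply: plane_sq; [exact: d5|exact: sq].
  (* No bound on [dim V] is assumed here: square roots in [K] already make the anisotropic part
     one-dimensional. *)
  + move=> _ ih; have cl := sqrt_core_line K_unit sigma_invol phi_herm phi_index sid (sq ih).
    apply/seteqP; split=> // f _; case: (cases f) => // qf; first exact: (lcl f sid cl qf).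
    exact: (plane_sq cl (sq ih) f qf).
Qed.
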